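(* Let $G$ be a diffeological group, $A$ an abelian group, $k\geq 0$, and $\alpha$ an element of $H^k(BG;A)$. Then the characteristic class $\alpha(\cdot)$ for $\mathcal D$-numerable principal $G$-bundles, given by $\alpha(P)=f_P^*\alpha\in H^k(X;A)$ where $f_P:X\to BG$ is a classifying map of $P\to X$, extends to a characteristic class for diffeological principal $G$-bundles.
   Context: A diffeological space is a set $X$ with a set $D_X$ of maps $U\to X$ (plots), $U$ open in some $\mathbb R^n$, that contains all constant maps, is local and is closed under precomposition with smooth maps between open subsets of Euclidean spaces. A map $f:X\to Y$ is smooth if $f\circ p$ is a plot for every plot $p$. $\mathcal D$ is the category of diffeological spaces and smooth maps; subsets carry the sub-diffeology; the final structure for a family of maps is the finest diffeology making them smooth; open subsets of $X$ refer to the final topology for the plots. A diffeological group is a group object in $\mathcal D$. Cohomology. Let $\mathbb A^p=\{x\in\mathbb R^{p+1}:\sum x_i=1\}$ and $\Delta^p_{\mathrm{sub}}=\{x\in\mathbb A^p:x_i\ge0\}$ with the sub-diffeology of $\mathbb R^{p+1}$. The standard simplex $\Delta^p$ is the same set as $\Delta^p_{\mathrm{sub}}$ with diffeology defined inductively: $\Delta^p=\Delta^p_{\mathrm{sub}}$ for $p\le1$; for $p\ge2$ it has the final structure for the maps $\varphi_i:\Delta^{p-1}\times[0,1)\to\Delta^p$, $\varphi_i(x,t)=(1-t)(i)+t\,d^i(x)$ $(0\le i\le p)$, where $(i)$ is the $i$-th vertex, $d^i$ is the affine map onto the $i$-th face ($d^i((k))=(k)$ for $k<i$, $(k+1)$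 for $k\ge i$), and $[0,1)$ has the sub-diffeology of $\mathbb R$. $\Delta^\bullet$ is a cosimplicial diffeological space, $S^{\mathcal D}(X)=\mathcal D(\Delta^\bullet,X)$, and $H^*(X;A)=H^*\mathrm{Hom}(\mathbb ZS^{\mathcal D}(X),A)$, where the free simplicial abelian group $\mathbb ZK$ on a simplicial set $K$ is a chain complex via $\partial=\sum(-1)^id_i$. Bundles. Let $\mathcal DG/X$ be the category of diffeological spaces with smooth right $G$-action over $X$ (trivial action on $X$). An object $\pi:E\to X$ of $\mathcal DG/X$ is a locally trivial principal $G$-bundle if there is an open cover $\{U_i\}$ of $X$ (a trivialization open cover) with each $\pi^{-1}(U_i)\to U_i$ $G$-equivariantly diffeomorphic over $U_i$ to $U_i\times G\to U_i$. It is $\mathcal D$-numerable if it has a trivialization open cover admitting a subordinate smooth partition of unity. An object $\pi:E\to X$ is a diffeological principal $G$-bundle if for every plot $p:U\to X$ the pullback $p^*E\to U$ is a locally trivial principal $G$-bundle. Every $\mathcal D$-numerable principal $G$-bundle is a diffeological principal $G$-bundle. Classifying space. $\pi_G:EG\to BG$ denotes Christensen–Wu's universal $\mathcal D$-numerable principal $G$-bundle: $EG$ is the quotient of $\{(t_i)\in\bigoplus_{i\in\mathbb N}\mathbb R: t_i\ge0,\sum t_i=1\}\times\prod_{i\in\mathbb N}G$ by $(t_i,g_i)\sim(t_i',g_i')$ iff $t_i=t_i'$ for all $i$ and $g_i=g'_i$ whenever $t_i\ne0$ (with $\bigoplus\mathbb R$ the colimit of the $\mathbb R^n$), with right action $[t_i,g_i]\cdot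 g=[t_i,g_ig]$, and $BG=EG/G$. For every diffeological space $X$, pulling back $EG$ gives a bijection from the set $[X,BG]_{\mathcal D}$ of smooth homotopy classes of smooth maps $X\to BG$ onto the set of isomorphism classes of $\mathcal D$-numerable principal $G$-bundles over $X$; a classifying map of $P$ is a smooth map $f_P:X\to BG$ with $f_P^*EG\cong P$. A characteristic class for a class $\mathcal P$ of smooth principal $G$-bundles is a rule assigning to each $\pi:P\to X$ in $\mathcal P$ a cohomology class $\alpha(P)$ of $X$ such that $\alpha(f^*P)=f^*\alpha(P)$ holds (for smooth maps $f$ into $X$). ''Extends'' means that the two rules agree on $\mathcal D$-numerable principal $G$-bundles. *)

(* Defs.v *)
From HB Require Import structures.
(* freeg comes first: its [lift] must not shadow fintype.lift. *)
From mathcomp Require Import generic_quotient freeg.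
From mathcomp Require Import all_boot all_order all_algebra.
From mathcomp Require Import boolp classical_sets functions cardinality fsbigop.
From mathcomp Require Import reals interval_inference topology normedtype landau derive.
Set Implicit Arguments.
Unset Strict Implicit.
Unset Printing Implicit Defensive.
Import Order.TTheory GRing.Theory Num.Theory numFieldNormedType.Exports.
Local Open Scope quotient_scope.
Local Open Scope classical_set_scope.
Local Open Scope ring_scope.

Section Smooth.
Context {R : realType}.

(* Cn_on k U f: f is C^k on the open set U; for k > 0, f is differentiable on U
   and all its directional derivatives are C^(k-1) on U. *)
Fixpoint Cn_on (k : nat) (V W : normedModType R) (U : set V) (f : V -> W) : Prop :=
  match k with
  | 0 => forall x, U x -> {for x, continuous f}
  | k'.+1 => (forall x, U x -> differentiable f x) /\
             (forall v, Cn_on k' U ('D_v f))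
  end.

Definition smooth_on (V W : normedModType R) (U : set V) (f : V -> W) : Prop :=
  forall k, Cn_on k U f.

Section Basics.
Context {V : normedModType R}.
Implicit Types (W : normedModType R) (U : set V).

Lemma near_differentiable W (f g : V -> W) (x : V) :
  (\near x, f x = g x) -> differentiable f x -> differentiable g x.
Proof.
move=> fg df.
have -> : g = f + (g - f) by rewrite addrC subrK.
apply: differentiableD => //.
set h := g - f.
have h0 : \near x, h x = 0.
  near=> y; rewrite /h /GRing.add /GRing.opp /=; have -> : f y = g y by near: y.
  by rewrite subrr.
suff hd : h \o shift x = cst (h x) + (0 : V -> W) +o_ 0 id.
  have d0 : 'd h x = 0 :> (V -> W).
    by apply: (@diff_unique _ _ _ _ (\0 : {linear V -> W})) => //; exact: cst_continuous.
  by apply/diff_locallyP; rewrite d0; split => //; exact: cst_continuous.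
apply: eqaddoE; rewrite addr0.
have -> : cst (h x) = 0 :> (V -> W) by apply/funext => y /=; exact: (nbhs_singleton h0).
rewrite add0r; apply/eqoP => _ /posnumP[e]; near=> y => /=.
suff -> : h (y + x) = 0 by rewrite normr0 mulr_ge0.
by near: y; move: h0; rewrite (near_shift 0 x) subr0.
Unshelve. all: by end_near. Qed.

Lemma Cn_subset W k (U U' : set V) (f : V -> W) :
  U' `<=` U -> Cn_on k U f -> Cn_on k U' f.
Proof.
move=> UU'; elim: k f => [|k IH] f /=; first by move=> h x /UU'; exact: h.
by move=> [df Df]; split=> [x /UU'|v]; [exact: df|exact: IH].
Qed.

Lemma Cn_eq W k (U : set V) (f g : V -> W) :
  open U -> (forall x, U x -> f x = g x) -> Cn_on k U f -> Cn_on k U g.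
Proof.
move=> oU; elim: k f g => [|k IH] f g fg /=.
  move=> cf x Ux; have /near_eq_cvg fgx : \near x, f x = g x.
    by apply: filterS fg _; exact: open_nbhs_nbhs.
  rewrite /prop_for /continuous_at -(fg _ Ux).
  by apply: cvg_trans (cf _ Ux); exact: fgx.
have near_fg x : U x -> \near x, f x = g x.
  by move=> Ux; apply: filterS fg _; exact: open_nbhs_nbhs.
move=> [df Df]; split=> [x Ux|v].
  by apply: (near_differentiable (near_fg _ Ux)); exact: df.
by apply: IH (Df v) => x Ux; apply: near_eq_derive; exact: near_fg.
Qed.

Lemma Cn_local W k (U : set V) (f : V -> W) :
  (forall x, U x -> exists2 U', U' x & Cn_on k U' f) -> Cn_on k U f.
Proof.
elim: k f => [|k IH] f /= h; first by move=> x /h[U' U'x]; apply.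
split=> [x /h[U' U'x [df _]]|v]; first exact: df.
by apply: IH => x /h[U' U'x [_ Df]]; exists U'.
Qed.

Lemma CnW W k (U : set V) (f : V -> W) : Cn_on k.+1 U f -> Cn_on k U f.
Proof.
elim: k f => [|k IH] f [df Df].
  by move=> x Ux; apply: differentiable_continuous; exact: df.
by split=> // v; apply: IH; exact: Df.
Qed.

Lemma Cn_cst W k (U : set V) (a : W) : Cn_on k U (cst a).
Proof.
elim: k a => [|k IH] a /=; first by move=> x _; exact: cst_continuous.
split=> [x _|v]; first exact: differentiable_cst.
have -> : 'D_v (cst a : V -> W) = cst 0 by apply/funext => x; exact: derive_cst.
exact: IH.
Qed.

Lemma Cn_id k (U : set V) : Cn_on k U (@idfun V).
Proof.
case: k => [|k] /=; first by move=> x _; exact: cvg_id.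
split=> [x _|v]; first exact: (@ex_diff _ _ _ _ _ idfun).
have -> : 'D_v (@idfun V) = cst v by apply/funext => x; exact: derive_id.
exact: Cn_cst.
Qed.

Lemma CnD W k (U : set V) (f g : V -> W) : open U ->
  Cn_on k U f -> Cn_on k U g -> Cn_on k U (f + g).
Proof.
move=> oU; elim: k f g => [|k IH] f g /=.
  by move=> cf cg x Ux; apply: continuousD; [exact: cf|exact: cg].
move=> [df Df] [dg Dg]; split=> [x Ux|v].
  by apply: differentiableD; [exact: df|exact: dg].
apply: Cn_eq (IH _ _ (Df v) (Dg v)) => // x Ux.
by rewrite deriveD //; apply: diff_derivable; [exact: df|exact: dg].
Qed.

Lemma Cn_sum W k (U : set V) n (f : 'I_n -> V -> W) : open U ->
  (forall i, Cn_on k U (f i)) -> Cn_on k U (\sum_(i < n) f i).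
Proof.
move=> oU h; elim/big_rec: _ => [|i g _ ?]; first exact: Cn_cst.
exact: CnD.
Qed.

Lemma Cn_linear W W' k (U : set V) (f : V -> W) (L : {linear W -> W'}) :
  open U -> continuous L -> Cn_on k U f -> Cn_on k U (L \o f).
Proof.
move=> oU cL; elim: k f => [|k IH] f /=.
  by move=> cf x Ux; apply: continuous_comp; [exact: cf|exact: cL].
move=> [df Df]; split=> [x Ux|v].
  apply: differentiable_comp; first exact: df.
  exact: linear_differentiable.
apply: Cn_eq (IH _ (Df v)) => // x Ux /=.
have dfx := df _ Ux.
have dLfx : differentiable L (f x) by exact: linear_differentiable.
have dLf : differentiable (L \o f) x by exact: differentiable_comp.
by rewrite (deriveE _ dfx) (deriveE _ dLf) (diff_comp dfx dLfx) (diff_lin _ cL).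
Qed.
End Basics.

Section Scale.
Context {W : normedModType R}.

Lemma scale_is_bilinear :
  bilinear_for
    (GRing.Scale.Law.clone _ _ *:%R _) (GRing.Scale.Law.clone _ _ *:%R _)
    (@GRing.scale R W : R -> W -> W).
Proof.
split=> [u'|u] a x y /=; first by rewrite scalerDl scalerA.
by rewrite scalerDr !scalerA mulrC.
Qed.
HB.instance Definition _ :=
  bilinear_isBilinear.Build R R W W _ _ (@GRing.scale R W : R -> W -> W)
    scale_is_bilinear.
Context {V : normedModType R}.

Let scale_bilinear : {bilinear R -> W -> W} := @GRing.scale R W : R -> W -> W.

Lemma differentiable_scale (a : V -> R) (f : V -> W) x :
  differentiable a x -> differentiable f x ->
  differentiable (fun y => a y *: f y) x.
Proof.
move=> da df; have -> : (fun y => a y *: f y) =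
  (fun p => scale_bilinear p.1 p.2) \o (fun y => (a y, f y)) by [].
apply: differentiable_comp; first exact: differentiable_pair.
by apply: (@differentiable_bilin _ _ _ _ scale_bilinear) => ?; exact: scale_continuous.
Qed.

Lemma derive_scale (a : V -> R) (f : V -> W) x v :
  differentiable a x -> differentiable f x ->
  'D_v (fun y => a y *: f y) x = 'D_v a x *: f x + a x *: 'D_v f x.
Proof.
move=> da df; rewrite !deriveE //; last exact: differentiable_scale.
have -> : (fun y => a y *: f y) =
  (fun p => scale_bilinear p.1 p.2) \o (fun y => (a y, f y)) by [].
have c : continuous (fun p : R * W => scale_bilinear p.1 p.2).
  by move=> ?; exact: scale_continuous.
have d1 := differentiable_pair da df.
have d2 := differentiable_bilin (a x, f x) c.
by rewrite (diff_comp d1 d2) diff_bilin //= diff_pair //= addrC.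
Qed.

Lemma CnZ k (U : set V) (a : V -> R) (f : V -> W) : open U ->
  Cn_on k U a -> Cn_on k U f -> Cn_on k U (fun y => a y *: f y).
Proof.
move=> oU; elim: k a f => [|k IH] a f.
  by move=> ca cf x Ux; apply: (cvgZ (ca _ Ux) (cf _ Ux)).
move=> Ca Cf; have [[da Da] [df Df]] := (Ca, Cf); split=> [x Ux|v].
  by apply: differentiable_scale; [exact: da|exact: df].
apply: (@Cn_eq _ _ _ _ ((fun y => 'D_v a y *: f y) + (fun y => a y *: 'D_v f y))) => //.
  by move=> x Ux; rewrite derive_scale //; [exact: da|exact: df].
by apply: CnD => //; [exact: (IH _ _ (Da v) (CnW Cf))|exact: (IH _ _ (CnW Ca) (Df v))].
Qed.
End Scale.

Definition coordf n (i : 'I_n) (x : 'rV[R]_n) : R := x 0 i.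

Fact coordf_linear n (i : 'I_n) : linear (@coordf n i).
Proof. by move=> a x y; rewrite /coordf !mxE. Qed.
HB.instance Definition _ n i :=
  GRing.isLinear.Build R 'rV[R]_n R *:%R _ (@coordf_linear n i).

Lemma Cn_comp k m n (W : normedModType R) (U : set 'rV[R]_m) (U' : set 'rV[R]_n)
    (f : 'rV[R]_m -> 'rV[R]_n) (g : 'rV[R]_n -> W) :
  open U -> open U' -> (forall x, U x -> U' (f x)) ->
  Cn_on k U f -> Cn_on k U' g -> Cn_on k U (g \o f).
Proof.
move=> oU oU' UU'; elim: k g => [|k IH] g Cf Cg.
  move=> x Ux; apply: continuous_comp; first exact: Cf.
  by apply: Cg; exact: UU'.
have [[df Df] [dg Dg]] := (Cf, Cg); split=> [x Ux|v].
  by apply: differentiable_comp; [exact: df|apply: dg; exact: UU'].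
apply: (@Cn_eq _ _ _ _ (\sum_(i < n) (fun x => 'D_v (coordf i \o f) x *:
          ('D_(delta_mx 0 i) g \o f) x))) => //.
  move=> x Ux; have dfx := df _ Ux; have dgx := dg _ (UU' _ Ux).
  have dgf : differentiable (g \o f) x by exact: differentiable_comp.
  rewrite (deriveE _ dgf) (diff_comp dfx dgx) /= [in RHS](row_sum_delta ('d f x v)) linear_sum fct_sumE.
  apply: eq_bigr => i _; rewrite linearZ /=; congr (_ *: _); last first.
    by rewrite deriveE.
  have cf : continuous (coordf i : 'rV[R]_n -> R) by exact: coord_continuous.
  have dc : differentiable (coordf i) (f x) by exact: linear_differentiable.
  have dcf : differentiable (coordf i \o f) x by exact: differentiable_comp.
  by rewrite (deriveE _ dcf) (diff_comp dfx dc) (diff_lin _ cf).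
apply: Cn_sum => // i; apply: CnZ => //; last exact: (IH _ (CnW Cf) (Dg _)).
have /= : Cn_on k.+1 U (coordf i \o f).
  by apply: Cn_linear => //; exact: coord_continuous.
by case=> _; exact.
Qed.

End Smooth.

(* A plot U -> X is represented by a total function on R^n, of which only the
   restriction to U is relevant (plot_ext); an empty X has no such function,
   but then its only plots would be the empty ones. *)
Record diffeology (R : realType) (X : Type) := Diffeology {
  plot : forall n, set 'rV[R]_n -> ('rV[R]_n -> X) -> Prop;
  plot_open : forall n (U : set 'rV[R]_n) p, plot U p -> open U;
  plot_ext : forall n (U : set 'rV[R]_n) p q,
    (forall u, U u -> p u = q u) -> plot U p -> plot U q;
  plot_cst : forall n (U : set 'rV[R]_n) x, open U -> plot U (fun=> x);
  plot_local : forall n (U : set 'rV[R]_n) p, open U ->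
    (forall u, U u -> exists V, [/\ V u, V `<=` U & plot V p]) -> plot U p;
  plot_comp : forall m n (V : set 'rV[R]_m) (U : set 'rV[R]_n) p f,
    plot U p -> open V -> smooth_on V f -> (forall v, V v -> U (f v)) ->
    plot V (p \o f) }.

Record dspace (R : realType) := DSpace {
  dcarrier :> Type;
  dstruct : diffeology R dcarrier }.

Section Spaces.
Context {R : realType}.
Implicit Types X Y Z : dspace R.

Definition is_plot X n (U : set 'rV[R]_n) (p : 'rV[R]_n -> X) : Prop :=
  plot (dstruct X) U p.

Definition dsmooth X Y (f : X -> Y) : Prop :=
  forall n (U : set 'rV[R]_n) (p : 'rV[R]_n -> X),
    is_plot U p -> is_plot U (f \o p).

Record smooth_map X Y := SmoothMap {
  sm_fun :> X -> Y;
  sm_smooth : dsmooth sm_fun }.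

HB.instance Definition _ X Y := gen_eqMixin (smooth_map X Y).
HB.instance Definition _ X Y := gen_choiceMixin (smooth_map X Y).

Lemma smooth_map_eq X Y (f g : smooth_map X Y) : f =1 g -> f = g.
Proof.
case: f g => [f sf] [g sg] /= /funext fg; case: _ / fg in sg *.
by rewrite (Prop_irrelevance sf sg).
Qed.

Lemma dsmooth_comp X Y Z (f : X -> Y) (g : Y -> Z) :
  dsmooth f -> dsmooth g -> dsmooth (g \o f).
Proof. by move=> sf sg n U p /sf/sg. Qed.

Definition smooth_comp X Y Z (g : smooth_map Y Z) (f : smooth_map X Y) :
  smooth_map X Z := SmoothMap (dsmooth_comp (sm_smooth f) (sm_smooth g)).

(* The standard diffeology, used for R^n and R. *)
Section Standard.
Variable W : normedModType R.

Definition std_plot n (U : set 'rV[R]_n) (p : 'rV[R]_n -> W) : Prop :=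
  open U /\ smooth_on U p.

Program Definition std_diffeology : diffeology R W :=
  @Diffeology R W std_plot _ _ _ _ _.
Next Obligation. by move=> n U p []. Qed.
Next Obligation.
by move=> n U p q pq [oU sp]; split=> // k; exact: Cn_eq pq (sp k).
Qed.
Next Obligation. by move=> n U x oU; split=> // k; exact: Cn_cst. Qed.
Next Obligation.
move=> n U p oU h; split=> // k; apply: Cn_local => u /h[V [Vu _ [_ sp]]].
by exists V.
Qed.
Next Obligation.
move=> m n V U p f [oU sp] oV sf VU; split=> // k.
exact: Cn_comp VU (sf k) (sp k).
Qed.
End Standard.

Definition euclid n : dspace R := DSpace (std_diffeology 'rV[R]_n).
Definition dline : dspace R := DSpace (std_diffeology R).

Section Induced.
Variables (T : Type) (X : dspace R) (f : T -> X).

Definition induced_plot n (U : set 'rV[R]_n) (p : 'rV[R]_n -> T) : Prop :=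
  is_plot U (f \o p).

Program Definition induced_diffeology : diffeology R T :=
  @Diffeology R T induced_plot _ _ _ _ _.
Next Obligation. by move=> n U p; exact: plot_open. Qed.
Next Obligation.
by move=> n U p q pq; apply: plot_ext => u Uu /=; rewrite pq.
Qed.
Next Obligation. by move=> n U x oU; exact: plot_cst. Qed.
Next Obligation. by move=> n U p oU h; exact: plot_local. Qed.
Next Obligation. by move=> m n V U p g; exact: plot_comp. Qed.
End Induced.

Lemma sval_inj T (A : set T) (x y : {x | A x}) : sval x = sval y -> x = y.
Proof.
case: x y => x sx [y sy] /= xy; case: _ / xy in sy *.
by rewrite (Prop_irrelevance sx sy).
Qed.

Definition dsub X (A : set X) : dspace R :=
  DSpace (induced_diffeology (fun x : {x | A x} => sval x : X)).

Section Product.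
Variables (I : Type) (X : I -> dspace R).

Definition pi_plot n (U : set 'rV[R]_n) (p : 'rV[R]_n -> forall i, X i) : Prop :=
  open U /\ forall i, is_plot U (fun u => p u i).

Program Definition pi_diffeology : diffeology R (forall i, X i) :=
  @Diffeology R _ pi_plot _ _ _ _ _.
Next Obligation. by move=> n U p []. Qed.
Next Obligation.
move=> n U p q pq [oU hp]; split=> // i.
by apply: plot_ext (hp i) => u Uu; rewrite pq.
Qed.
Next Obligation. by move=> n U x oU; split=> // i; exact: plot_cst. Qed.
Next Obligation.
move=> n U p oU h; split=> // i; apply: plot_local => // u /h[V [Vu VU [_ hp]]].
by exists V; split=> //; exact: hp.
Qed.
Next Obligation.
move=> m n V U p f [oU hp] oV sf VU; split=> // i.
exact: (plot_comp (hp i) oV sf VU).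
Qed.
End Product.

Definition dpi I (X : I -> dspace R) : dspace R := DSpace (pi_diffeology X).

Section BinaryProduct.
Variables X Y : dspace R.

Definition prod_plot n (U : set 'rV[R]_n) (p : 'rV[R]_n -> X * Y) : Prop :=
  is_plot U (fun u => (p u).1) /\ is_plot U (fun u => (p u).2).

Program Definition prod_diffeology : diffeology R (X * Y) :=
  @Diffeology R _ prod_plot _ _ _ _ _.
Next Obligation. by move=> n U p [/plot_open]. Qed.
Next Obligation.
by move=> n U p q pq [p1 p2]; split; [apply: plot_ext p1|apply: plot_ext p2];
  move=> u Uu; rewrite pq.
Qed.
Next Obligation. by move=> n U x oU; split; exact: plot_cst. Qed.
Next Obligation.
by move=> n U p oU h; split; apply: plot_local => // u /h[V [Vu VU [p1 p2]]];
  exists V.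
Qed.
Next Obligation.
move=> m n V U p f [p1 p2] oV sf VU; split.
- exact: (plot_comp p1 oV sf VU).
- exact: (plot_comp p2 oV sf VU).
Qed.
End BinaryProduct.

Definition dprod X Y : dspace R := DSpace (prod_diffeology X Y).

Lemma dsmooth_pair X Y Z (f : Z -> X) (g : Z -> Y) :
  dsmooth f -> dsmooth g -> dsmooth (fun z => (f z, g z) : dprod X Y).
Proof. by move=> sf sg n U p hp; split; [exact: sf|exact: sg]. Qed.

Lemma dsmooth_fst X Y : dsmooth (fst : dprod X Y -> X).
Proof. by move=> n U p []. Qed.

Lemma dsmooth_snd X Y : dsmooth (snd : dprod X Y -> Y).
Proof. by move=> n U p []. Qed.

Lemma dsmooth_sval X (A : set X) : dsmooth (fun x : dsub A => sval x).
Proof. by move=> n U p. Qed.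

(* The finest diffeology on T making all f i smooth: its plots are those of
   every such diffeology. *)
Section Final.
Variables (I : Type) (Y : I -> dspace R) (T : Type) (f : forall i, Y i -> T).

Definition final_plot n (U : set 'rV[R]_n) (p : 'rV[R]_n -> T) : Prop :=
  open U /\ forall D : diffeology R T,
    (forall i, @dsmooth (Y i) (DSpace D) (@f i)) -> plot D U p.

Program Definition final_diffeology : diffeology R T :=
  @Diffeology R T final_plot _ _ _ _ _.
Next Obligation. by move=> n U p []. Qed.
Next Obligation.
move=> n U p q pq [oU hp]; split=> // D hD.
exact: plot_ext pq (hp D hD).
Qed.
Next Obligation. by move=> n U x oU; split=> // D hD; exact: plot_cst. Qed.
Next Obligation.
move=> n U p oU h; split=> // D hD; apply: plot_local => // u /h.
by move=> [V [Vu VU [_ /(_ D hD)]]]; exists V.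
Qed.
Next Obligation.
move=> m n V U p g [oU hp] oV sg VU; split=> // D hD.
exact: (plot_comp (hp D hD) oV sg VU).
Qed.

Definition dfinal : dspace R := DSpace final_diffeology.

Lemma final_smooth i : @dsmooth (Y i) dfinal (@f i).
Proof.
move=> n U p hp; split; first exact: plot_open hp.
by move=> D hD; exact: hD.
Qed.

Lemma final_universal Z (g : T -> Z) :
  (forall i, dsmooth (g \o @f i)) -> @dsmooth dfinal Z g.
Proof.
move=> sg n U p [oU hp]; apply: (hp (induced_diffeology g)) => i m V q hq.
exact: (sg i m V q hq).
Qed.
End Final.

(* The D-topology: final topology for the plots. *)
Definition dopen X (A : set X) : Prop :=
  forall n (U : set 'rV[R]_n) (p : 'rV[R]_n -> X),
    is_plot U p -> open (U `&` p @^-1` A).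

Definition dclosure X (A : set X) : set X :=
  [set x | forall B, dopen B -> B x -> B `&` A !=set0].

End Spaces.
Arguments dline {R}.

Section Quotients.
Context {R : realType}.

Record eqrel (T : Type) := EqRel {
  eqr :> T -> T -> Prop;
  eqr_refl : forall x, eqr x x;
  eqr_sym : forall x y, eqr x y -> eqr y x;
  eqr_trans : forall y x z, eqr x y -> eqr y z -> eqr x z }.

Section QuotientSet.
Variables (T : Type) (r : eqrel T).

Definition eqrb : rel {classic T} := fun x y => `[< r x y >].

Fact eqrb_refl : reflexive eqrb.
Proof. by move=> x; apply/asboolP; exact: eqr_refl. Qed.

Fact eqrb_sym : symmetric eqrb.
Proof. by move=> x y; apply/asboolP/asboolP; exact: eqr_sym. Qed.

Fact eqrb_trans : transitive eqrb.
Proof.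
by move=> y x z /asboolP xy /asboolP yz; apply/asboolP; exact: eqr_trans xy yz.
Qed.

Canonical eqrb_equiv := EquivRel eqrb eqrb_refl eqrb_sym eqrb_trans.
Canonical eqrb_equiv_direct := defaultEncModRel eqrb.

Definition quot : Type := {eq_quot eqrb}.

Definition class_of (x : T) : quot := \pi_({eq_quot eqrb}) x.
Definition repr_of (c : quot) : T := repr (c : {eq_quot eqrb}).

Lemma repr_ofK c : class_of (repr_of c) = c.
Proof. exact: reprK. Qed.

Lemma class_ofP x y : class_of x = class_of y <-> r x y.
Proof. by split=> [/eqmodP/asboolP//|rxy]; apply/eqmodP/asboolP. Qed.

Lemma repr_ofP x : r (repr_of (class_of x)) x.
Proof. by apply/class_ofP; rewrite repr_ofK. Qed.
End QuotientSet.

Definition dquot (X : dspace R) (r : eqrel X) : dspace R :=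
  @dfinal R unit (fun=> X) (quot r) (fun=> class_of r).

Lemma class_of_smooth (X : dspace R) (r : eqrel X) :
  @dsmooth R X (dquot r) (class_of r).
Proof. exact: (@final_smooth R unit (fun=> X) (quot r) (fun=> class_of r) tt). Qed.

(* Plots of a quotient are the maps lifting locally to plots. *)
Section QuotientPlots.
Variables (X : dspace R) (r : eqrel X).

Definition lift_plot n (U : set 'rV[R]_n) (p : 'rV[R]_n -> quot r) : Prop :=
  open U /\ forall u, U u -> exists V q,
    [/\ V u, V `<=` U, is_plot V q & forall v, V v -> p v = class_of r (q v)].

Program Definition lift_diffeology : diffeology R (quot r) :=
  @Diffeology R _ lift_plot _ _ _ _ _.
Next Obligation. by move=> n U p []. Qed.
Next Obligation.
move=> n U p q pq [oU hp]; split=> // u /hp[V [s [Vu VU sP ps]]].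
by exists V, s; split=> // v Vv; rewrite -ps // pq //; exact: VU.
Qed.
Next Obligation.
move=> n U x oU; split=> // u Uu; exists U, (fun=> repr_of x); split=> //.
  exact: plot_cst.
by move=> v _; rewrite repr_ofK.
Qed.
Next Obligation.
move=> n U p oU h; split=> // u /h[V [Vu VU [oV /(_ u Vu)[V' [q [V'u V'V qP pq]]]]]].
by exists V', q; split=> //; exact: subset_trans VU.
Qed.
Next Obligation.
move=> m n V U p f [oU hp] oV sf VU; split=> // v Vv.
have [U' [q [U'fv U'U qP pq]]] := hp _ (VU _ Vv).
have oU' := plot_open qP.
have oV' : open (V `&` f @^-1` U').
  rewrite openE => w [Vw U'fw]; apply: filterI; first exact: open_nbhs_nbhs.
  by apply: (sf 0 w Vw); exact: open_nbhs_nbhs.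
exists (V `&` f @^-1` U'), (q \o f); split=> //.
- apply: (plot_comp qP oV') => // [k|w []//].
  by apply: Cn_subset (sf k) => w [].
- by move=> w [_ /pq].
Qed.

Lemma quot_plotP n (U : set 'rV[R]_n) (p : 'rV[R]_n -> dquot r) :
  is_plot U p -> lift_plot U p.
Proof.
case=> oU /(_ lift_diffeology); apply => _ m V q qP.
split; first exact: plot_open qP.
by move=> v Vv; exists V, q; split.
Qed.
End QuotientPlots.
End Quotients.

Section Simplices.
Context {R : realType}.

Definition std_simplex p : set 'rV[R]_p.+1 :=
  [set x | \sum_i x 0 i = 1 /\ forall i, 0 <= x 0 i].

Definition simplex p : Type := {x : 'rV[R]_p.+1 | std_simplex x}.

Definition vertex p (i : 'I_p.+1) : 'rV[R]_p.+1 := delta_mx 0 i.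

(* The affine map with (k) |-> (lift i k); lift i k = k if k < i, k+1 if k >= i. *)
Definition coface_fun p (i : 'I_p.+2) (x : 'rV[R]_p.+1) : 'rV[R]_p.+2 :=
  \sum_(k < p.+1) x 0 k *: vertex (lift i k).

Lemma vertex_std p (i : 'I_p.+1) : std_simplex (vertex i).
Proof.
split=> [|j]; last by rewrite mxE eqxx /=; case: eqP.
rewrite (bigD1 i) //= big1 => [|j /negPf ji]; first by rewrite mxE !eqxx addr0.
by rewrite mxE ji andbF.
Qed.

Lemma convex_std p n (a : 'I_n -> R) (x : 'I_n -> 'rV[R]_p.+1) :
  \sum_i a i = 1 -> (forall i, 0 <= a i) -> (forall i, std_simplex (x i)) ->
  std_simplex (\sum_i a i *: x i).
Proof.
move=> a1 a0 sx; split=> [|j]; last first.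
  rewrite summxE sumr_ge0 // => i _; rewrite mxE mulr_ge0 //.
  by have [_ ->] := sx i.
rewrite (eq_bigr (fun j => \sum_i a i * x i 0 j)); last first.
  by move=> j _; rewrite summxE; apply: eq_bigr => i _; rewrite mxE.
rewrite exchange_big -[RHS]a1; apply: eq_bigr => i _.
by rewrite -mulr_sumr; have [-> _] := sx i; rewrite mulr1.
Qed.

Lemma convex2_std p (t : R) (x y : 'rV[R]_p.+1) : 0 <= t <= 1 ->
  std_simplex x -> std_simplex y -> std_simplex ((1 - t) *: x + t *: y).
Proof.
move=> /andP[t0 t1] sx sy.
have := @convex_std p 2 (fun i => if i == 0 then 1 - t else t)
  (fun i => if i == 0 then x else y).
rewrite !big_ord_recl !big_ord0 /= !addr0; apply; first by rewrite subrK.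
  by move=> i; case: ifP => // _; rewrite subr_ge0.
by move=> i; case: ifP.
Qed.

Lemma coface_std p (i : 'I_p.+2) (x : 'rV[R]_p.+1) :
  std_simplex x -> std_simplex (coface_fun i x).
Proof. by move=> [x1 x0]; apply: convex_std => // k; exact: vertex_std. Qed.

Definition coface p (i : 'I_p.+2) (x : simplex p) : simplex p.+1 :=
  exist _ (coface_fun i (sval x)) (coface_std i (svalP x)).

Definition half_open : set R := [set t | 0 <= t < 1].

Lemma phi_std p (i : 'I_p.+2) (x : simplex p) (t : {t | half_open t}) :
  std_simplex ((1 - sval t) *: vertex i + sval t *: coface_fun i (sval x)).
Proof.
apply: convex2_std; [|exact: vertex_std|exact/coface_std/svalP].
by case: t => t /= /andP[-> /ltW].
Qed.

(* x |-> (1 - t)(i) + t d^i(x) *)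
Definition phi p (i : 'I_p.+2) (xt : simplex p * {t | half_open t}) : simplex p.+1 :=
  exist _ _ (phi_std i xt.1 xt.2).

Definition half_open_space : dspace R := dsub (half_open : set dline).

(* Not the sub-diffeology of R^(p+1) for p >= 2. *)
Fixpoint simplex_diffeology p : diffeology R (simplex p) :=
  match p return diffeology R (simplex p) with
  | 0 => induced_diffeology (fun x : simplex 0 => sval x : euclid 1)
  | q.+1 =>
    match q return diffeology R (simplex q) -> diffeology R (simplex q.+1) with
    | 0 => fun _ => induced_diffeology (fun x : simplex 1 => sval x : euclid 2)
    | s.+1 => fun D =>
      final_diffeology (fun i : 'I_s.+3 =>
        @phi s.+1 i : dprod (DSpace D) half_open_space -> simplex s.+2)
    end (simplex_diffeology q)
  end.

Definition dsimplex p : dspace R := DSpace (simplex_diffeology p).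
End Simplices.

Section CofaceSmooth.
Context {R : realType}.
Notation dsimplex := (@dsimplex R).
Notation half_open_space := (@half_open_space R).

Fact coface_fun_linear p (i : 'I_p.+2) : linear (@coface_fun R p i).
Proof.
move=> a x y; rewrite /coface_fun scaler_sumr -big_split /=.
by apply: eq_bigr => k _; rewrite !mxE scalerDl scalerA.
Qed.
HB.instance Definition _ p i :=
  GRing.isLinear.Build R _ _ _ (@coface_fun R p i) (@coface_fun_linear p i).

Lemma coface_fun_vertex p (i : 'I_p.+2) k :
  coface_fun i (@vertex R p k) = vertex (lift i k).
Proof.
rewrite /coface_fun (bigD1 k) //= big1 => [|j /negPf jk].
  by rewrite mxE !eqxx scale1r addr0.
by rewrite mxE jk andbF scale0r.
Qed.

Fact lift_swap_proof p (i : 'I_p.+3) (j : 'I_p.+2) : (unbump j i < p.+2)%N.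
Proof.
rewrite /unbump; case: (ltnP j i) => ji; last by rewrite subn0 (leq_ltn_trans ji).
by rewrite subn1; case: (nat_of_ord i) (ltn_ord i) ji.
Qed.

Definition lift_swap p (i : 'I_p.+3) (j : 'I_p.+2) : 'I_p.+2 :=
  Ordinal (lift_swap_proof i j).

Lemma liftC p (i : 'I_p.+3) (j : 'I_p.+2) (k : 'I_p.+1) :
  lift i (lift j k) = lift (lift i j) (lift (lift_swap i j) k).
Proof. by apply/val_inj; exact: bumpC. Qed.

Lemma coface_phi p (i : 'I_p.+3) (j : 'I_p.+2) (xt : simplex p * {t | @half_open R t}) :
  coface i (phi j xt) = phi (lift i j) (coface (lift_swap i j) xt.1, xt.2).
Proof.
apply: sval_inj => /=; rewrite linearD !linearZ /= coface_fun_vertex.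
congr (_ + _ *: _).
rewrite [coface_fun j _]/coface_fun [coface_fun (lift_swap i j) _]/coface_fun.
rewrite !linear_sum /=; apply: eq_bigr => k _.
by rewrite !linearZ /= !coface_fun_vertex liftC.
Qed.

Lemma phi_smooth p (i : 'I_p.+3) :
  @dsmooth R (dprod (dsimplex p.+1) half_open_space) (dsimplex p.+2) (phi i).
Proof.
exact: (@final_smooth R 'I_p.+3 (fun=> dprod (dsimplex p.+1) half_open_space) _
  (fun i => @phi R p.+1 i) i).
Qed.

Fact half_open0 : @half_open R 0.
Proof. by rewrite /half_open /= lexx ltr01. Qed.

Let co1 (j : 'I_2) (x : simplex 1) : {t | @half_open R t} :=
  match pselect (half_open (1 - sval x 0 j)) with
  | left h => exist _ _ h
  | right _ => exist _ _ half_open0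
  end.

(* The sub-diffeology of Delta^1 also is final for the maps phi. *)
Lemma simplex1_universal (Z : dspace R) (g : simplex 1 -> Z) :
  (forall j : 'I_2, @dsmooth R (dprod (dsimplex 0) half_open_space) Z (g \o phi j)) ->
  @dsmooth R (dsimplex 1) Z g.
Proof.
move=> sg n U q qP; have oU := plot_open qP.
have [_ sq] : std_plot U (fun u => sval (q u)) by [].
have cq (j : 'I_2) k : Cn_on k U (fun u => sval (q u) 0 j).
  have cj : continuous (@coordf R 2 j : 'rV[R]_2 -> R) by exact: coord_continuous.
  exact: (Cn_linear oU cj (sq k)).
apply: plot_local => // u Uu.
have [j xj] : exists j : 'I_2, 0 < sval (q u) 0 j.
  have [x1 x0] := svalP (q u); apply: contrapT => /forallNP h.
  have : \sum_i sval (q u) 0 i <= 0.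
    by apply: sumr_le0 => i _; rewrite leNgt; apply/negP/h.
  by rewrite x1 ler10.
pose V := U `&` [set v | 0 < sval (q v) 0 j].
have oV : open V.
  rewrite openE => v [Uv xv]; apply: filterI; first exact: open_nbhs_nbhs.
  by apply: (cq j 0 v Uv [set y | 0 < y]); apply: open_nbhs_nbhs; split=> //; exact: open_gt.
have VU : V `<=` U by move=> v [].
pose pt : simplex 0 := exist _ _ (@vertex_std R 0 ord0).
pose r v : simplex 0 * {t | @half_open R t} := (pt, co1 j (q v)).
have co1E v : V v -> sval (co1 j (q v)) = 1 - sval (q v) 0 j.
  move=> [_ /= xv]; rewrite /co1; case: pselect => // -[].
  rewrite /half_open /= subr_ge0 gtrBl xv andbT.
  have [<- x0] := svalP (q v).
  by rewrite (bigD1 j) //= lerDl sumr_ge0.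
have rP : @is_plot R (dprod (dsimplex 0) half_open_space) n V r.
  split; first exact: plot_cst.
  split=> // k; apply: (@Cn_eq _ _ _ _ _ (cst 1 + (fun v => (-1) *: sval (q v) 0 j))) => //.
    by move=> v Vv; rewrite /= co1E // [LHS]/(1 + _) scaleN1r.
  apply: CnD => //; first exact: Cn_cst.
  by apply: CnZ => //; [exact: Cn_cst|exact: Cn_subset (cq j k)].
exists V; split=> //; apply: plot_ext (sg j n V r rP) => v Vv.
rewrite /comp; congr g; apply: sval_inj; rewrite /= co1E //.
rewrite [RHS]row_sum_delta (bigD1_ord j) //= subKr; congr (_ + _).
have [xs _] := svalP (q v).
have -> : 1 - sval (q v) 0 j = sval (q v) 0 (lift j ord0).
  rewrite -xs (bigD1_ord j) //= big_ord_recl big_ord0 addr0.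
  by rewrite addrAC subrr add0r.
rewrite /coface_fun !big_ord_recl !big_ord0 !addr0 /= /vertex.
by rewrite mxE !eqxx scale1r.
Qed.

Lemma coface_smooth p (i : 'I_p.+2) :
  @dsmooth R (dsimplex p) (dsimplex p.+1) (coface i).
Proof.
elim: p i => [|p IH] i.
  move=> n U q qP.
  apply: plot_ext (plot_cst (dstruct (dsimplex 1)) (coface i (exist _ _ (vertex_std ord0)))
    (plot_open qP)) => u _ /=; congr (coface i); apply: sval_inj => /=.
  have [x1 _] := svalP (q u); move: x1; rewrite big_ord_recl big_ord0 addr0 => x1.
  by apply/rowP => k; rewrite (ord1 k) mxE !eqxx x1.
have sphi (j : 'I_p.+2) :
    @dsmooth R (dprod (dsimplex p) half_open_space) (dsimplex p.+2) (coface i \o phi j).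
  have -> : coface i \o phi j =
      phi (lift i j) \o (fun xt : simplex p * {t | @half_open R t} =>
        (coface (lift_swap i j) xt.1, xt.2)).
    by apply: funext => xt; exact: coface_phi.
  apply: (@dsmooth_comp R _ (dprod (dsimplex p.+1) half_open_space)); last exact: phi_smooth.
  apply: dsmooth_pair; last exact: dsmooth_snd.
  apply: (@dsmooth_comp R _ (dsimplex p)); first exact: dsmooth_fst.
  exact: IH.
case: p IH i sphi => [|p] IH i sphi; first exact: simplex1_universal.
exact: final_universal.
Qed.

Definition coface_map p (i : 'I_p.+2) : smooth_map (dsimplex p) (dsimplex p.+1) :=
  SmoothMap (coface_smooth i).
End CofaceSmooth.

Section LiftAdditive.
Variables (S : nzRingType) (K : choiceType) (M : lmodType S) (f : K -> M).

HB.instance Definition _ :=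
  GRing.isZmodMorphism.Build {freeg K / S} M (fglift f) (lift_is_additive f).
End LiftAdditive.

Section Cohomology.
Context {R : realType}.
Implicit Types X Y Z : dspace R.

Definition sing X p : choiceType := smooth_map (dsimplex p) X.

Definition face X p (i : 'I_p.+2) (s : sing X p.+1) : sing X p :=
  smooth_comp s (coface_map i).

Definition chain X p : lmodType int := {freeg (sing X p) / int}.

Definition boundary X p : {additive chain X p.+1 -> chain X p} :=
  fglift (fun s : sing X p.+1 => \sum_(i < p.+2) (-1) ^+ i *: << face i s >>).

Definition chain_map X Y (f : smooth_map X Y) p : {additive chain X p -> chain Y p} :=
  fglift (fun s : sing X p => << (smooth_comp f s : sing Y p) >>).

Lemma freegU_intz (K : choiceType) (k : int) (x : K) :
  << k *g x >> = << x >> *~ k :> {freeg K / int}.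
Proof. by rewrite freegU_mulz intz. Qed.

Lemma chain_ext X p (A : zmodType) (f g : {additive chain X p -> A}) :
  (forall s : sing X p, f << s >> = g << s >>) -> f =1 g.
Proof.
move=> fg c; rewrite -(freeg_sumE c) !raddf_sum; apply: eq_bigr => s _.
by rewrite (freegU_intz (coeff s c)) !raddfMz fg.
Qed.

Lemma boundaryU X p (s : sing X p.+1) :
  boundary X p << s >> = \sum_(i < p.+2) (-1) ^+ i *: << face i s >>.
Proof. by rewrite /boundary /= liftU scale1r. Qed.

Lemma chain_mapU X Y (f : smooth_map X Y) p (s : sing X p) :
  chain_map f p << s >> = << (smooth_comp f s : sing Y p) >>.
Proof. by rewrite /chain_map /= liftU scale1r. Qed.

Lemma chain_map_boundary X Y (f : smooth_map X Y) p (c : chain X p.+1) :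
  chain_map f p (boundary X p c) = boundary Y p (chain_map f p.+1 c).
Proof.
apply: (@chain_ext X p.+1 _ (chain_map f p \o boundary X p)
  (boundary Y p \o chain_map f p.+1)) => s /=.
rewrite boundaryU chain_mapU boundaryU raddf_sum; apply: eq_bigr => i _.
rewrite raddfZsign chain_mapU; congr (_ *: << _ >>).
exact: smooth_map_eq.
Qed.

Record cocycle X (A : zmodType) p := Cocycle {
  cocycle_val :> {additive chain X p -> A};
  cocycleP : forall c, cocycle_val (boundary X p c) = 0 }.

(* The cochain z o boundary of cochains z of degree k - 1; for k = 0 the complex
   is zero in degree k - 1. *)
Definition is_coboundary X (A : zmodType) p : (chain X p -> A) -> Prop :=
  match p with
  | 0 => fun z => forall c, z c = 0
  | q.+1 => fun z => exists b : {additive chain X q -> A}, forall c, z c = b (boundary X q c)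
  end.

Definition cohomologous X (A : zmodType) p (z z' : cocycle X A p) : Prop :=
  is_coboundary (fun c => z c - z' c).

Program Definition cohomologous_eqrel X (A : zmodType) p : eqrel (cocycle X A p) :=
  @EqRel _ (@cohomologous X A p) _ _ _.
Next Obligation.
move=> X A [|p] z; rewrite /cohomologous /=; first by move=> c; rewrite subrr.
by exists \0 => c; rewrite subrr.
Qed.
Next Obligation.
move=> X A [|p] z z'; rewrite /cohomologous /=.
  by move=> h c; rewrite -opprB h oppr0.
by move=> [b h]; exists (\- b) => c; rewrite -opprB h.
Qed.
Next Obligation.
move=> X A [|p] z' z z''; rewrite /cohomologous /=.
  by move=> h h' c; rewrite -(subrKA (z' c)) h h' addr0.
by move=> [b h] [b' h']; exists (b \+ b') => c; rewrite -(subrKA (z' c)) h h'.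
Qed.

Definition cohomology X (A : zmodType) p : Type := quot (cohomologous_eqrel X A p).

Program Definition cocycle_pull X Y (A : zmodType) p (f : smooth_map X Y)
    (z : cocycle Y A p) : cocycle X A p :=
  @Cocycle X A p (z \o chain_map f p) _.
Next Obligation.
by move=> X Y A p f z c; rewrite /= chain_map_boundary cocycleP.
Qed.

Definition cohomology_pull X Y (A : zmodType) p (f : smooth_map X Y)
    (a : cohomology Y A p) : cohomology X A p :=
  class_of (cohomologous_eqrel X A p) (cocycle_pull f (repr_of a)).

Lemma cohomology_pullE X Y (A : zmodType) p (f : smooth_map X Y) (z : cocycle Y A p) :
  cohomology_pull f (class_of (cohomologous_eqrel Y A p) z) =
  class_of (cohomologous_eqrel X A p) (cocycle_pull f z).
Proof.
apply/class_ofP; have := repr_ofP (cohomologous_eqrel Y A p) z.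
set z' := repr_of _ => /=; rewrite /cohomologous.
case: p z z' => [|p] z z' /=; first by move=> h c; exact: h.
move=> [b h]; exists (b \o chain_map f p) => c /=.
by rewrite h chain_map_boundary.
Qed.
End Cohomology.

Record dgroup (R : realType) := DGroup {
  dgroup_group : groupType;
  dgroup_diffeology : diffeology R dgroup_group;
  mul_smooth : let G := DSpace dgroup_diffeology in
    @dsmooth R (dprod G G) G (fun gh => (gh.1 * gh.2)%g);
  inv_smooth : let G := DSpace dgroup_diffeology in
    @dsmooth R G G (fun g => g^-1%g) }.

Definition dgroup_space (R : realType) (G : dgroup R) : dspace R :=
  DSpace (dgroup_diffeology G).
Coercion dgroup_space : dgroup >-> dspace.

Section Bundles.
Context {R : realType} (G : dgroup R).

(* The objects of DG/X. *)
Record gspace (X : dspace R) := GSpace {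
  total :> dspace R;
  act : total -> G -> total;
  proj : total -> X;
  act_smooth : @dsmooth R (dprod total G) total (fun eg => act eg.1 eg.2);
  proj_smooth : dsmooth proj;
  act1 : forall e, act e 1%g = e;
  actM : forall e g h, act e (g * h)%g = act (act e g) h;
  proj_act : forall e g, proj (act e g) = proj e }.

Definition giso X (E F : gspace X) : Prop :=
  exists (f : smooth_map E F) (f' : smooth_map F E),
    [/\ cancel f f', cancel f' f,
        forall e g, f (act e g) = act (f e) g &
        forall e, proj (f e) = proj e].

Program Definition triv_gspace (X : dspace R) : gspace X :=
  @GSpace X (dprod X G) (fun xg h => (xg.1, xg.2 * h)%g) fst _ _ _ _ _.
Next Obligation.
move=> X n U p [[p1 p2] p3]; split; first exact: p1.
by apply: (@mul_smooth R G n U (fun u => ((p u).1.2, (p u).2))); split.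
Qed.
Next Obligation. by move=> X; exact: dsmooth_fst. Qed.
Next Obligation. by move=> X [x g] /=; rewrite mulg1. Qed.
Next Obligation. by move=> X [x k] g h /=; rewrite mulgA. Qed.
Next Obligation. by []. Qed.

Section Restriction.
Variables (X : dspace R) (E : gspace X) (A : set X).

Definition restr_total : dspace R := dsub [set e : E | A (proj e)].

Fact restr_act_proof (e : restr_total) (g : G) : A (proj (act (sval e) g)).
Proof. by rewrite proj_act; exact: (svalP e). Qed.

Definition restr_act (e : restr_total) (g : G) : restr_total :=
  exist (fun e : E => A (proj e)) (act (sval e) g) (restr_act_proof e g).

Definition restr_proj (e : restr_total) : dsub A :=
  exist A (proj (sval e)) (svalP e).

Program Definition restr : gspace (dsub A) :=
  @GSpace (dsub A) restr_total restr_act restr_proj _ _ _ _ _.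
Next Obligation.
move=> n U p [p1 p2].
by apply: (@act_smooth X E n U (fun u => (sval (p u).1, (p u).2))); split.
Qed.
Next Obligation.
by move=> n U p hp; apply: (@proj_smooth X E n U (fun u => sval (p u))).
Qed.
Next Obligation. by move=> e; apply: sval_inj => /=; rewrite act1. Qed.
Next Obligation. by move=> e g h; apply: sval_inj => /=; rewrite actM. Qed.
Next Obligation.
by move=> e g; apply: sval_inj => /=; rewrite proj_act.
Qed.
End Restriction.

Section Pullback.
Variables (X Y : dspace R) (f : smooth_map Y X) (E : gspace X).

Definition pullback_total : dspace R :=
  dsub [set ye : dprod Y E | f ye.1 = proj ye.2].

Fact pullback_act_proof (ye : pullback_total) (g : G) :
  f (sval ye).1 = proj (act (sval ye).2 g).
Proof. by rewrite proj_act; exact: svalP ye. Qed.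

Definition pullback_act (ye : pullback_total) (g : G) : pullback_total :=
  exist (fun ye : Y * E => f ye.1 = proj ye.2)
    ((sval ye).1, act (sval ye).2 g) (pullback_act_proof ye g).

Program Definition pullback : gspace Y :=
  @GSpace Y pullback_total pullback_act (fun ye => (sval ye).1) _ _ _ _ _.
Next Obligation.
move=> n U p [[p1 p2] p3]; split; first exact: p1.
by apply: (@act_smooth X E n U (fun u => ((sval (p u).1).2, (p u).2))); split.
Qed.
Next Obligation. by move=> n U p []. Qed.
Next Obligation.
by move=> [[y e] h]; apply: sval_inj => /=; rewrite act1.
Qed.
Next Obligation.
by move=> [[y e] h] g k; apply: sval_inj => /=; rewrite actM.
Qed.
Next Obligation. by []. Qed.
End Pullback.

Definition trivialization_cover X (E : gspace X) I (U : I -> set X) : Prop :=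
  [/\ forall i, dopen (U i), \bigcup_i U i = setT &
      forall i, giso (restr E (U i)) (triv_gspace (dsub (U i)))].

Definition locally_trivial X (E : gspace X) : Prop :=
  exists (I : Type) (U : I -> set X), trivialization_cover E U.

Definition dsupport (X : dspace R) (f : X -> R) : set X := dclosure [set x | f x != 0].

Definition subordinate_partition (X : dspace R) (I : choiceType)
    (U : I -> set X) (rho : I -> X -> R) : Prop :=
  [/\ forall i, @dsmooth R X dline (rho i),
      forall i x, 0 <= rho i x,
      forall i, dsupport (rho i) `<=` U i,
      forall x, exists B : set X, [/\ dopen B, B x &
        finite_set [set i | B `&` dsupport (rho i) !=set0]] &
      forall x, \sum_(i \in [set: I]) rho i x = 1].

(* Index types are choiceTypes only because finitely supported sums require it;
   classically every type is one. The sum in subordinate_partition is finite at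
   each point by local finiteness. *)
Definition D_numerable X (E : gspace X) : Prop :=
  exists (I : choiceType) (U : I -> set X) (rho : I -> X -> R),
    trivialization_cover E U /\ subordinate_partition U rho.

Section Plots.
Variables (X : dspace R) (n : nat) (U : set 'rV[R]_n) (p : 'rV[R]_n -> X).
Hypothesis pP : is_plot U p.

Fact plot_restr_smooth :
  @dsmooth R (dsub (U : set (euclid n))) X (fun u => p (sval u)).
Proof.
move=> m V q [oV sq].
exact: (plot_comp pP oV sq (fun v _ => svalP (q v))).
Qed.

Definition plot_map : smooth_map (dsub (U : set (euclid n))) X :=
  SmoothMap plot_restr_smooth.
End Plots.

Definition diffeological_principal X (E : gspace X) : Prop :=
  forall n (U : set 'rV[R]_n) (p : 'rV[R]_n -> X) (pP : is_plot U p),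
    locally_trivial (pullback (plot_map pP) E).

(* The direct sum of copies of R as the colimit of the R^n. *)
Definition finseq : Type := {t : nat -> R | exists n, forall i, (n <= i)%N -> t i = 0}.

Definition finseq_incl_fun n (x : 'rV[R]_n) (i : nat) : R :=
  oapp (fun j : 'I_n => x 0 j) 0 (insub i).

Fact finseq_incl_proof n (x : 'rV[R]_n) :
  exists n, forall i, (n <= i)%N -> finseq_incl_fun x i = 0.
Proof.
by exists n => i ni; rewrite /finseq_incl_fun insubF // ltnNge ni.
Qed.

Definition finseq_incl n (x : 'rV[R]_n) : finseq := exist _ _ (finseq_incl_proof x).

Definition direct_sum : dspace R :=
  @dfinal R nat (fun n => euclid n) finseq finseq_incl.

Definition inf_simplex : dspace R :=
  dsub [set t : direct_sum | (forall i, 0 <= sval t i) /\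
                             \sum_(i \in [set: nat]) sval t i = 1].

Definition EG_pre : dspace R := dprod inf_simplex (dpi (fun _ : nat => G : dspace R)).

Definition weight (x : EG_pre) (i : nat) : R := sval (sval x.1) i.

Program Definition EG_rel : eqrel EG_pre :=
  @EqRel EG_pre (fun x y => (forall i, weight x i = weight y i) /\
                 (forall i, weight x i <> 0 -> x.2 i = y.2 i)) _ _ _.
Next Obligation. by []. Qed.
Next Obligation.
by move=> x y [tE gE]; split=> i; rewrite -tE // => /gE.
Qed.
Next Obligation.
move=> y x z [tE gE] [tE' gE']; split=> i; first by rewrite tE tE'.
by move=> ti; rewrite gE // gE' // -tE.
Qed.

Definition EG : dspace R := dquot EG_rel.

Definition EG_pre_act (x : EG_pre) (g : G) : EG_pre := (x.1, fun i => (x.2 i * g)%g).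

Definition EG_act (e : EG) (g : G) : EG := class_of EG_rel (EG_pre_act (repr_of e) g).

Lemma EG_actE (x : EG_pre) (g : G) :
  EG_act (class_of EG_rel x) g = class_of EG_rel (EG_pre_act x g).
Proof.
apply/class_ofP; have [tE gE] := repr_ofP EG_rel x.
by split=> i; [exact: tE|move=> /gE /= ->].
Qed.

Lemma EG_act1 (e : EG) : EG_act e 1%g = e.
Proof.
rewrite -(repr_ofK e) EG_actE; congr class_of.
rewrite /EG_pre_act; case: (repr_of e) => t g /=; congr pair.
by apply/funext => i; rewrite mulg1.
Qed.

Lemma EG_actM (e : EG) (g h : G) : EG_act e (g * h)%g = EG_act (EG_act e g) h.
Proof.
rewrite -(repr_ofK e) !EG_actE; congr class_of.
rewrite /EG_pre_act; case: (repr_of e) => t k /=; congr pair.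
by apply/funext => i; rewrite mulgA.
Qed.

Lemma EG_act_smooth : @dsmooth R (dprod EG G) EG (fun eg => EG_act eg.1 eg.2).
Proof.
move=> n U p [p1 p2]; have [oU lp] := quot_plotP p1.
apply: plot_local => // u /lp[V [q [Vu VU qP pq]]]; exists V; split=> //.
have oV := plot_open qP.
have p2V : is_plot V (fun u => (p u).2).
  by apply: (plot_comp p2 oV _ VU) => k; exact: Cn_id.
apply: (@plot_ext _ _ (dstruct EG) n V
    (class_of EG_rel \o (fun v => EG_pre_act (q v) (p v).2))).
  by move=> v Vv /=; rewrite pq // EG_actE.
apply: (@class_of_smooth R EG_pre EG_rel); case: qP => q1 [_ q2].
split; first exact: q1.
split=> // i.
by apply: (@mul_smooth R G n V (fun v => ((q v).2 i, (p v).2))); split;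
  [exact: q2|exact: p2V].
Qed.

Program Definition BG_rel : eqrel EG :=
  @EqRel EG (fun e e' => exists g : G, e' = EG_act e g) _ _ _.
Next Obligation. by move=> e; exists 1%g; rewrite EG_act1. Qed.
Next Obligation.
by move=> e e' [g ->]; exists (g^-1)%g; rewrite -EG_actM mulgV EG_act1.
Qed.
Next Obligation.
by move=> e' e e'' [g ->] [h ->]; exists (g * h)%g; rewrite EG_actM.
Qed.

Definition BG : dspace R := dquot BG_rel.

Program Definition universal_bundle : gspace BG :=
  @GSpace BG EG EG_act (class_of BG_rel) EG_act_smooth _ EG_act1 EG_actM _.
Next Obligation. exact: class_of_smooth. Qed.
Next Obligation.
by move=> e g; apply/class_ofP/eqr_sym; exists g.
Qed.

Definition classifying X (P : gspace X) (f : smooth_map X BG) : Prop :=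
  giso (pullback f universal_bundle) P.

Section CharacteristicClasses.
Variables (C : forall X, gspace X -> Prop) (A : zmodType) (k : nat).

Definition class_rule : Type :=
  forall (X : dspace R) (P : gspace X), C P -> cohomology X A k.

(* f^*P is only determined up to isomorphism, so Q is any representative of it;
   with f the identity this includes invariance under isomorphism. *)
Definition characteristic_class (a : class_rule) : Prop :=
  forall (X Y : dspace R) (f : smooth_map Y X) (P : gspace X) (Q : gspace Y)
    (CP : C P) (CQ : C Q),
    giso Q (pullback f P) -> a Y Q CQ = cohomology_pull f (a X P CP).
End CharacteristicClasses.
End Bundles.

(* Main.v *)
Require Import Defs.
From mathcomp Require Import freeg.
From mathcomp Require Import all_boot all_order all_algebra.
From mathcomp Require Import boolp classical_sets functions fsbigop reals.
From mathcomp Require Import topology normedtype sequences derive exp.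
From mathcomp Require Import lra ring.

(* For a principal bundle P -> X form the associated space Q = P x_G EG, with its
   projections q : Q -> X and c : Q -> BG. The fibres of q are copies of EG, which
   is contractible, so q should induce an isomorphism in cohomology and the class
   of P should be (q^* )^-1 (c^* alpha). A classifying map f of P is the same thing as
   a section s of q with c s = f, which gives s^* c^* alpha = f^* alpha.

   The inverse of q^* is built on chains. If e is a plot defined on an affine space,
   then e^*P is trivial over boxes, hence e^*Q is acyclic there, and the method of
   acyclic carriers gives a chain map from affine chains of X to chains of Q that is
   unique up to homotopy. The pull-back of P to one of Kihara's simplices need not be
   trivial, so chains of X are first replaced by affine ones, again by acyclic
   carriers; this requires that Kihara's simplices are contractible. EG itself only
   needs to be contracted one finite stage at a time: the simplices being compact,
   every chain of EG has a vertex at which all its weights vanish, and the cone with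
   this vertex is a contraction. *)

Set Implicit Arguments.
Unset Strict Implicit.
Unset Printing Implicit Defensive.
Import Order.TTheory GRing.Theory Num.Theory numFieldNormedType.Exports.
Local Open Scope classical_set_scope.
Local Open Scope ring_scope.

(** * Smooth functions and a flat step *)

Section SmoothScalar.
Context {R : realType}.

(** A carrier of a simplex e lies in the product of the domain of e with the target; for Q it
    consists of pairs (b, z) with e b = q z. Thus e^*Q is never formed as a bundle, and a face acts
    by (b, z) |-> (d^i b, z) even if e is not injective. Naturality and extension both follow from
    the uniqueness of carried chain maps: the chain maps of f^*P and of P along f lie in the same
    carriers, and for a section s the map e |-> s o e is carried too. None of the chosen chain maps
    has to be natural.

    Straight segments to the vertex 0 do not contract Kihara's simplices of dimension at least 2.
    Near a vertex i a plot must lift to the chart [phi i], that is, to a point of the opposite face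
    and a parameter t; on the segment from x to the vertex 0 this point has no limit as x tends to i
    and the time to 0. Therefore mass is first pushed off every vertex i != 0: near i, the link is
    contracted to its vertex 0 with t fixed, and t is increased afterwards. Once the coordinate 0 is
    positive everywhere, the segments are smooth. The link being a simplex of lower dimension, this
    is an induction on the dimension. *)

Lemma Cn_scalar_comp (V : normedModType R) (F : set (R -> R)) (O : set R) :
  (forall g, F g -> exists2 g', F g' & forall x, O x -> is_derive x 1 g (g' x)) ->
  forall k (U : set V) (f : V -> R), open U -> (forall u, U u -> O (f u)) ->
  Cn_on k U f -> forall g, F g -> Cn_on k U (g \o f).
Proof.
(* The induction covers all of [F] at once: the derivative of [g \o f] is a multiple of [g' \o f],
   and [g'] lies in [F] again. *)
move=> hF; elim=> [|k IH] U f oU UO Cf g Fg.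
  move=> x Ux; have [g' _ dg] := hF _ Fg.
  apply: continuous_comp; first exact: Cf.
  apply: differentiable_continuous; apply/derivable1_diffP.
  by have [] := dg _ (UO _ Ux).
have [df Df] := Cf; have [g' Fg' dg] := hF _ Fg.
have dgf x : U x -> differentiable g (f x).
  by move=> Ux; apply/derivable1_diffP; have [] := dg _ (UO _ Ux).
split=> [x Ux|v]; first by apply: differentiable_comp; [exact: df|exact: dgf].
apply: (@Cn_eq _ _ _ _ _ (fun x => 'D_v f x *: (g' \o f) x)) => //.
  move=> x Ux; have dfx := df _ Ux; have dgx := dgf _ Ux.
  rewrite (deriveE _ (differentiable_comp dfx dgx)) (diff_comp dfx dgx) /=.
  rewrite -(deriveE _ dfx) [in RHS](_ : 'D_v f x = 'D_v f x *: 1); last first.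
    by rewrite /GRing.scale /= mulr1.
  rewrite linearZ /= -(deriveE _ dgx); congr (_ *: _).
  by have [_ ->] := dg _ (UO _ Ux).
by apply: CnZ => //; [exact: Df|exact: IH (CnW Cf) _ Fg'].
Qed.

Lemma is_derive_inv (x : R) : x != 0 -> is_derive x 1 (@GRing.inv R) (- x ^- 2).
Proof.
move=> x0; have d0 : derivable (@idfun R) x (1 : R) by exact: derivable_id.
apply: DeriveDef; first exact: (@derivableV _ _ (@idfun R) x 1).
have h := @deriveV _ _ (@idfun R) x 1 x0 d0.
by rewrite [LHS]h derive_id /GRing.scale /= mulr1.
Qed.

Lemma Cn_inv (V : normedModType R) k (U : set V) (f : V -> R) : open U ->
  (forall u, U u -> f u != 0) -> Cn_on k U f -> Cn_on k U (fun u => (f u)^-1).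
Proof.
move=> oU f0 Cf.
pose F := [set g : R -> R | exists c n, g = fun x => c * x^-1 ^+ n].
have hF g : F g -> exists2 g', F g' & forall x : R, x != 0 -> is_derive x (1 : R) g (g' x).
  move=> [c [n ->]]; exists (fun x => (- (c * n%:R)) * x^-1 ^+ n.+1).
    by exists (- (c * n%:R)), n.+1.
  move=> x x0; have d := is_derive_inv x0.
  have -> : (fun y : R => c * y^-1 ^+ n) = c *: ((@GRing.inv R) ^+ n).
    apply/funext => y; rewrite /GRing.scale /=; congr (_ * _).
    by elim: n => [//|n IH]; rewrite !exprS IH.
  apply: is_derive_eq.
  rewrite /GRing.scale /=.
  case: n {d} => [|n] /=; first by rewrite mulr0n !mul0r !mulr0 oppr0 mul0r.
  by rewrite -exprVn; move: (n.+1%:R) (x^-1) => a y; rewrite (exprSr y n.+1) (exprSr y n); ring.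
have := @Cn_scalar_comp V F (fun x : R => x != 0) hF k U f oU f0 Cf (@GRing.inv R).
by apply; exists 1, 1%N; apply/funext => x; rewrite mul1r expr1.
Qed.

(** For P = 1 this is the usual flat function exp(-1/x); the factor P(1/x) makes the family closed
    under differentiation, as [Cn_scalar_comp] requires. *)
Definition flat (P : {poly R}) (x : R) : R :=
  if 0 < x then P.[x^-1] * expR (- x^-1) else 0.

(** With y = 1/x, the inequality exp(-y) y^i <= (i + 1)!/y bounds each monomial of P(1/x) and leaves
    a factor x. Applied to ['X * P], which is the difference quotient of [flat P] at 0, the bound
    gives the derivative 0 there. *)
Lemma flat_bound (P : {poly R}) : exists2 C, 0 <= C & forall x, `|flat P x| <= C * `|x|.
Proof.
exists (\sum_(i < size P) `|P`_i| * (i.+1)`!%:R).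
  by apply: sumr_ge0 => i _; rewrite mulr_ge0.
move=> x; rewrite /flat; case: ifPn => [x0|_]; last first.
  by rewrite normr0 mulr_ge0 // sumr_ge0 // => i _; rewrite mulr_ge0.
rewrite horner_coef mulr_suml; apply: le_trans (ler_norm_sum _ _ _) _.
rewrite mulr_suml; apply: ler_sum => i _.
rewrite !normrM (ger0_norm (expR_ge0 _)) (gtr0_norm x0) -!mulrA.
apply: ler_wpM2l => //; rewrite normrX normfV (gtr0_norm x0) expRN.
have y0 : 0 <= x^-1 by rewrite invr_ge0 ltW.
have h := expR_ge1Dxn i y0.
have h2 : x^-1 ^+ i.+1 / (i.+1)`!%:R <= expR x^-1.
  by apply: le_trans h; rewrite lerDr.
have f0 : 0 < (i.+1)`!%:R :> R by rewrite ltr0n fact_gt0.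
rewrite ler_pdivrMr // in h2.
rewrite ler_pdivrMr ?expR_gt0 //.
have -> : x^-1 ^+ i = x * x^-1 ^+ i.+1 by rewrite exprS mulrA divff ?mul1r // gt_eqF.
by rewrite mulrAC mulrC; apply: ler_wpM2r; [exact: ltW|rewrite mulrC].
Qed.

Lemma is_derive_flat (P : {poly R}) (x : R) :
  is_derive x 1 (flat P) (flat ('X^2 * (P - P^`())) x).
Proof.
have [x0|x0|->] := ltgtP x 0.
- rewrite {2}/flat ltNge (ltW x0) /=.
  have h : \near x, (cst 0 : R -> R) x = flat P x.
    near=> y; rewrite /flat ifN // -leNgt ltW //.
    by near: y; apply: open_nbhs_nbhs; split => //; exact: open_lt.
  apply: DeriveDef.
    apply/derivable1_diffP; apply: (near_differentiable h); exact: differentiable_cst.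
  by rewrite -(near_eq_derive _ h) ?derive_cst.
- rewrite {2}/flat x0.
  have h : \near x, P.[x^-1] * expR (- x^-1) = flat P x.
    near=> y; rewrite /flat ifT //.
    by near: y; apply: open_nbhs_nbhs; split => //; exact: open_gt.
  have xn : x != 0 by rewrite gt_eqF.
  have d := is_derive_inv xn.
  have dP : is_derive x 1 (horner P \o (@GRing.inv R)) (P^`().[x^-1] * (- x^-2)).
    apply: DeriveDef.
      apply/derivable1_diffP/differentiable_comp.
        by apply/derivable1_diffP; case: d.
      by apply/derivable1_diffP; exact: derivable_horner.
    rewrite -derive1E derive1_comp; last exact: derivable_horner.
      by rewrite -derivE derive1E; congr (_ * _); have [_ ->] := d.
    by case: d.
  have dN : is_derive x 1 (fun y : R => - y^-1) (x^-2).
    by rewrite -[x^-2]opprK; apply: is_deriveN.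
  have dE : is_derive x 1 (expR \o (fun y : R => - y^-1)) (expR (- x^-1) * x^-2).
    apply: DeriveDef.
      apply/derivable1_diffP/differentiable_comp.
        by apply/derivable1_diffP; case: dN.
      by apply/derivable1_diffP; exact: derivable_expR.
    rewrite -derive1E derive1_comp; last exact: derivable_expR.
      rewrite !derive1E; congr (_ * _); first by have [_ ->] := is_derive_expR (- x^-1).
      by have [_ ->] := dN.
    by case: dN.
  have dM := is_deriveM dP dE.
  have -> : ('X^2 * (P - P^`())).[x^-1] * expR (- x^-1) =
     (horner P \o (@GRing.inv R)) x *: (expR (- x^-1) * x^-2) +
     (expR \o (fun y : R => - y^-1)) x *: (P^`().[x^-1] * (- x^-2)).
    rewrite /GRing.scale /= hornerM hornerXn hornerD hornerN -exprVn.
    by move: (x^-1) (expR _) => y e; ring.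
  apply: DeriveDef.
    apply/derivable1_diffP; apply: (near_differentiable h).
    by apply/derivable1_diffP; case: dM.
  by rewrite -(near_eq_derive _ h) //; case: dM.
- rewrite {2}/flat ltxx.
  have hl : (fun h : R => h^-1 *: ((flat P \o shift 0) (h *: 1) - flat P 0)) @ 0^' --> (0 : R).
    have [C C0 hC] := flat_bound ('X * P).
    apply/cvgr0Pnorm_lt => e e0.
    near=> h.
    have h0 : h != 0 by near: h; exact: nbhs_dnbhs_neq.
    have -> : h^-1 *: ((flat P \o shift 0) (h *: 1) - flat P 0) = flat ('X * P) h.
      rewrite /flat /= addr0 ltxx subr0 /GRing.scale /= mulr1.
      case: ifP => _; last by rewrite mulr0.
      by rewrite hornerM hornerX mulrA.
    apply: le_lt_trans (hC h) _.
    have : `|h| < e / (C + 1).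
      near: h; apply: dnbhs0_lt; rewrite divr_gt0 //; lra.
    rewrite ltr_pdivlMr; last lra.
    apply: le_lt_trans; rewrite mulrC; apply: ler_wpM2l => //; lra.
  apply: DeriveDef; first by apply/cvg_ex; exists 0; exact: hl.
  exact/cvg_lim.
Unshelve. all: by end_near. Qed.

Definition step (s : R) : R := flat 1 s / (flat 1 s + flat 1 (1 - s)).

Let flat_ge0 s : 0 <= flat 1 s.
Proof. by rewrite /flat; case: ifP => // _; rewrite hornerE mul1r expR_ge0. Qed.

Let flat_gt0 s : 0 < s -> 0 < flat 1 s.
Proof. by rewrite /flat => ->; rewrite hornerE mul1r expR_gt0. Qed.

Let flat_le0 s : s <= 0 -> flat 1 s = 0.
Proof. by rewrite /flat ltNge => ->. Qed.

Let step_den s : 0 < flat 1 s + flat 1 (1 - s).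
Proof.
have [s0|s0] := leP s 0.
  by rewrite ltr_wpDl // flat_gt0 // subr_gt0 (le_lt_trans s0).
by rewrite ltr_pwDl ?flat_gt0.
Qed.

Lemma step_le0 s : s <= 0 -> step s = 0.
Proof. by move=> s0; rewrite /step flat_le0 // mul0r. Qed.

Lemma step_ge1 s : 1 <= s -> step s = 1.
Proof.
move=> s1; rewrite /step (@flat_le0 (1 - s)) ?subr_le0 // addr0 divff //.
by rewrite gt_eqF // flat_gt0 // (lt_le_trans ltr01).
Qed.

Lemma step_ge0 s : 0 <= step s.
Proof. by rewrite /step divr_ge0 // ltW // step_den. Qed.

Lemma step_le1 s : step s <= 1.
Proof. by rewrite /step ler_pdivrMr ?step_den // mul1r lerDl. Qed.

Section Closure.
Context {V : normedModType R}.
Variables (k : nat) (U : set V).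
Hypothesis oU : open U.
Implicit Types f g : V -> R.

Lemma CnDf f g : Cn_on k U f -> Cn_on k U g -> Cn_on k U (fun u => f u + g u).
Proof. exact: CnD. Qed.

Lemma CnMf f g : Cn_on k U f -> Cn_on k U g -> Cn_on k U (fun u => f u * g u).
Proof. exact: CnZ. Qed.

Lemma CnNf f : Cn_on k U f -> Cn_on k U (fun u => - f u).
Proof.
move=> cf; apply: (@Cn_eq _ _ _ _ _ (fun u => (-1) * f u)) => //.
  by move=> u _; rewrite mulN1r.
by apply: CnMf => //; exact: Cn_cst.
Qed.

Lemma CnBf f g : Cn_on k U f -> Cn_on k U g -> Cn_on k U (fun u => f u - g u).
Proof. by move=> cf cg; apply: CnDf => //; exact: CnNf. Qed.

Lemma Cn_flat P f : Cn_on k U f -> Cn_on k U (fun u => flat P (f u)).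
Proof.
move=> cf; pose F := [set g : R -> R | exists Q, g = flat Q].
have hF (r : R -> R) : F r -> exists2 r', F r' & forall x : R, setT x -> is_derive x (1 : R) r (r' x).
  move=> [Q ->]; exists (flat ('X^2 * (Q - Q^`()))); first by exists ('X^2 * (Q - Q^`())).
  by move=> x _; exact: is_derive_flat.
by apply: (Cn_scalar_comp hF oU _ cf) => //; exists P.
Qed.

Lemma Cn_step f : Cn_on k U f -> Cn_on k U (fun u => step (f u)).
Proof.
move=> cf; apply: CnMf; first exact: Cn_flat.
apply: Cn_inv => //.
  by move=> u _; rewrite gt_eqF // step_den.
by apply: CnDf; [|apply: Cn_flat; apply: CnBf => //; exact: Cn_cst]; exact: Cn_flat.
Qed.

Lemma Cn_coord n (f : V -> 'rV[R]_n) (i : 'I_n) :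
  Cn_on k U f -> Cn_on k U (fun u => f u 0 i).
Proof.
have c : continuous (@coordf R n i : 'rV[R]_n -> R) by exact: coord_continuous.
by move=> cf; exact: (Cn_linear oU c cf).
Qed.

Lemma Cn_row n (f : V -> 'rV[R]_n) :
  (forall i, Cn_on k U (fun u => f u 0 i)) -> Cn_on k U f.
Proof.
move=> h; apply: (@Cn_eq _ _ _ _ _ (\sum_(i < n) (fun u => f u 0 i *: delta_mx 0 i))) => //.
  by move=> u _; rewrite fct_sumE -row_sum_delta.
by apply: Cn_sum => // i; apply: CnZ => //; exact: Cn_cst.
Qed.

Lemma Cn_sumf (I : finType) (f : I -> V -> R) :
  (forall i, Cn_on k U (f i)) -> Cn_on k U (fun u => \sum_i f i u).
Proof.
move=> h; have -> : (fun u => \sum_i f i u) = \sum_i f i.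
  by apply/funext => u; rewrite fct_sumE.
elim/big_rec: _ => [|i g _ hg]; first exact: Cn_cst.
exact: CnD.
Qed.

End Closure.
End SmoothScalar.

(** * Plots *)

Section PlotBasics.
Context {R : realType}.

Lemma plot_sub (X : dspace R) n (U V : set 'rV[R]_n) (p : 'rV[R]_n -> X) :
  is_plot U p -> open V -> V `<=` U -> is_plot V p.
Proof. by move=> pP oV VU; apply: (plot_comp pP oV _ VU) => k; exact: Cn_id. Qed.

Lemma plot_glue (X : dspace R) n (U : set 'rV[R]_n) (p : 'rV[R]_n -> X) :
  (forall u, U u -> exists V q, [/\ V u, V `<=` U, is_plot V q &
     forall v, V v -> p v = q v]) -> is_plot U p.
Proof.
move=> h; have oU : open U.
  rewrite openE => u /h[V [q [Vu VU qP _]]].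
  by apply: (filterS VU); apply: open_nbhs_nbhs; split => //; exact: plot_open qP.
apply: plot_local => // u /h[V [q [Vu VU qP pq]]]; exists V; split => //.
by apply: plot_ext qP => v /pq.
Qed.

Lemma splotP n (U : set 'rV[R]_n) (f : 'rV[R]_n -> R) :
  open U -> (forall k, Cn_on k U f) -> @is_plot R dline n U f.
Proof. by []. Qed.

Lemma splot_continuous n (U : set 'rV[R]_n) (f : 'rV[R]_n -> R) :
  @is_plot R dline n U f -> forall u, U u -> {for u, continuous f}.
Proof. by case=> _ /(_ 0%N). Qed.

Lemma splot_open n (U : set 'rV[R]_n) (f : 'rV[R]_n -> R) (O : set R) :
  @is_plot R dline n U f -> open O -> open (U `&` f @^-1` O).
Proof.
move=> fP oO; have oU := plot_open fP; rewrite openE => u [Uu Ofu].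
apply: filterI; first exact: open_nbhs_nbhs.
by apply: (splot_continuous fP Uu); exact: open_nbhs_nbhs.
Qed.

Lemma splot_lt n (U : set 'rV[R]_n) (f : 'rV[R]_n -> R) (a : R) :
  @is_plot R dline n U f -> open (U `&` [set u | f u < a]).
Proof. by move=> fP; apply: (splot_open (O := [set x | x < a]) fP); exact: open_lt. Qed.

Lemma splot_gt n (U : set 'rV[R]_n) (f : 'rV[R]_n -> R) (a : R) :
  @is_plot R dline n U f -> open (U `&` [set u | a < f u]).
Proof. by move=> fP; apply: (splot_open (O := [set x | a < x]) fP); exact: open_gt. Qed.

Section FinalLift.
Variables (I : Type) (Y : I -> dspace R) (T : Type) (f : forall i, Y i -> T).

(** Constants are a separate case because the maps [f i] need not be jointly surjective. *)
Definition flift_plot n (U : set 'rV[R]_n) (p : 'rV[R]_n -> T) : Prop :=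
  open U /\ forall u, U u -> exists V, [/\ V u, V `<=` U, open V &
    (exists x, forall v, V v -> p v = x) \/
    (exists i q, @is_plot R (Y i) n V q /\ forall v, V v -> p v = f (q v))].

Program Definition flift_diffeology : diffeology R T :=
  @Diffeology R T flift_plot _ _ _ _ _.
Next Obligation. by move=> n U p []. Qed.
Next Obligation.
move=> n U p q pq [oU h]; split=> // u /h[V [Vu VU oV c]]; exists V; split=> //.
case: c => [[x px]|[i [r [rP pr]]]]; [left; exists x|right; exists i, r; split => //].
  by move=> v Vv; rewrite -pq ?px //; exact: VU.
by move=> v Vv; rewrite -pq ?pr //; exact: VU.
Qed.
Next Obligation.
by move=> n U x oU; split=> // u Uu; exists U; split => //; left; exists x.
Qed.
Next Obligation.
move=> n U p oU h; split=> // u /h[V [Vu VU [_ /(_ u Vu)[V' [V'u V'V oV' c]]]]].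
by exists V'; split=> //; exact: subset_trans VU.
Qed.
Next Obligation.
move=> m n V U p g [oU h] oV sg VU; split=> // v Vv.
have [U' [U'g U'U oU' c]] := h _ (VU _ Vv).
have oV' : open (V `&` g @^-1` U').
  rewrite openE => w [Vw U'gw]; apply: filterI; first exact: open_nbhs_nbhs.
  by apply: (sg 0 w Vw); exact: open_nbhs_nbhs.
exists (V `&` g @^-1` U'); split=> //.
case: c => [[x px]|[i [r [rP pr]]]]; [left; exists x|right; exists i, (r \o g); split].
- by move=> w [_ /px].
- apply: (plot_comp rP oV') => [k|w []//].
  by apply: Cn_subset (sg k) => w [].
- by move=> w [_ /pr].
Qed.

Lemma flift_smooth i : @dsmooth R (Y i) (DSpace flift_diffeology) (@f i).
Proof.
move=> n U p pP; have oU := plot_open pP.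
by split=> // u Uu; exists U; split=> //; right; exists i, p.
Qed.

(** The local lifts form a diffeology for which every [f i] is smooth, and a plot of the final
    diffeology is a plot of each such diffeology. *)
Lemma final_lift n (U : set 'rV[R]_n) (p : 'rV[R]_n -> dfinal f) :
  is_plot U p -> flift_plot U p.
Proof. by case=> _ /(_ flift_diffeology); apply => i; exact: flift_smooth. Qed.
End FinalLift.

End PlotBasics.

(** * Kihara's simplices *)

Section KiharaSimplex.
Context {R : realType}.
Notation dsimplex := (@dsimplex R).
Notation half_open_space := (@half_open_space R).

Implicit Types p : nat.

Lemma std_le1 p (x : simplex p) i : sval x 0 i <= 1 :> R.
Proof.
have [<- x0] := svalP x.
by rewrite (bigD1 i) //= lerDl sumr_ge0.
Qed.

Lemma std_ge0 p (x : simplex p) i : 0 <= sval x 0 i :> R.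
Proof. by have [_ ->] := svalP x. Qed.

Lemma simplex_eq p (x y : @simplex R p) :
  (forall i, sval x 0 i = sval y 0 i) -> x = y.
Proof. by move=> h; apply: sval_inj; apply/rowP. Qed.

Lemma simplex0_eq (x y : @simplex R 0) : x = y.
Proof.
apply: simplex_eq => i; rewrite (ord1 i).
have [] := svalP x; rewrite big_ord1 => -> _.
by have [] := svalP y; rewrite big_ord1 => -> _.
Qed.

Lemma sum_lift p (f : 'I_p.+2 -> R) (i : 'I_p.+2) :
  \sum_j f j = f i + \sum_k f (lift i k).
Proof. by rewrite (bigD1_ord i). Qed.

Lemma coface_fun_lift p (i : 'I_p.+2) (x : 'rV[R]_p.+1) k :
  coface_fun i x 0 (lift i k) = x 0 k.
Proof.
rewrite /coface_fun summxE (bigD1 k) //= big1 => [|j jk].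
  by rewrite !mxE !eqxx mulr1 addr0.
by rewrite !mxE eqxx /= (inj_eq lift_inj) eq_sym (negPf jk) mulr0.
Qed.

Lemma coface_fun_diag p (i : 'I_p.+2) (x : 'rV[R]_p.+1) : coface_fun i x 0 i = 0.
Proof.
rewrite /coface_fun summxE big1 // => j _.
by rewrite !mxE eqxx /= (negPf (neq_lift _ _)) mulr0.
Qed.

Lemma lift_swapK p (i : 'I_p.+3) (j : 'I_p.+2) : lift (lift i j) (lift_swap i j) = i.
Proof.
apply/val_inj; rewrite /= /bump /unbump.
case: (ltnP j i) => ji; last by rewrite add1n subn0 ltnNge ji.
rewrite add0n subn1; case: (nat_of_ord i) ji => // m.
by rewrite ltnS => -> /=; rewrite add1n.
Qed.

Lemma coface_comm p (i : 'I_p.+3) (j : 'I_p.+2) (x : 'rV[R]_p.+1) :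
  coface_fun i (coface_fun j x) =
  coface_fun (lift i j) (coface_fun (lift_swap i j) x).
Proof.
rewrite [coface_fun j _]/coface_fun [coface_fun (lift_swap i j) _]/coface_fun.
rewrite !linear_sum /=; apply: eq_bigr => k _.
by rewrite !linearZ /= !coface_fun_vertex liftC.
Qed.

Lemma phi_diag p (i : 'I_p.+2) (xt : simplex p * {t : R | half_open t}) :
  sval (phi i xt) 0 i = 1 - sval xt.2.
Proof. by rewrite /= !mxE coface_fun_diag !eqxx mulr0 mulr1 addr0. Qed.

Lemma phi_lift p (i : 'I_p.+2) (xt : simplex p * {t : R | half_open t}) k :
  sval (phi i xt) 0 (lift i k) = sval xt.2 * sval xt.1 0 k.
Proof.
rewrite /= !mxE coface_fun_lift eqxx /= eq_sym (negPf (neq_lift _ _)).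
by rewrite mulr0 add0r.
Qed.

Lemma phi_eqP p (i : 'I_p.+2) (x : simplex p.+1) (yt : simplex p * {t : R | half_open t}) :
  sval x 0 i = 1 - sval yt.2 ->
  (forall k, sval x 0 (lift i k) = sval yt.2 * sval yt.1 0 k) ->
  x = phi i yt.
Proof.
move=> h1 h2; apply: simplex_eq => j; case: (unliftP i j) => [k ->|->].
  by rewrite phi_lift h2.
by rewrite phi_diag h1.
Qed.

Lemma half_openP (t : R) : 0 <= t -> t < 1 -> half_open t.
Proof. by rewrite /half_open /= => -> ->. Qed.

(* The value outside [0, 1) is junk. *)
Definition to_half (t : R) : {t : R | half_open t} :=
  match pselect (half_open t) with
  | left h => exist _ _ h
  | right _ => exist _ _ half_open0
  end.

Lemma to_halfE (t : R) : 0 <= t -> t < 1 -> sval (to_half t) = t.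
Proof. by move=> t0 t1; rewrite /to_half; case: pselect => // -[]; exact: half_openP. Qed.

Lemma to_half_plot n (U : set 'rV[R]_n) (t : 'rV[R]_n -> R) :
  @is_plot R dline n U t -> (forall u, U u -> 0 <= t u < 1) ->
  @is_plot R half_open_space n U (to_half \o t).
Proof.
move=> tP h; apply: (@plot_ext _ _ (dstruct dline) n U t); last exact: tP.
by move=> u /h /andP[t0 t1] /=; rewrite to_halfE.
Qed.

Lemma half_plot n (U : set 'rV[R]_n) (t : 'rV[R]_n -> {t : R | half_open t}) :
  @is_plot R half_open_space n U t -> @is_plot R dline n U (fun u => sval (t u)).
Proof. by []. Qed.

Lemma simplex0_plot n (U : set 'rV[R]_n) (x : 'rV[R]_n -> simplex 0) :
  open U -> @is_plot R (dsimplex 0) n U x.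
Proof.
move=> oU; apply: plot_ext (plot_cst (dstruct (dsimplex 0)) (exist _ _ (@vertex_std R 0 ord0)) oU).
by move=> u _; exact: simplex0_eq.
Qed.

Lemma phi_dsmooth p (i : 'I_p.+2) :
  @dsmooth R (dprod (dsimplex p) half_open_space) (dsimplex p.+1) (phi i).
Proof.
case: p i => [|p] i; last exact: phi_smooth.
move=> n U yt [y1 y2]; have oU := plot_open y1; split => // k.
have [_ st] : @is_plot R dline n U (fun u => sval (yt u).2) by [].
apply: Cn_row => // j; case: (unliftP i j) => [l ->|->].
  apply: (@Cn_eq _ _ _ _ _ (fun u => sval (yt u).2 * sval (yt u).1 0 l)) => //.
    by move=> u _; exact: esym (phi_lift i (yt u) l).
  apply: CnMf => //.
  have [_ s1] : @is_plot R (dsimplex 0) n U (fun u => (yt u).1) by [].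
  exact: (Cn_coord oU l (s1 k)).
apply: (@Cn_eq _ _ _ _ _ (fun u => 1 - sval (yt u).2)) => //.
  by move=> u _; exact: esym (phi_diag i (yt u)).
by apply: CnBf => //; exact: Cn_cst.
Qed.

Lemma some_pos p (x : simplex p) : exists i, 0 < sval x 0 i :> R.
Proof.
have [x1 x0] := svalP x; apply: contrapT => /forallNP h.
have : \sum_i sval x 0 i <= 0.
  by apply: sumr_le0 => i _; rewrite leNgt; apply/negP/h.
by rewrite x1 ler10.
Qed.

Definition radial_fun p (i : 'I_p.+2) (x : 'rV[R]_p.+2) : 'rV[R]_p.+1 :=
  \row_k (x 0 (lift i k) / (1 - x 0 i)).

Lemma radial_std p (i : 'I_p.+2) (x : 'rV[R]_p.+2) :
  std_simplex x -> x 0 i != 1 -> std_simplex (radial_fun i x).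
Proof.
move=> [x1 x0] xi.
have d0 : 0 < 1 - x 0 i.
  rewrite subr_gt0 lt_neqAle xi -x1 (sum_lift _ i) lerDl sumr_ge0 //.
split=> [|k]; last by rewrite mxE divr_ge0 // ltW.
rewrite (eq_bigr (fun k => x 0 (lift i k) / (1 - x 0 i))); last by move=> k _; rewrite mxE.
have e : 1 - x 0 i = \sum_k x 0 (lift i k).
  by rewrite -x1 (sum_lift _ i) [_ + _ - _]addrAC subrr add0r.
by rewrite -mulr_suml -e divff // gt_eqF.
Qed.

(* The point y with x = phi i (y, 1 - x i); its value at the vertex i is junk. *)
Definition radial p (i : 'I_p.+2) (x : simplex p.+1) : simplex p :=
  match pselect (sval x 0 i != 1) with
  | left h => exist _ _ (radial_std (svalP x) h)
  | right _ => exist _ _ (vertex_std ord0)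
  end.

Lemma radialE p (i : 'I_p.+2) (x : simplex p.+1) k : sval x 0 i != 1 ->
  sval (radial i x) 0 k = sval x 0 (lift i k) / (1 - sval x 0 i).
Proof. by rewrite /radial => h; case: pselect => //= h'; rewrite mxE. Qed.

Lemma radial_uniq p (i : 'I_p.+2) (x : simplex p.+1) (y : simplex p) (s : R) :
  sval x 0 i != 1 -> sval x 0 i = 1 - s ->
  (forall k, sval x 0 (lift i k) = s * sval y 0 k) -> radial i x = y.
Proof.
move=> xi xs xy; apply: simplex_eq => k; rewrite radialE // xy xs subKr mulrC mulKf //.
by apply: contra_neq xi => s0; rewrite xs s0 subr0.
Qed.

Lemma radialK p (i : 'I_p.+2) (x : simplex p.+1) k :
  sval x 0 (lift i k) = (1 - sval x 0 i) * sval (radial i x) 0 k.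
Proof.
have [/eqP xi|xi] := boolP (sval x 0 i == 1); last first.
  by rewrite radialE // mulrC divfK // subr_eq0 eq_sym.
rewrite xi subrr mul0r; apply/eqP; rewrite eq_le std_ge0 andbT.
have [xs x0] := svalP x; rewrite -(lerD2l 1) addr0 -{2}xs (sum_lift _ i) -xi lerD2l.
by rewrite (bigD1 k) //= lerDl sumr_ge0 // => *; exact: std_ge0.
Qed.

Definition simplex_lift p n (U : set 'rV[R]_n) (x : 'rV[R]_n -> simplex p.+1) u :=
  exists V (k : 'I_p.+2) (y : 'rV[R]_n -> simplex p) (t : 'rV[R]_n -> {t : R | half_open t}),
   [/\ V u, V `<=` U, @is_plot R (dsimplex p) n V y, @is_plot R half_open_space n V t &
       forall v, V v -> x v = phi k (y v, t v)].

(** Where the diffeology is final this is [final_lift]; constants lift as well, since every point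
    has a positive coordinate i and so lies in the image of [phi i]. *)
Lemma simplex_plot_lift p n (U : set 'rV[R]_n) (x : 'rV[R]_n -> simplex p.+1) :
  @is_plot R (dsimplex p.+1) n U x -> forall u, U u -> simplex_lift U x u.
Proof.
move=> xP u Uu.
have [_ /(_ u Uu)[V [Vu VU oV c]]] :
    @flift_plot R 'I_p.+2 (fun=> dprod (dsimplex p) half_open_space) (simplex p.+1)
      (fun i => phi i) n U x.
  case: p x xP => [|p] x xP; last exact: final_lift.
  (* Delta^1 has the sub-diffeology by definition; [simplex1_universal], applied to the identity,
     shows that its plots lift all the same. *)
  pose Z := DSpace (@flift_diffeology R 'I_2 (fun=> dprod (dsimplex 0) half_open_space)
    (simplex 1) (fun i => phi i)).
  apply: (@simplex1_universal R Z id _ n U x xP) => j.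
  exact: (@flift_smooth R 'I_2 (fun=> dprod (dsimplex 0) half_open_space)
    (simplex 1) (fun i => phi i) j).
case: c => [[z xz]|[k [q [[q1 q2] xq]]]]; last first.
  by exists V, k, (fun v => (q v).1), (fun v => (q v).2); split.
have [i zi] := some_pos z.
have z1 : 0 <= 1 - sval z 0 i by rewrite subr_ge0 std_le1.
have z2 : 1 - sval z 0 i < 1 by rewrite ltrBlDl ltrDr.
exists V, i, (fun=> radial i z), (fun=> to_half (1 - sval z 0 i)); split => //.
- exact: plot_cst.
- exact: plot_cst.
- move=> v Vv; rewrite xz //; apply: phi_eqP => /=; rewrite to_halfE // ?subKr // => k.
  exact: radialK.
Qed.

Lemma simplex_coord_plot p n (U : set 'rV[R]_n) (x : 'rV[R]_n -> simplex p) i :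
  @is_plot R (dsimplex p) n U x -> @is_plot R dline n U (fun u => sval (x u) 0 i).
Proof.
elim: p n U x i => [|p IH] n U x i xP.
  have oU := plot_open xP.
  apply: (@plot_ext _ _ (dstruct dline) n U (fun=> 1)); last exact: plot_cst.
  by move=> u _; have [<- _] := svalP (x u); rewrite big_ord1 (ord1 i).
apply: plot_glue => u Uu.
have [V [k [y [t [Vu VU yP tP xy]]]]] := simplex_plot_lift xP Uu.
have [oV st] := half_plot tP.
case: (unliftP k i) => [l ->|->].
  have [_ sy] := IH _ _ _ l yP.
  exists V, (fun v => sval (t v) * sval (y v) 0 l); split => //.
    by apply: splotP => // m; apply: CnMf => //.
  by move=> v Vv; rewrite xy // phi_lift.
exists V, (fun v => 1 - sval (t v)); split => //.
  by apply: splotP => // m; apply: CnBf => //; exact: Cn_cst.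
by move=> v Vv; rewrite xy // phi_diag.
Qed.

(* Unlike in simplex_lift, the vertex i is prescribed; the price is that x may meet
   the face opposite to i, which is not in the image of phi i. *)
Definition polar_lift p n (U : set 'rV[R]_n) (x : 'rV[R]_n -> simplex p.+1) i u :=
  exists V (z : 'rV[R]_n -> simplex p),
   [/\ V u, V `<=` U, @is_plot R (dsimplex p) n V z &
       forall v, V v -> forall k, sval (x v) 0 (lift i k) = (1 - sval (x v) 0 i) * sval (z v) 0 k].

(** Induction on the dimension. Locally x = [phi k (y, t)] for some k. If k = i, then z = y will do;
    otherwise i is the vertex j of the face opposite to k, and the projection of x from i is
    [phi k' (z, w)], where z is the projection of y from j and k' is the position of k in the face
    opposite to i. *)
Lemma polarP p n (U : set 'rV[R]_n) (x : 'rV[R]_n -> simplex p.+1) i u :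
  @is_plot R (dsimplex p.+1) n U x -> U u -> polar_lift U x i u.
Proof.
elim: p n U x i u => [|p IH] n U x i u xP Uu.
  exists U, (fun=> exist _ _ (vertex_std ord0)); split => //.
    exact/simplex0_plot/(plot_open xP).
  move=> v Uv k /=; rewrite (ord1 k) mxE !eqxx mulr1.
  have [<- _] := svalP (x v); rewrite (sum_lift _ i) big_ord1.
  by rewrite [_ + _ - _]addrAC subrr add0r.
have [V [k [y [t [Vu VU yP tP xy]]]]] := simplex_plot_lift xP Uu.
have xlk v l : V v -> sval (x v) 0 (lift k l) = sval (t v) * sval (y v) 0 l.
  by move=> Vv; rewrite xy // phi_lift.
have xk v : V v -> sval (x v) 0 k = 1 - sval (t v) by move=> Vv; rewrite xy // phi_diag.
case: (unliftP k i) => [j ij|->]; last first.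
  exists V, y; split => // v Vv l.
  by rewrite xlk // xk // subKr.
have [V' [z [V'u V'V zP yz]]] := IH n V y j u yP Vu.
have [oV' st] := half_plot tP; have oV := plot_open zP.
have [_ sy] := simplex_coord_plot j yP.
pose k' := lift_swap k j.
(* d is 1 - x i, and it is positive because t < 1. The value of w is forced by x k = d (1 - w), and
   then d w = t (1 - y j), as the other coordinates demand. *)
pose d v := 1 - sval (t v) * sval (y v) 0 j.
pose w v := sval (t v) * (1 - sval (y v) 0 j) / d v.
have t01 v : 0 <= sval (t v) < 1 by case: (t v) => s /=.
have d0 v : 0 < d v.
  rewrite subr_gt0 (@le_lt_trans _ _ (sval (t v))) //; last by case/andP: (t01 v).
  by rewrite ler_piMr ?std_le1 //; case/andP: (t01 v).
have wP v : V' v -> 0 <= w v < 1.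
  move=> V'v; case/andP: (t01 v) => tv0 tv1.
  have dv := d0 v; apply/andP; split.
    rewrite /w mulr_ge0 ?invr_ge0 ?(ltW dv) // mulr_ge0 // subr_ge0.
    exact: std_le1.
  by rewrite /w ltr_pdivrMr // mul1r /d mulrBr mulr1 ltrD2r.
have sw : @is_plot R dline n V' w.
  apply: splotP => // m; have VV : V' `<=` V by [].
  have st' := Cn_subset VV (st m); have sy' := Cn_subset VV (sy m).
  have c1 : @Cn_on R m 'rV[R]_n R V' (fun=> 1) by exact: Cn_cst.
  apply: CnMf => //; first by apply: CnMf => //; apply: CnBf.
  have dn a : V' a -> d a != 0 by move=> _; rewrite gt_eqF // d0.
  apply: (@Cn_inv _ _ m V' d oV dn).
  by apply: CnBf => //; apply: CnMf.
exists V', (fun v => phi k' (z v, to_half (w v))); split => //; first exact: subset_trans VU.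
  apply: (@phi_dsmooth p k' n V' (fun v => (z v, to_half (w v)))); split => //.
  exact: to_half_plot.
move=> v V'v l; have Vv := V'V _ V'v.
have [wv0 wv1] := andP (wP _ V'v).
have xi : 1 - sval (x v) 0 i = d v by rewrite ij xlk.
have kij : k = lift i k' by rewrite ij; exact: esym (lift_swapK k j).
rewrite xi; case: (unliftP k' l) => [m ->|->].
  rewrite phi_lift /= to_halfE // ij /k' -liftC xlk // yz //.
  have dn : d v != 0 by rewrite gt_eqF // d0.
  by rewrite /w; move: (d v) dn (sval (t v)) (sval (z v)) (sval (y v) 0 j) => D Dn a z' b; field.
rewrite phi_diag /= to_halfE // -kij xk // mulrBr mulr1 /w mulrC divfK ?gt_eqF //.
by rewrite /d; ring.
Qed.

End KiharaSimplex.

(** * Contraction of Kihara's simplices *)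

Section ScalarPlots.
Context {R : realType}.
Variables (n : nat) (U : set 'rV[R]_n).
Notation splot := (@is_plot R dline n U).
Implicit Types f g : 'rV[R]_n -> R.

Lemma splotD f g : splot f -> splot g -> splot (fun u => f u + g u).
Proof. by move=> [oU sf] [_ sg]; apply: splotP => // k; exact: CnDf. Qed.

Lemma splotB f g : splot f -> splot g -> splot (fun u => f u - g u).
Proof. by move=> [oU sf] [_ sg]; apply: splotP => // k; exact: CnBf. Qed.

Lemma splotM f g : splot f -> splot g -> splot (fun u => f u * g u).
Proof. by move=> [oU sf] [_ sg]; apply: splotP => // k; exact: CnMf. Qed.

Lemma splotV f : (forall u, U u -> f u != 0) -> splot f -> splot (fun u => (f u)^-1).
Proof. by move=> f0 [oU sf]; apply: splotP => // k; exact: Cn_inv. Qed.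

Lemma splot_step f : splot f -> splot (fun u => step (f u)).
Proof. by move=> [oU sf]; apply: splotP => // k; exact: Cn_step. Qed.

Lemma splot_cst (a : R) : open U -> splot (fun=> a).
Proof. exact: plot_cst. Qed.

End ScalarPlots.

Section KiharaContraction.
Context {R : realType}.
Notation dsimplex := (@dsimplex R).
Notation simplex := (@simplex R).
Implicit Types p : nat.

Definition dsmooth2 (X Y : dspace R) (H : X -> R -> Y) : Prop :=
  forall n (U : set 'rV[R]_n) (x : 'rV[R]_n -> X) (s : 'rV[R]_n -> R),
    is_plot U x -> @is_plot R dline n U s -> is_plot U (fun u => H (x u) (s u)).

Lemma dsmooth2_at (X Y : dspace R) (H : X -> R -> Y) s :
  dsmooth2 H -> dsmooth (fun x => H x s).
Proof. by move=> sH n U x xP; apply: sH => //; exact/splot_cst/(plot_open xP). Qed.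

(* The last clause says that mass only moves towards the vertex 0; it ensures that
   the pushes off the different vertices do not undo each other. *)
Definition mono_htpy p (f g : simplex p -> simplex p) : Prop :=
  exists H : simplex p -> R -> simplex p,
    [/\ @dsmooth2 (dsimplex p) (dsimplex p) H,
        forall x s, s <= 0 -> H x s = f x,
        forall x s, 1 <= s -> H x s = g x &
        forall x s k, k != 0 -> sval (H x s) 0 k <= sval x 0 k].

Lemma mono_htpy_smooth p (f g : simplex p -> simplex p) :
  mono_htpy f g -> @dsmooth R (dsimplex p) (dsimplex p) g.
Proof.
move=> [H [sH _ H1 _]]; have -> : g = H^~ 1 by apply/funext => x; rewrite H1.
exact: dsmooth2_at.
Qed.

Lemma mono_htpy_le p (f g : simplex p -> simplex p) : mono_htpy f g ->
  forall x k, k != 0 -> sval (g x) 0 k <= sval x 0 k.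
Proof. by move=> [H [_ _ H1 Hm]] x k k0; rewrite -(H1 x 1) // Hm. Qed.

Lemma mono_htpy_refl p : @mono_htpy p id id.
Proof. by exists (fun x s => x); split => // n U x s. Qed.

Lemma mono_htpy_trans p (f g h : simplex p -> simplex p) :
  mono_htpy f g -> mono_htpy g h -> mono_htpy f h.
Proof.
move=> [H [sH H0 H1 Hm]] [H' [sH' H'0 H'1 H'm]].
(* At triple speed the two homotopies use [0, 1/3] and [2/3, 1]; in between both formulas give g, so
   that the switch at 1/2 is smooth. *)
exists (fun x s => if s < 2^-1 then H x (3 * s) else H' x (3 * s - 2)); split.
- move=> n U x s xP sP; have oU := plot_open xP; apply: plot_glue => u Uu.
  have s3 V : V `<=` U -> open V -> @is_plot R dline n V (fun u => 3 * s u).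
    by move=> VU oV; apply: splotM (plot_sub sP oV VU); exact: splot_cst.
  have [su|su] := ltP (s u) (3^-1 * 2).
    have oV := splot_lt (a := 3^-1 * 2) sP.
    pose V := U `&` [set u | s u < 3^-1 * 2]; have VU : V `<=` U by move=> v [].
    exists V, (fun v => H (x v) (3 * s v)); split => //.
      by apply: sH; [exact: plot_sub xP oV VU|exact: s3].
    move=> v [Vv /= sv]; case: ltP => // sv'.
    by rewrite H1 ?H'0 //; lra.
  have oV := splot_gt (a := 2^-1) sP.
  pose V := U `&` [set u | 2^-1 < s u]; have VU : V `<=` U by move=> v [].
  exists V, (fun v => H' (x v) (3 * s v - 2)); split => //.
  + by split => //=; lra.
  + apply: sH'; first exact: plot_sub xP oV VU.
    by apply: splotB; [exact: s3|exact: splot_cst].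
  + by move=> v [Vv /= sv]; rewrite ltNge ltW.
- by move=> x s s0; rewrite ifT; [rewrite H0 //|]; lra.
- by move=> x s s1; rewrite ifF; [rewrite H'1 //; lra|apply/negbTE; rewrite -leNgt; lra].
- by move=> x s k k0; case: ifP => _; [exact: Hm|exact: H'm].
Qed.

Lemma mono_htpy_comp p (f g w : simplex p -> simplex p) :
  mono_htpy f g -> mono_htpy id w -> mono_htpy g (w \o g).
Proof.
move=> fg [H [sH H0 H1 Hm]]; exists (fun x s => H (g x) s); split.
- move=> n U x s xP sP; apply: (sH n U (g \o x) s _ sP).
  exact: (mono_htpy_smooth fg).
- by move=> x s /H0 ->.
- by move=> x s /H1 ->.
- by move=> x s k k0; apply: le_trans (Hm _ _ _ k0) _; exact: (mono_htpy_le fg).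
Qed.

Lemma mono_le0 p (x y : simplex p) :
  (forall k, k != 0 -> sval y 0 k <= sval x 0 k) -> sval x 0 0 <= sval y 0 0.
Proof.
move=> h; have [xs _] := svalP x; have [ys _] := svalP y.
have : \sum_i sval y 0 i <= \sum_i sval x 0 i + (sval y 0 0 - sval x 0 0).
  rewrite (bigD1 0) //= [in leRHS](bigD1 0) //= addrAC addrCA subrr addr0.
  by rewrite lerD2l; apply: ler_sum => k /h.
by rewrite xs ys; lra.
Qed.

Section Push.
Variables (p : nat) (i : 'I_p.+2).
Hypothesis i0 : i != 0.
Variable H : simplex p -> R -> simplex p.
Hypothesis sH : @dsmooth2 (dsimplex p) (dsimplex p) H.
Hypothesis H0 : forall x s, s <= 0 -> H x s = x.
Hypothesis H1 : forall x s, 1 <= s -> H x s = exist _ _ (vertex_std ord0).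
Hypothesis Hm : forall x s k, k != 0 -> sval (H x s) 0 k <= sval x 0 k.

(** If x 0 = 0, then some i != 0 has c x i > 2, as p + 1 coordinates of at most 1/(p + 2) do not add
    up to 1; so the pushes together reach every point. As c >= 4, the thresholds 1, 2 and 3 of c x i
    used below are passed before the vertex i. *)
Let c : R := 2 * p.+2%:R.

Fact c_ge4 : 4 <= c.
Proof.
by rewrite /c -natrM ler_nat (@leq_mul2l 2 2).
Qed.

(** [b] is nonzero only for c x i > 2 and s > 1/2, where [a] and [step (2 * s)] are 1: the parameter
    [v] moves only after the link has been contracted to a point. Where [b] is 1, the coordinate i
    is halved. *)
Let a (x : simplex p.+1) := step (c * sval x 0 i - 1).
Let b (x : simplex p.+1) (s : R) := step (c * sval x 0 i - 2) * step (2 * s - 1).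
Let v (x : simplex p.+1) (s : R) := 1 - sval x 0 i * (1 - b x s / 2).

Let b01 (x : simplex p.+1) (s : R) : 0 <= b x s <= 1.
Proof.
rewrite /b mulr_ge0 ?step_ge0 //=.
by rewrite -[leRHS]mul1r ler_pM ?step_ge0 ?step_le1.
Qed.

Let v_ge (x : simplex p.+1) (s : R) : 1 - sval x 0 i <= v x s.
Proof.
have [b0 b1] := andP (b01 x s); rewrite /v.
rewrite lerD2l lerN2 ler_piMr ?std_ge0 //; lra.
Qed.

Let v01 (x : simplex p.+1) (s : R) : 0 < sval x 0 i -> 0 <= v x s < 1.
Proof.
move=> x0; have [b0 b1] := andP (b01 x s); have := std_le1 x i => x1.
apply/andP; split; first by apply: le_trans (v_ge x s); rewrite subr_ge0.
rewrite /v ltrBlDr ltrDl mulr_gt0 //; lra.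
Qed.

(* Near the vertex i the link is first contracted to its vertex 0, which leaves a
   neighbourhood of the vertex i inside the edge from i to 0, and is then pushed
   off the vertex i along this edge. *)
Let W (x : simplex p.+1) (s : R) : simplex p.+1 :=
  if c * sval x 0 i <= 1 then x
  else phi i (H (radial i x) (a x * step (2 * s)), to_half (v x s)).

(** [radial i] is junk at the vertex i; for smoothness there, a polar lift z must replace it. At the
    vertex either [v] is 0, so that z does not matter, or s > 1/2 and H has already reached its
    constant end. *)
Let WE (x : simplex p.+1) (s : R) (z : simplex p) : 0 < sval x 0 i ->
  (forall k, sval x 0 (lift i k) = (1 - sval x 0 i) * sval z 0 k) ->
  W x s = phi i (H z (a x * step (2 * s)), to_half (v x s)).
Proof.
move=> xi0 xz; have c4 := c_ge4; rewrite /W; case: leP => [cx|cx].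
  have -> : a x = 0 by rewrite /a step_le0 //; lra.
  have vx : v x s = 1 - sval x 0 i.
    by rewrite /v /b step_le0 ?mul0r ?subr0 ?mulr1 //; lra.
  rewrite mul0r H0 //; have /andP[v0 v1] := v01 s xi0.
  by apply: phi_eqP => /= [|k]; rewrite to_halfE // vx ?subKr // xz.
have [/eqP xi|xi] := boolP (sval x 0 i == 1); last first.
  by rewrite (@radial_uniq _ _ i x z (1 - sval x 0 i)) // subKr.
have ax : a x = 1 by rewrite /a xi step_ge1 //; lra.
have [s1|s1] := leP s 2^-1; last first.
  by rewrite ax mul1r step_ge1 ?H1 //; lra.
have vx : v x s = 0.
  have s2 : 2 * s - 1 <= 0 by lra.
  by rewrite /v /b xi (step_le0 s2); lra.
by apply: phi_eqP => [|k]; rewrite ?phi_diag ?phi_lift /= vx to_halfE // !mul0r.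
Qed.

Let W_smooth : @dsmooth2 (dsimplex p.+1) (dsimplex p.+1) W.
Proof.
move=> n U x s xP sP; have oU := plot_open xP; have c4 := c_ge4; apply: plot_glue => u Uu.
have xiP := simplex_coord_plot i xP.
have [xi|xi] := ltP (sval (x u) 0 i) c^-1.
  have oV := splot_lt (a := c^-1) xiP.
  exists (U `&` [set u | sval (x u) 0 i < c^-1]), x; split => //.
  - by apply: plot_sub xP oV _ => w [].
  - move=> w [Uw /= xw]; rewrite /W ifT //.
    have c0 : 0 < c by lra.
    by rewrite mulrC -ler_pdivlMr // mul1r ltW.
have xi0 : 0 < sval (x u) 0 i by apply: lt_le_trans xi; rewrite invr_gt0; lra.
have [V [z [Vu VU zP xz]]] := polarP i xP Uu.
have VxiP := plot_sub xiP (plot_open zP) VU.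
have oV := splot_gt (a := 0) VxiP.
set V' := V `&` _ in oV; have V'V : V' `<=` V by move=> w [].
have xiP' := plot_sub VxiP oV V'V.
have sP' := plot_sub sP oV (subset_trans V'V VU).
have cP (d : R) := @splot_cst R n V' d oV.
have cxP (d : R) : @is_plot R dline n V' (fun u => step (c * sval (x u) 0 i - d)).
  by apply: splot_step; apply: splotB => //; apply: splotM.
have vP : @is_plot R dline n V' (fun u => v (x u) (s u)).
  apply: splotB => //; apply: splotM => //; apply: splotB => //; apply: splotM => //.
  by apply: splotM => //; apply: splot_step; apply: splotB => //; exact: splotM.
exists V', (fun w => phi i (H (z w) (a (x w) * step (2 * s w)), to_half (v (x w) (s w)))).
split => //; first exact: subset_trans VU.
- apply: (@phi_dsmooth R p i n V'
    (fun w => (H (z w) (a (x w) * step (2 * s w)), to_half (v (x w) (s w))))); split.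
    apply: sH; first exact: plot_sub zP oV V'V.
    by apply: splotM; [exact: cxP|apply: splot_step; exact: splotM].
  by apply: to_half_plot => // w [_ xw]; exact: v01.
- by move=> w [Vw xw]; apply: WE => // k; exact: xz.
Qed.

Lemma push_off : exists w, mono_htpy id w /\
  forall x : simplex p.+1, 2 <= c * sval x 0 i -> 0 < sval (w x) 0 0.
Proof.
have c4 := c_ge4; have [k0 i0k] : exists k, 0 = lift i k.
  by case: (unliftP i 0) => [k ->|e]; [exists k|by move: i0; rewrite -e eqxx].
have k00 : k0 = 0.
  apply/val_inj; have /(congr1 val) /= := i0k; rewrite /bump.
  by case: (val k0) => // m; rewrite addnS.
have lift0 k : (lift i k == 0) = (k == 0) by rewrite i0k (inj_eq lift_inj) k00.
have W1 (x : simplex p.+1) (s : R) : 1 <= s -> W x s = W x 1.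
  by move=> s1; rewrite /W /v /b !(@step_ge1 _ (2 * _)) ?(@step_ge1 _ (2 * _ - 1)) //; lra.
have Wphi (x : simplex p.+1) (s : R) : c * sval x 0 i > 1 ->
    W x s = phi i (H (radial i x) (a x * step (2 * s)), to_half (v x s)).
  by move=> cx; rewrite /W lt_geF.
have Wi (x : simplex p.+1) (s : R) : c * sval x 0 i > 1 -> sval (W x s) 0 i <= sval x 0 i.
  move=> cx; have xi0 : 0 < sval x 0 i by rewrite -(pmulr_rgt0 _ (_ : 0 < c)); lra.
  have /andP[v0 v1] := v01 s xi0.
  rewrite Wphi // phi_diag /= to_halfE // lerBlDr -lerBlDl.
  exact: v_ge.
have Wl (x : simplex p.+1) (s : R) k : c * sval x 0 i > 1 -> sval (W x s) 0 (lift i k) =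
    v x s * sval (H (radial i x) (a x * step (2 * s))) 0 k.
  move=> cx; have xi0 : 0 < sval x 0 i by rewrite -(pmulr_rgt0 _ (_ : 0 < c)); lra.
  have /andP[v0 v1] := v01 s xi0.
  by rewrite Wphi // phi_lift /= to_halfE.
exists (W^~ 1); split.
  exists W; split => //.
  - move=> x s s0.
    rewrite /W; case: leP => // cx; rewrite [step (2 * s)]step_le0 ?mulr0 ?H0 //; last lra.
    have x0 : 0 < sval x 0 i by rewrite -(pmulr_rgt0 _ (_ : 0 < c)); lra.
    have vx : v x s = 1 - sval x 0 i.
      by rewrite /v /b [step (2 * s - 1)]step_le0 ?mulr0 ?mul0r ?subr0 ?mulr1 //; lra.
    have /andP[v0 v1] := v01 s x0.
    by apply: esym; apply: phi_eqP => /= [|k]; rewrite to_halfE // vx ?subKr // radialK.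
  - move=> x s k kn0; have [cx|cx] := leP (c * sval x 0 i) 1; first by rewrite /W cx.
    case: (unliftP i k) kn0 => [l ->|-> _]; last exact: Wi.
    rewrite lift0 => l0; rewrite Wl // radialK.
    have [/eqP b0|b0] := boolP (b x s == 0).
      have -> : v x s = 1 - sval x 0 i by rewrite /v b0 mul0r subr0 mulr1.
      by rewrite ler_wpM2l ?subr_ge0 ?std_le1 // Hm.
    have cx2 : 2 < c * sval x 0 i.
      rewrite ltNge; apply: contra b0 => h; rewrite /b step_le0 ?mul0r //; lra.
    have s2 : 1 < 2 * s.
      rewrite ltNge; apply: contra b0 => h; rewrite /b [step (2 * s - 1)]step_le0 ?mulr0 //; lra.
    rewrite /a !step_ge1 ?mulr1 ?H1 /= ?mxE ?(negPf l0) ?andbF ?mulr0 //; try lra.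
    by rewrite mulr_ge0 ?std_ge0 // subr_ge0 std_le1.
move=> x cx; rewrite i0k Wl; last lra.
rewrite /a !step_ge1 ?mulr1 ?H1 //=; try lra.
rewrite mxE k00 !eqxx mulr1.
have xi0 : 0 < sval x 0 i by rewrite -(pmulr_rgt0 _ (_ : 0 < c)); lra.
have [xi|xi] := eqVneq (sval x 0 i) 1.
  by rewrite /v /b xi !step_ge1; lra.
apply: lt_le_trans (v_ge x 1); rewrite subr_gt0 lt_neqAle xi; exact: std_le1.
Qed.
End Push.

(** When i is treated, either c x i is at least 2 and the push makes x 0 positive, or the bound
    holds for i. Both outcomes survive the later pushes, since these move mass only towards the
    vertex 0. *)
Lemma push_all p (L : seq 'I_p.+2) :
  @mono_htpy p id (fun=> exist _ _ (vertex_std ord0)) ->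
  exists g : simplex p.+1 -> simplex p.+1, mono_htpy id g /\ forall x, 0 < sval (g x) 0 0 \/
      forall i, i \in L -> i != 0 -> 2 * p.+2%:R * sval (g x) 0 i <= 2.
Proof.
move=> [H [sH H0 H1 Hm]]; elim: L => [|i L [g [hg gL]]].
  by exists id; split; [exact: mono_htpy_refl|right].
have [i0|i0] := eqVneq i 0.
  exists g; split => // x; have [?|h] := gL x; [by left|right] => j.
  by rewrite inE => /orP[/eqP ->|]; [rewrite i0 eqxx|exact: h].
have [w [hw w0]] := push_off i0 sH H0 H1 Hm.
have wm := mono_htpy_le hw.
exists (w \o g); split.
  exact: (mono_htpy_trans hg (mono_htpy_comp hg hw)).
move=> x /=; have [g0|gx] := gL x.
  by left; apply: (lt_le_trans g0); apply: mono_le0 => k; exact: wm.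
have [gi|gi] := leP 2 (2 * p.+2%:R * sval (g x) 0 i); first by left; exact: w0.
right=> j; have wle k : k != 0 ->
    2 * p.+2%:R * sval (w (g x)) 0 k <= 2 * p.+2%:R * sval (g x) 0 k.
  by move=> k0; rewrite ler_wpM2l ?mulr_ge0 //; exact: wm.
rewrite inE => /orP[/eqP -> _|jL j0]; first exact: le_trans (wle _ i0) (ltW gi).
exact: le_trans (wle _ j0) (gx _ jL j0).
Qed.

Lemma simplex_contraction p : @mono_htpy p id (fun=> exist _ _ (vertex_std ord0)).
Proof.
elim: p => [|p IH].
  exists (fun x s => x); split=> // x s _; exact: simplex0_eq.
have [g [hg gL]] := push_all (enum 'I_p.+2) IH.
have g0 x : 0 < sval (g x) 0 0.
  have [//|h] := gL x; rewrite ltNge; apply/negP => g0.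
  have {}g0 : sval (g x) 0 0 = 0 by apply/eqP; rewrite eq_le g0 std_ge0.
  have [gs _] := svalP (g x).
  have : \sum_k 2 * p.+2%:R * sval (g x) 0 (lift 0 k) <= \sum_(k < p.+1) (2 : R).
    by apply: ler_sum => k _; apply: h; rewrite ?mem_enum.
  rewrite -mulr_sumr sumr_const card_ord -[X in _ <= X]mulr_natr.
  move: gs; rewrite (sum_lift _ 0) g0 add0r => ->.
  by rewrite mulr1 ler_pM2l // ler_nat ltnn.
apply: (mono_htpy_trans hg).
(* Since the coordinate 0 of [g x] is positive, v < 1, and the segment to the vertex 0 stays in the
   image of [phi 0]. *)
pose v x s : R := (1 - sval (g x) 0 0) * (1 - step s).
have v01 x s : 0 <= v x s < 1.
  have := g0 x; have := std_le1 (g x) 0; have := @step_ge0 R s; have := @step_le1 R s => *.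
  rewrite /v mulr_ge0 ?subr_ge0 //=.
  by apply: (@le_lt_trans _ _ (1 - sval (g x) 0 0)); [rewrite ler_piMr|]; lra.
exists (fun x s => phi 0 (radial 0 (g x), to_half (v x s))); split.
- move=> n U x s xP sP; apply: plot_glue => u Uu.
  have gP : @is_plot R (dsimplex p.+1) n U (g \o x) by exact: (mono_htpy_smooth hg).
  have [V [z [Vu VU zP xz]]] := polarP 0 gP Uu; have oV := plot_open zP.
  exists V, (fun w => phi 0 (z w, to_half (v (x w) (s w)))); split => //.
    apply: (@phi_dsmooth R p 0 n V (fun w => (z w, to_half (v (x w) (s w))))); split => //.
    apply: to_half_plot => [|w _]; last exact: v01.
    apply: splotM; apply: splotB; try exact: splot_cst.
      by apply: plot_sub (simplex_coord_plot 0 gP) oV VU.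
    by apply: splot_step; exact: plot_sub sP oV VU.
  move=> w Vw; have /andP[? ?] := v01 (x w) (s w); apply: phi_eqP => [|k].
    by rewrite phi_diag.
  rewrite phi_lift /= to_halfE //.
  by rewrite /v -!(mulrC (1 - step _)) -!mulrA -radialK xz.
- move=> x s s0; have /andP[? ?] := v01 x s; apply: esym; apply: phi_eqP => /= [|k].
    by rewrite to_halfE // /v step_le0 // subr0 mulr1 subKr.
  by rewrite to_halfE // /v step_le0 // subr0 mulr1 radialK.
- move=> x s s1; have /andP[? ?] := v01 x s.
  apply: simplex_eq => k; case: (unliftP 0 k) => [l ->|->].
    by rewrite phi_lift /= to_halfE // /v step_ge1 // subrr mulr0 mul0r mxE.
  by rewrite phi_diag /= to_halfE // /v step_ge1 // subrr mulr0 subr0 mxE eqxx.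
- move=> x s k; have /andP[? ?] := v01 x s; case: (unliftP 0 k) => [l -> _|->]; last by rewrite eqxx.
  rewrite phi_lift /= to_halfE //; apply: le_trans (mono_htpy_le hg _ _) => //.
  rewrite radialK /v mulrAC ler_piMr // ?mulr_ge0 ?std_ge0 ?subr_ge0 ?std_le1 //.
  by rewrite lerBlDr lerDl step_ge0.
Qed.
End KiharaContraction.

(** * Acyclic carriers *)

Section Alternating.

Lemma lift_swap_swap p (i : 'I_p.+3) (j : 'I_p.+2) :
  lift_swap (lift i j) (lift_swap i j) = j.
Proof.
by apply: (@lift_inj _ (lift (lift i j) (lift_swap i j))); rewrite !lift_swapK.
Qed.

(** The involution (i, j) |-> ([lift i j], [lift_swap i j]) exchanges the pairs with j < i and those
    with i <= j, and it changes i + j by one; so the terms cancel in pairs. *)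
Lemma alternating_sum0 (M : lmodType int) p (F : 'I_p.+3 -> 'I_p.+2 -> M) :
  (forall i j, F i j = F (lift i j) (lift_swap i j)) ->
  \sum_(i < p.+3) (-1) ^+ i *: \sum_(j < p.+2) (-1) ^+ j *: F i j = 0.
Proof.
move=> hF; under eq_bigr do rewrite scaler_sumr.
rewrite pair_bigA /= (bigID (fun ij : 'I_p.+3 * 'I_p.+2 => (ij.2 < ij.1)%N)) /=.
pose tau (ij : 'I_p.+3 * 'I_p.+2) := (lift ij.1 ij.2, lift_swap ij.1 ij.2).
have tauK : involutive tau by move=> [i j]; rewrite /tau /= lift_swapK lift_swap_swap.
have tau_lt ij : ((tau ij).2 < (tau ij).1)%N = ~~ (ij.2 < ij.1)%N.
  case: ij => i j; rewrite /= /bump /unbump.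
  case: (ltnP j i) => ji; last by rewrite subn0 add1n ltnS ji.
  by rewrite add0n subn1; apply/negbTE; rewrite -leqNgt; case: (nat_of_ord i) ji.
have tau_ltN ij : ~~ ((tau ij).2 < (tau ij).1)%N = (ij.2 < ij.1)%N by rewrite tau_lt negbK.
rewrite [X in _ + X](reindex_inj (inv_inj tauK)) [X in _ + X](eq_bigl _ _ tau_ltN) /=.
rewrite -big_split big1 // => -[i j] /= ji.
rewrite -hF !scalerA -!exprD.
have -> : ((-1) ^+ (bump i j + unbump j i) = - (-1) ^+ (i + j) :> int)%R.
  rewrite /bump /unbump ji leqNgt ji add0n subn1.
  case: (nat_of_ord i) ji => // m _; rewrite addSn exprS mulN1r opprK.
  by rewrite addnC.
by rewrite scaleNr subrr.
Qed.

End Alternating.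

(* Solving  bd (T p.+1 s) = E p s +- sum_i (-1)^i push i (T p (d i s))  degree by
   degree in complexes A p attached to the simplices of dimension p. *)
Section AcyclicLifting.
Variables (S : nat -> Type) (d : forall p, 'I_p.+2 -> S p.+1 -> S p).
Hypothesis dC : forall p (i : 'I_p.+3) (j : 'I_p.+2) s,
  d j (d i s) = d (lift_swap i j) (d (lift i j) s).
Variables (A : nat -> nat -> lmodType int).
Variable bd : forall p n, {additive A p n.+1 -> A p n}.
Variable push : forall p n, 'I_p.+2 -> {additive A p n -> A p.+1 n}.
Hypothesis push_bd : forall p n i a, push n i (bd p n a) = bd p.+1 n (push n.+1 i a).
Hypothesis pushC : forall p n (i : 'I_p.+3) (j : 'I_p.+2) (a : A p n),
  push n i (push n j a) = push n (lift i j) (push n (lift_swap i j) a).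
Variable sup : forall p n, S p -> A p n -> Prop.
Hypothesis sup0 : forall p n s, @sup p n s 0.
Hypothesis supD : forall p n s a b, @sup p n s a -> sup s b -> sup s (a + b).
Hypothesis supN : forall p n s a, @sup p n s a -> sup s (- a).
Hypothesis sup_push : forall p n i s (a : A p n), sup (d i s) a -> sup s (push n i a).

Lemma sup_sign p n (s : S p) (a : A p n) m : sup s a -> sup s ((-1) ^+ m *: a).
Proof. by move=> sa; rewrite -signr_odd scaler_sign; case: ifP => // _; exact: supN. Qed.

Definition altpush p n (T : S p -> A p n) (s : S p.+1) : A p.+1 n :=
  \sum_(i < p.+2) (-1) ^+ i *: push n i (T (d i s)).

Lemma altpush0E n (T : S 0 -> A 0 n) s : altpush T s =
  push n ord0 (T (d ord0 s)) - push n (lift ord0 ord0) (T (d (lift ord0 ord0) s)).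
Proof.
by rewrite /altpush !big_ord_recl big_ord0 /= expr0 scale1r expr1 scaleN1r addr0.
Qed.

Lemma sup_altpush p n (T : S p -> A p n) s :
  (forall s, sup s (T s)) -> sup s (altpush T s).
Proof.
move=> hT; rewrite /altpush; elim/big_ind: _ => // [a b|i _]; first exact: supD.
by apply/sup_sign/sup_push.
Qed.

Lemma bd_altpush p n (T : S p -> A p n.+1) s :
  bd p.+1 n (altpush T s) = altpush (fun s => bd p n (T s)) s.
Proof.
by rewrite /altpush raddf_sum; apply: eq_bigr => i _; rewrite raddfZsign push_bd.
Qed.

Lemma altpushK p n (T : S p -> A p n) s : altpush (altpush T) s = 0.
Proof.
rewrite -[RHS](@alternating_sum0 _ p
  (fun i j => push n i (push n j (T (d j (d i s)))))); last first.
  by move=> i j; rewrite pushC dC.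
apply: eq_bigr => i _; congr (_ *: _); rewrite raddf_sum; apply: eq_bigr => j _.
by rewrite raddfZsign.
Qed.

Lemma altpushD p n (T T' : S p -> A p n) s :
  altpush (fun s => T s + T' s) s = altpush T s + altpush T' s.
Proof.
by rewrite /altpush -big_split; apply: eq_bigr => i _; rewrite raddfD scalerDr.
Qed.

Lemma altpushZ p n (T : S p -> A p n) m s :
  altpush (fun s => (-1) ^+ m *: T s) s = (-1) ^+ m *: altpush T s.
Proof.
rewrite /altpush scaler_sumr; apply: eq_bigr => i _.
by rewrite raddfZsign !scalerA mulrC.
Qed.

Variables (E : forall p, S p.+1 -> A p.+1 p) (e : nat) (T0 : S 0 -> A 0 0).
Hypothesis supE : forall p s, sup s (@E p s).
Hypothesis bdE : forall p s, bd _ _ (@E p.+1 s) = - ((-1) ^+ e *: altpush (@E p) s).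
Hypothesis supT0 : forall s, sup s (T0 s).

Let solvable p (T : S p -> A p p) := forall s : S p.+1,
  exists a, sup s a /\ bd _ _ a = @E p s + (-1) ^+ e *: altpush T s.

Hypothesis solve0 : solvable T0.
Hypothesis acyclicA : forall p (s : S p.+2) (a : A p.+2 p.+1),
  sup s a -> bd _ _ a = 0 -> exists a', sup s a' /\ bd _ _ a' = a.

(** Solvability in the next degree is part of the state, since it depends on the choices made so
    far. *)
Let state p := {T : S p -> A p p | (forall s, sup s (T s)) /\ solvable T}.

Let next p (T : state p) : {T' : state p.+1 |
  forall s, bd _ _ (sval T' s) = @E p s + (-1) ^+ e *: altpush (sval T) s}.
Proof.
case: T => T [sT hT] /=.
have hT' s : sup s (sval (cid (hT s))) by have [] := svalP (cid (hT s)).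
have bT' s : bd _ _ (sval (cid (hT s))) = @E p s + (-1) ^+ e *: altpush T s.
  by have [] := svalP (cid (hT s)).
pose T' s := sval (cid (hT s)).
suff sol : solvable T' by exists (exist _ T' (conj hT' sol)).
move=> s; apply: acyclicA.
  by apply: supD => //; apply: sup_sign; exact: sup_altpush.
(* The right-hand side is a cycle: the boundary of E cancels against the E in the boundary of T',
   and [altpush] squares to zero. *)
rewrite raddfD raddfZsign bd_altpush bdE.
have -> : altpush (fun s => bd _ _ (T' s)) s =
    altpush (fun s => @E p s + (-1) ^+ e *: altpush T s) s.
  by congr altpush; apply/funext => s'; exact: bT'.
by rewrite altpushD altpushZ altpushK scaler0 addr0 addNr.
Qed.

(** Used twice: with E = 0 and e = 0 for the existence of carried chain maps, and with e = 1, E the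
    difference of two of them and degrees shifted by one, for the homotopy between them. *)
Lemma acyclic_lift : exists T : forall p, S p -> A p p,
  [/\ T 0%N = T0, forall p s, sup s (T p s) &
      forall p s, bd _ _ (T p.+1 s) = @E p s + (-1) ^+ e *: altpush (T p) s].
Proof.
pose T := nat_rect state (exist _ T0 (conj supT0 solve0)) (fun p t => sval (next t)).
exists (fun p => sval (T p)); split => // [p s|p s].
  by have [] := svalP (T p).
exact: (svalP (next (T p))).
Qed.
End AcyclicLifting.

(* Singular chains are needed both for Kihara's simplices and for affine ones. *)
Record model (R : realType) := Model {
  mspace :> nat -> dspace R;
  mcof : forall p, 'I_p.+2 -> smooth_map (mspace p) (mspace p.+1);
  mcofC : forall p (i : 'I_p.+3) (j : 'I_p.+2) x,
    mcof i (mcof j x) = mcof (lift i j) (mcof (lift_swap i j) x) }.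

(** * Chains over a model, their supports, and carried chain maps *)

Section ModelChains.
Context {R : realType}.
Implicit Types (D : model R) (X Y Z : dspace R).

Definition msing D X p : choiceType := smooth_map (D p) X.
Definition mface D X p (i : 'I_p.+2) (s : msing D X p.+1) : msing D X p :=
  smooth_comp s (mcof D i).
Definition mchain D X p : lmodType int := {freeg (msing D X p) / int}.
Definition mbd D X p : {additive mchain D X p.+1 -> mchain D X p} :=
  fglift (fun s : msing D X p.+1 => \sum_(i < p.+2) (-1) ^+ i *: << mface i s >>).
Definition mmap D X Y (f : smooth_map X Y) p : {additive mchain D X p -> mchain D Y p} :=
  fglift (fun s : msing D X p => << (smooth_comp f s : msing D Y p) >>).

Arguments mmap {D X Y} f p.

Lemma mfaceC D X p (i : 'I_p.+3) (j : 'I_p.+2) (s : msing D X p.+2) :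
  mface j (mface i s) = mface (lift_swap i j) (mface (lift i j) s).
Proof. by apply: smooth_map_eq => x /=; rewrite mcofC. Qed.

Lemma freeg_ext (K : choiceType) (M : zmodType) (f g : {additive {freeg K / int} -> M}) :
  (forall s, f << s >> = g << s >>) -> f =1 g.
Proof.
move=> fg c; rewrite -(freeg_sumE c) !raddf_sum; apply: eq_bigr => s _.
by rewrite (freegU_intz (coeff s c)) !raddfMz fg.
Qed.

Lemma fgliftU (K : choiceType) (M : lmodType int) (f : K -> M) s : fglift f << s >> = f s.
Proof. by rewrite liftU scale1r. Qed.

Lemma mbdU D X p (s : msing D X p.+1) :
  mbd D X p << s >> = \sum_(i < p.+2) (-1) ^+ i *: << mface i s >>.
Proof. exact: fgliftU. Qed.

Lemma mmapU D X Y (f : smooth_map X Y) p (s : msing D X p) :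
  mmap f p << s >> = << (smooth_comp f s : msing D Y p) >>.
Proof. exact: fgliftU. Qed.

Lemma mmap_bd D X Y (f : smooth_map X Y) p (c : mchain D X p.+1) :
  mmap f p (mbd _ _ _ c) = mbd _ _ _ (mmap f p.+1 c).
Proof.
apply: (@freeg_ext _ _ (mmap f p \o mbd D X p) (mbd D Y p \o mmap f p.+1)) => s /=.
rewrite mbdU mmapU mbdU raddf_sum; apply: eq_bigr => i _.
by rewrite raddfZsign mmapU; congr (_ *: << _ >>); exact: smooth_map_eq.
Qed.

Lemma mmap_comp D X Y Z (g : smooth_map Y Z) (f : smooth_map X Y) p (c : mchain D X p) :
  mmap g p (mmap f p c) = mmap (smooth_comp g f) p c.
Proof.
apply: (@freeg_ext _ _ (mmap g p \o mmap f p) (mmap (smooth_comp g f) p)) => s /=.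
by rewrite !mmapU; congr (<< _ >>); exact: smooth_map_eq.
Qed.

Lemma mmap_deg D X Y (f : smooth_map X Y) p (c : mchain D X p) : deg (mmap f p c) = deg c.
Proof.
by apply: (@freeg_ext (msing D X p) int (@deg _ \o mmap f p) (@deg _)) => s; rewrite /= mmapU !degU.
Qed.

(** Chains in a subset are kept as chains of X rather than as chains of a subspace, so that chains
    in different subsets can be added directly. *)
Definition supp D X p (B : set X) (c : mchain D X p) : Prop :=
  forall s : msing D X p, coeff s c != 0 -> forall x, B (s x).

Section Support.
Variables (D : model R) (X : dspace R) (p : nat) (B : set X).
Implicit Types c : mchain D X p.

Lemma supp0 : supp B (0 : mchain D X p).
Proof. by move=> s; rewrite coeff0 eqxx. Qed.

Lemma suppD c c' : supp B c -> supp B c' -> supp B (c + c').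
Proof.
move=> hc hc' s; rewrite coeffD => h x.
have [/eqP c0|/hc //] := boolP (coeff s c == 0).
by apply: hc' => //; move: h; rewrite c0 add0r.
Qed.

Lemma suppN c : supp B c -> supp B (- c).
Proof. by move=> hc s; rewrite coeffN oppr_eq0; exact: hc. Qed.

Lemma suppMz c z : supp B c -> supp B (c *~ z).
Proof.
have suppMn n : supp B c -> supp B (c *+ n).
  by elim: n => [_|n IH h]; [exact: supp0|rewrite mulrS; apply: suppD => //; exact: IH].
by move=> h; case: z => n; [exact: suppMn|rewrite NegzE mulrNz; apply/suppN/suppMn].
Qed.

Lemma suppU (s : msing D X p) : (forall x, B (s x)) -> supp B (<< s >> : mchain D X p).
Proof. by move=> Bs s'; rewrite coeffU mul1r; have [<- _|] := eqVneq s s'. Qed.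

Lemma chain_sum c : c = \sum_(s <- dom c) << s >> *~ coeff s c.
Proof. by rewrite -[LHS]freeg_sumE; apply: eq_bigr => s _; exact: freegU_intz. Qed.

(** Induction over the simplices of c. A general P covers supports as well as, with f = [idfun],
    identities that hold only for chains in B. *)
Lemma supp_additive (M : zmodType) (P : M -> Prop) (f : {additive mchain D X p -> M}) c :
  P 0 -> (forall a b, P a -> P b -> P (a + b)) -> (forall a z, P a -> P (a *~ z)) ->
  (forall s : msing D X p, (forall x, B (s x)) -> P (f << s >>)) -> supp B c -> P (f c).
Proof.
move=> P0 PD PM Pf hc; rewrite [c]chain_sum raddf_sum big_seq_cond.
elim/big_ind: _ => // s; rewrite andbT mem_dom => /hc Bs.
by rewrite raddfMz; apply/PM/Pf.
Qed.
End Support.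

Lemma supp_mmap D X Y (f : smooth_map X Y) p (B : set X) (B' : set Y) (c : mchain D X p) :
  (forall x, B x -> B' (f x)) -> supp B c -> supp B' (mmap f p c).
Proof.
move=> BB'; apply: supp_additive.
- exact: supp0.
- by move=> ? ?; exact: suppD.
- by move=> ? ?; exact: suppMz.
- by move=> s Bs; rewrite mmapU; apply: suppU => x /=; apply/BB'/Bs.
Qed.

Lemma cst_smooth X Y (y : Y) : dsmooth (fun _ : X => y).
Proof. by move=> n U p pP; apply: plot_cst; exact: plot_open pP. Qed.
Definition cst_map X Y (y : Y) : smooth_map X Y := SmoothMap (cst_smooth y).

(** Vanishing of the reduced homology of the complex of chains in B, with [deg] as augmentation. *)
Record acyclic D X (B : set X) : Prop := Acyclic {
  acyclic_pt : exists x, B x;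
  acyclic0 : forall c : mchain D X 0, supp B c -> deg c = 0 ->
    exists c', supp B c' /\ mbd _ _ _ c' = c;
  acyclicS : forall p (c : mchain D X p.+1), supp B c -> mbd _ _ _ c = 0 ->
    exists c', supp B c' /\ mbd _ _ _ c' = c }.

Definition chomo D X D' Z (f g : forall p, mchain D X p -> mchain D' Z p) : Prop :=
  exists h : forall p, {additive mchain D X p -> mchain D' Z p.+1},
    (forall c, f 0%N c - g 0%N c = mbd _ _ _ (h 0%N c)) /\
    (forall p c, f p.+1 c - g p.+1 c = mbd _ _ _ (h p.+1 c) + h p (mbd _ _ _ c)).

Section Carriers.
Variables (D D' : model R) (X Z : dspace R).
Variable B : forall p, msing D X p -> set (dprod (D p) Z).
Hypothesis B_face : forall p (s : msing D X p.+1) i b z,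
  B (mface i s) (b, z) -> B s (mcof D i b, z).

Lemma cof_prod_smooth p (i : 'I_p.+2) :
  @dsmooth R (dprod (D p) Z) (dprod (D p.+1) Z) (fun bz => (mcof D i bz.1, bz.2)).
Proof. by move=> n U q [q1 q2]; split => //; exact: (sm_smooth (mcof D i)). Qed.
Definition cof_prod p (i : 'I_p.+2) := SmoothMap (cof_prod_smooth i).

Definition snd_map p : smooth_map (dprod (D p) Z) Z := SmoothMap (@dsmooth_snd R (D p) Z).

(** [L p s] stands for the image of the identity simplex of [D p]; it is kept in the product with
    [D p], where its support can be compared with [B s], and [induced] forgets this factor. *)
Definition system : Type := forall p, msing D X p -> mchain D' (dprod (D p) Z) p.

Record carried (L : system) : Prop := Carried {
  carried_supp : forall p s, supp (B s) (L p s);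
  carried_deg : forall s, deg (L 0%N s) = 1;
  carried_bd : forall p s, mbd _ _ _ (L p.+1 s) =
    \sum_(i < p.+2) (-1) ^+ i *: mmap (cof_prod i) p (L p (mface i s)) }.

Definition induced (L : system) p : {additive mchain D X p -> mchain D' Z p} :=
  fglift (fun s => mmap (snd_map p) p (L p s)).

Lemma inducedU (L : system) p s : induced L p << s >> = mmap (snd_map p) p (L p s).
Proof. exact: fgliftU. Qed.

Hypothesis B_acyclic : forall p (s : msing D X p), acyclic D' (B s).

Lemma mmap_sndcof p (i : 'I_p.+2) n (c : mchain D' (dprod (D p) Z) n) :
  mmap (snd_map p.+1) n (mmap (cof_prod i) n c) = mmap (snd_map p) n c.
Proof. by rewrite mmap_comp; congr (mmap _ _ _); exact: smooth_map_eq. Qed.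

Lemma induced_bd (L : system) p c : carried L ->
  mbd _ _ _ (induced L p.+1 c) = induced L p (mbd _ _ _ c).
Proof.
move=> cL; apply: (@freeg_ext _ _ (mbd _ _ _ \o induced L p.+1) (induced L p \o mbd _ _ _)) => s /=.
rewrite inducedU -mmap_bd carried_bd // mbdU !raddf_sum; apply: eq_bigr => i _.
by rewrite !raddfZsign mmap_sndcof inducedU.
Qed.

Lemma cof_prodC p (i : 'I_p.+3) (j : 'I_p.+2) n (c : mchain D' (dprod (D p) Z) n) :
  mmap (cof_prod i) n (mmap (cof_prod j) n c) =
  mmap (cof_prod (lift i j)) n (mmap (cof_prod (lift_swap i j)) n c).
Proof.
rewrite !mmap_comp; congr (mmap _ _ _).
by apply: smooth_map_eq => -[b z] /=; rewrite mcofC.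
Qed.

Lemma carried_ex : exists L, carried L.
Proof.
pose L0 (s : msing D X 0) : mchain D' (dprod (D 0) Z) 0 :=
  << (cst_map (D' 0) (sval (cid (acyclic_pt (B_acyclic s)))) : msing D' (dprod (D 0) Z) 0) >>.
have [] := @acyclic_lift (msing D X) (@mface D X) (@mfaceC D X)
  (fun p n => mchain D' (dprod (D p) Z) n) (fun p n => mbd D' (dprod (D p) Z) n)
  (fun p n i => mmap (cof_prod i) n) _ (fun p n i j => @cof_prodC p i j n)
  (fun p n s c => supp (B s) c)
  _ _ _ _ (fun p s => 0) 0%N L0.
- by move=> p n i a; rewrite mmap_bd.
- by move=> p n s; exact: supp0.
- by move=> p n s a b; exact: suppD.
- by move=> p n s a; exact: suppN.
- by move=> p n i s a; apply: supp_mmap => -[b z] /=; exact: B_face.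
- by move=> p s; exact: supp0.
- move=> p s; rewrite raddf0 /altpush big1 ?scaler0 ?oppr0 // => i _.
  by rewrite raddf0 scaler0.
- move=> s; apply: suppU => x /=; exact: (svalP (cid (acyclic_pt (B_acyclic s)))).
- move=> s; rewrite add0r expr0 scale1r; refine (acyclic0 (B_acyclic s) (c := _) _ _).
    rewrite altpush0E.
    have h i : supp (B s) (mmap (cof_prod i) 0 (L0 (mface i s))).
      apply: (supp_mmap (B := B (mface i s))) => [[b z]|]; first exact: B_face.
      by apply: suppU => x /=; exact: (svalP (cid (acyclic_pt (B_acyclic (mface i s))))).
    apply: suppD; first exact: h.
    by apply: suppN; exact: h.
  by rewrite altpush0E degB !mmap_deg !degU subrr.
- by move=> p s a; exact: (acyclicS (B_acyclic s)).
move=> L [L00 sL bL]; exists L; split => //.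
  by move=> s; rewrite L00 degU.
by move=> p s; rewrite bL add0r expr0 scale1r.
Qed.

Lemma carried_unique (L L' : system) :
  carried L -> carried L' -> chomo (fun p => induced L p) (fun p => induced L' p).
Proof.
move=> cL cL'.
have suppLL p s : supp (B s) (L p s - L' p s).
  apply: suppD; first exact: carried_supp.
  by apply: suppN; exact: carried_supp.
have bdLL p s : mbd _ _ _ (L p.+1 s - L' p.+1 s) =
    \sum_(i < p.+2) (-1) ^+ i *: mmap (cof_prod i) p (L p (mface i s) - L' p (mface i s)).
  rewrite raddfB (carried_bd cL) (carried_bd cL') -sumrB; apply: eq_bigr => i _.
  by rewrite -scalerBr [in RHS]raddfB.
have T0P (s : msing D X 0) : exists c, supp (B s) c /\ mbd _ _ _ c = L 0%N s - L' 0%N s.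
  apply: (acyclic0 (B_acyclic s)); first exact: suppLL.
  by rewrite degB (carried_deg cL) (carried_deg cL') subrr.
have [] := @acyclic_lift (msing D X) (@mface D X) (@mfaceC D X)
  (fun p n => mchain D' (dprod (D p) Z) n.+1) (fun p n => mbd D' (dprod (D p) Z) n.+1)
  (fun p n i => mmap (cof_prod i) n.+1) _ _ (fun p n s c => supp (B s) c)
  _ _ _ _ (fun p s => L p.+1 s - L' p.+1 s) 1%N (fun s => sval (cid (T0P s))).
- by move=> p n i a; rewrite mmap_bd.
- by move=> p n i j a; exact: cof_prodC.
- by move=> p n s; exact: supp0.
- by move=> p n s a b; exact: suppD.
- by move=> p n s a; exact: suppN.
- by move=> p n i s a; apply: supp_mmap => -[b z] /=; exact: B_face.
- by move=> p s; exact: suppLL.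
- by move=> p s; rewrite bdLL expr1 scaleN1r opprK.
- by move=> s; have [] := svalP (cid (T0P s)).
- move=> s; apply: (acyclicS (B_acyclic s)).
    apply: suppD; first exact: suppLL.
    rewrite expr1 scaleN1r; apply: suppN.
    rewrite /altpush; elim/big_ind: _ => [|a b|i _].
    + exact: supp0.
    + exact: suppD.
    + rewrite -signr_odd scaler_sign.
      have h : supp (B s) (mmap (cof_prod i) 1 (sval (cid (T0P (mface i s))))).
        apply: (supp_mmap (B := B (mface i s))) => [[b z]|]; first exact: B_face.
        by have [] := svalP (cid (T0P (mface i s))).
      by case: ifP => _ //; exact: suppN.
  rewrite raddfD /= bdLL expr1 scaleN1r raddfN /altpush raddf_sum -sumrB big1 // => i _.
  rewrite raddfZsign -mmap_bd.
  by have [_ ->] := svalP (cid (T0P (mface i s))); rewrite subrr.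
- by move=> p s a; exact: (acyclicS (B_acyclic s)).
move=> T [T00 sT bT].
pose h p : {additive mchain D X p -> mchain D' Z p.+1} :=
  fglift (fun s => mmap (snd_map p) p.+1 (T p s)).
have hU p s : h p << s >> = mmap (snd_map p) p.+1 (T p s) by exact: fgliftU.
exists h; split.
  move=> c; apply: (@freeg_ext _ _ (induced L 0 \- induced L' 0) (mbd _ _ _ \o h 0%N)) => s /=.
  rewrite !inducedU hU -mmap_bd T00.
  by have [_ ->] := svalP (cid (T0P s)); rewrite raddfB.
move=> p c; apply: (@freeg_ext _ _ (induced L p.+1 \- induced L' p.+1)
  ((mbd _ _ _ \o h p.+1) \+ (h p \o mbd _ _ _))) => s /=.
rewrite !inducedU hU -mmap_bd bT expr1 scaleN1r !raddfB /= -addrA.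
rewrite [X in _ = _ + X](_ : _ = 0) ?addr0 // addrC; apply/eqP; rewrite subr_eq0; apply/eqP.
rewrite mbdU /altpush !raddf_sum; apply: eq_bigr => i _.
by rewrite !raddfZsign mmap_sndcof hU.
Qed.
End Carriers.
End ModelChains.
Arguments mmap {R D X Y} f p.

(** * Cones *)

Section Models.
Context {R : realType}.
Notation simplex := (@simplex R).

Lemma radial_coface0 p (x : 'rV[R]_p.+1) : radial_fun ord0 (coface_fun ord0 x) = x.
Proof.
by apply/rowP => k; rewrite mxE coface_fun_diag coface_fun_lift subr0 divr1.
Qed.

Lemma lift_swap0 p (i : 'I_p.+2) : lift_swap ord0 i = ord0.
Proof. by apply/val_inj; rewrite /= /unbump ltn0 subn0. Qed.

Lemma coface_fun0 p (i : 'I_p.+2) (x : 'rV[R]_p.+2) :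
  coface_fun (lift ord0 i) x 0 ord0 = x 0 ord0.
Proof.
have := coface_fun_lift (lift ord0 i) x (lift_swap ord0 i).
by rewrite lift_swapK lift_swap0.
Qed.

Lemma radial_cofaceS p (i : 'I_p.+2) (x : 'rV[R]_p.+2) :
  radial_fun ord0 (coface_fun (lift ord0 i) x) = coface_fun i (radial_fun ord0 x).
Proof.
apply/rowP => k; rewrite mxE coface_fun0.
case: (unliftP i k) => [l ->|->]; last by rewrite !coface_fun_diag mul0r.
by rewrite liftC !coface_fun_lift lift_swap0 mxE.
Qed.

Lemma Cn_coface (V : normedModType R) p (i : 'I_p.+2) k (U : set V)
    (f : V -> 'rV[R]_p.+1) : open U ->
  Cn_on k U f -> Cn_on k U (fun u => coface_fun i (f u)).
Proof.
move=> oU cf; apply: Cn_row => // j; case: (unliftP i j) => [l ->|->].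
  by apply: Cn_eq (Cn_coord oU l cf) => // u _; rewrite coface_fun_lift.
by apply: Cn_eq (Cn_cst k U 0) => // u _; rewrite /= coface_fun_diag.
Qed.

Definition aff p : dspace R := dsub ([set x | \sum_i x 0 i = 1] : set (euclid p.+1)).

Lemma aff_vertexP p (i : 'I_p.+1) : \sum_j (vertex i : 'rV[R]_p.+1) 0 j = 1.
Proof. by have [] := @vertex_std R p i. Qed.
Definition aff_vertex p (i : 'I_p.+1) : aff p := exist _ _ (aff_vertexP i).

Lemma aff_cofaceP p (i : 'I_p.+2) (x : aff p) : \sum_j coface_fun i (sval x) 0 j = 1.
Proof.
rewrite (sum_lift _ i) coface_fun_diag add0r -[RHS](svalP x).
by apply: eq_bigr => k _; rewrite coface_fun_lift.
Qed.

Definition aff_coface p (i : 'I_p.+2) (x : aff p) : aff p.+1 :=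
  exist _ _ (aff_cofaceP i x).

Lemma aff_coface_smooth p (i : 'I_p.+2) : dsmooth (aff_coface i).
Proof. by move=> n U x [oU sx]; split => // k; exact: Cn_coface. Qed.

Lemma aff_cofC p (i : 'I_p.+3) (j : 'I_p.+2) x :
  SmoothMap (aff_coface_smooth i) (SmoothMap (aff_coface_smooth j) x) =
  SmoothMap (aff_coface_smooth (lift i j)) (SmoothMap (aff_coface_smooth (lift_swap i j)) x).
Proof. by apply: sval_inj; rewrite /= coface_comm. Qed.

Definition affine_model : model R :=
  @Model R aff (fun p (i : 'I_p.+2) => SmoothMap (aff_coface_smooth i)) aff_cofC.

Lemma kihara_cofC p (i : 'I_p.+3) (j : 'I_p.+2) (x : simplex p) :
  @coface_map R p.+1 i (coface_map j x) =
  coface_map (lift i j) (coface_map (lift_swap i j) x).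
Proof. by apply: sval_inj; rewrite /= coface_comm. Qed.

Definition kihara_model : model R := @Model R (@dsimplex R) (@coface_map R) kihara_cofC.

(* A model is conical if its spaces of positive dimension are cones with vertex 0
   over the space one dimension below: rad is the projection away from the vertex. *)
Record conical (D : model R) := Conical {
  hgt : forall p, D p -> R;
  rad : forall p, D p.+1 -> D p;
  hgt_plot : forall p n (U : set 'rV[R]_n) (x : 'rV[R]_n -> D p),
    is_plot U x -> @is_plot R dline n U (fun u => hgt (x u));
  rad_plot : forall p n (U : set 'rV[R]_n) (x : 'rV[R]_n -> D p.+1),
    is_plot U x -> (forall u, U u -> hgt (x u) != 1) -> is_plot U (fun u => rad (x u));
  hgt0 : forall x : D 0, hgt x = 1;
  hgt_cof0 : forall p (x : D p), hgt (mcof D ord0 x) = 0;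
  rad_cof0 : forall p (x : D p), rad (mcof D ord0 x) = x;
  hgt_cofS : forall p (i : 'I_p.+1) (x : D p), hgt (mcof D (lift ord0 i) x) = hgt x;
  rad_cofS : forall p (i : 'I_p.+2) (x : D p.+1), hgt x != 1 ->
    rad (mcof D (lift ord0 i) x) = mcof D i (rad x) }.

Lemma coface_fun0S p (i : 'I_p.+1) (x : 'rV[R]_p.+1) :
  \sum_j x 0 j = 1 -> coface_fun (lift ord0 i) x 0 ord0 = x 0 ord0.
Proof.
case: p i x => [|p] i x _; last exact: coface_fun0.
have -> : ord0 = lift (lift ord0 i) ord0 :> 'I_2 by rewrite (ord1 i); exact: val_inj.
by rewrite coface_fun_lift.
Qed.

Lemma radial_val p (x : simplex p.+1) : sval x 0 ord0 != 1 ->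
  sval (radial ord0 x) = radial_fun ord0 (sval x).
Proof. by move=> x1; apply/rowP => k; rewrite radialE // mxE. Qed.

Lemma kihara_rad_plot p n (U : set 'rV[R]_n) (x : 'rV[R]_n -> simplex p.+1) :
  @is_plot R (dsimplex p.+1) n U x -> (forall u, U u -> sval (x u) 0 ord0 != 1) ->
  @is_plot R (dsimplex p) n U (fun u => radial ord0 (x u)).
Proof.
move=> xP x1; apply: plot_glue => u Uu; have [V [z [Vu VU zP xz]]] := polarP ord0 xP Uu.
exists V, z; split => // v Vv.
apply: (@radial_uniq R p ord0 (x v) (z v) (1 - sval (x v) 0 ord0)); rewrite ?subKr //.
  exact/x1/VU.
exact: xz.
Qed.

Definition kihara_conical : conical kihara_model.
Proof.
apply: (@Conical kihara_model (fun p (x : simplex p) => sval x 0 ord0 : R)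
  (fun p (x : simplex p.+1) => radial ord0 x)).
- by move=> p n U x; exact: simplex_coord_plot.
- exact: kihara_rad_plot.
- by move=> x; have [<- _] := svalP x; rewrite big_ord1.
- by move=> p x; rewrite /= coface_fun_diag.
- move=> p x; apply: sval_inj; rewrite radial_val /= ?radial_coface0 //.
  by rewrite coface_fun_diag eq_sym oner_eq0.
- by move=> p i x; rewrite /= coface_fun0S //; have [] := svalP x.
- move=> p i x x1; apply: sval_inj; rewrite radial_val /= ?coface_fun0 //.
  by rewrite radial_cofaceS radial_val.
Defined.

Lemma aff_radialP p (x : aff p.+1) : sval x 0 ord0 != 1 ->
  \sum_i radial_fun ord0 (sval x) 0 i = 1.
Proof.
move=> x1; have e : 1 - sval x 0 ord0 = \sum_k sval x 0 (lift ord0 k).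
  case: x x1 => y /= ys _; rewrite -[in LHS]ys (sum_lift _ ord0) [_ + _ - _]addrAC.
  by rewrite subrr add0r.
rewrite (eq_bigr (fun k => sval x 0 (lift ord0 k) / (1 - sval x 0 ord0))).
  by rewrite -mulr_suml -e divff // subr_eq0 eq_sym.
by move=> k _; rewrite mxE.
Qed.

Definition aff_radial p (x : aff p.+1) : aff p :=
  match pselect (sval x 0 ord0 != 1) with
  | left h => exist _ _ (aff_radialP h)
  | right _ => aff_vertex ord0
  end.

Lemma aff_radial_val p (x : aff p.+1) : sval x 0 ord0 != 1 ->
  sval (aff_radial x) = radial_fun ord0 (sval x).
Proof. by rewrite /aff_radial; case: pselect. Qed.

Lemma aff_coord_plot p n (U : set 'rV[R]_n) (x : 'rV[R]_n -> aff p) i :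
  is_plot U x -> @is_plot R dline n U (fun u => sval (x u) 0 i).
Proof. by move=> [oU sx]; apply: splotP => // k; exact: (Cn_coord oU i (sx k)). Qed.

Lemma aff_plotP p n (U : set 'rV[R]_n) (x : 'rV[R]_n -> aff p) : open U ->
  (forall i, @is_plot R dline n U (fun u => sval (x u) 0 i)) -> is_plot U x.
Proof. by move=> oU h; split => // k; apply: Cn_row => // i; case: (h i). Qed.

Lemma aff_rad_plot p n (U : set 'rV[R]_n) (x : 'rV[R]_n -> aff p.+1) :
  is_plot U x -> (forall u, U u -> sval (x u) 0 ord0 != 1) ->
  is_plot U (fun u => aff_radial (x u)).
Proof.
move=> xP x1; have oU := plot_open xP; apply: aff_plotP => // i.
apply: (@plot_ext _ _ (dstruct dline) n U
    (fun u => sval (x u) 0 (lift ord0 i) * (1 - sval (x u) 0 ord0)^-1)).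
  by move=> u Uu; rewrite aff_radial_val ?x1 // mxE.
apply: splotM; first exact: aff_coord_plot.
apply: splotV; first by move=> u Uu; rewrite subr_eq0 eq_sym x1.
by apply: splotB; [exact: splot_cst|exact: aff_coord_plot].
Qed.

Definition affine_conical : conical affine_model.
Proof.
apply: (@Conical affine_model (fun p (x : aff p) => sval x 0 ord0 : R) aff_radial).
- by move=> p n U x; exact: aff_coord_plot.
- exact: aff_rad_plot.
- by move=> [y /= ys]; rewrite -[RHS]ys big_ord1.
- by move=> p x; rewrite /= coface_fun_diag.
- move=> p x; apply: sval_inj; rewrite aff_radial_val /= ?radial_coface0 //.
  by rewrite coface_fun_diag eq_sym oner_eq0.
- by move=> p i x; rewrite /= coface_fun0S //; exact: (svalP x).
- move=> p i x x1; apply: sval_inj; rewrite aff_radial_val /= ?coface_fun0 //.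
  by rewrite radial_cofaceS aff_radial_val.
Defined.

Section Cone.
Variables (D : model R) (cD : conical D) (X : dspace R).

(* The constant tails of H make the cones built from it smooth. *)
Record contraction (A B : set X) (w : X) (H : X -> R -> X) : Prop := Contraction {
  contr_plot : forall n (U : set 'rV[R]_n) (x : 'rV[R]_n -> X) (s : 'rV[R]_n -> R),
    is_plot U x -> (forall u, U u -> A (x u)) -> @is_plot R dline n U s ->
    is_plot U (fun u => H (x u) (s u));
  contr_le0 : forall x s, A x -> s <= 0 -> H x s = x;
  contr_ge1 : forall x s, A x -> 1 <= s -> H x s = w;
  contr_in : forall x s, A x -> B (H x s) }.

Variables (A B : set X) (w : X) (H : X -> R -> X).
Hypothesis cH : contraction A B w H.

(** The factor 2 makes the cone equal to w from height 1/2 on, hence on a neighbourhood of the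
    height 1, where [rad] need not be smooth. Affine simplices also have heights outside [0, 1]; the
    constant tails of H take care of them. *)
Definition cone_fun p (s : D p -> X) (x : D p.+1) : X := H (s (rad cD x)) (2 * hgt cD x).

Lemma cone_smooth p (s : msing D X p) : (forall x, A (s x)) -> dsmooth (cone_fun s).
Proof.
move=> As n U x xP; have oU := plot_open xP; apply: plot_glue => u Uu.
have hP := hgt_plot cD xP.
have [hu|hu] := ltP (hgt cD (x u)) 1.
  have oV := splot_lt (a := 1) hP.
  set V := U `&` _ in oV; have VU : V `<=` U by move=> v [].
  exists V, (cone_fun s \o x); split => //.
  have xPV := plot_sub xP oV VU.
  apply: (contr_plot cH (x := fun v => s (rad cD (x v))) (s := fun v => 2 * hgt cD (x v))) => //.
    apply: (sm_smooth s); apply: (rad_plot (c := cD)) => // v [_ /= hv]; by rewrite lt_eqF.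
  by apply: splotM; [exact: splot_cst|exact: plot_sub hP oV VU].
have oV := splot_gt (a := 2^-1) hP.
exists (U `&` [set v | 2^-1 < hgt cD (x v)]), (fun=> w); split => //.
- by split => //=; lra.
- exact: plot_cst.
- by move=> v [_ /= hv]; rewrite /cone_fun (contr_ge1 cH) //; lra.
Qed.

Definition cone p (s : msing D X p) : mchain D X p.+1 :=
  match pselect (forall x, A (s x)) with
  | left As => << (SmoothMap (cone_smooth As) : msing D X p.+1) >>
  | right _ => 0
  end.

Definition cone_op p : {additive mchain D X p -> mchain D X p.+1} := fglift (@cone p).

Lemma cone_opU p (s : msing D X p) (As : forall x, A (s x)) :
  cone_op p << s >> = << (SmoothMap (cone_smooth As) : msing D X p.+1) >>.
Proof.
rewrite /cone_op /= fgliftU /cone; case: pselect => [As'|//].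
by congr (<< _ >>); exact: smooth_map_eq.
Qed.

Lemma face_cone0 p (s : msing D X p) (As : forall x, A (s x)) :
  mface ord0 (SmoothMap (cone_smooth As) : msing D X p.+1) = s.
Proof.
apply: smooth_map_eq => x; rewrite /= /cone_fun hgt_cof0 rad_cof0 mulr0.
by rewrite (contr_le0 cH).
Qed.

Lemma bd_cone0 (c : mchain D X 0) : supp A c ->
  mbd _ _ _ (cone_op 0 c) = c - << (cst_map (D 0) w : msing D X 0) >> *~ deg c.
Proof.
set w0 := << _ >>; pose P c := mbd D X 0 (cone_op 0 c) = c - w0 *~ deg c.
apply: (@supp_additive _ _ _ _ A _ P idfun c).
- by rewrite /P deg0 !raddf0 addr0.
- by move=> a b; rewrite /P degD !raddfD /= => -> ->; rewrite addrACA.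
- move=> a z; rewrite /P (raddfMz (@deg _)) !raddfMz /= => ->.
  by rewrite mulrzDl.
move=> s As; rewrite /P /= (cone_opU As) mbdU !big_ord_recl big_ord0 addr0.
rewrite expr0 scale1r face_cone0 degU mulr1z.
have -> : ((-1) ^+ (lift ord0 (ord0 : 'I_1)) = -1 :> int) by [].
rewrite scaleN1r; congr (_ - << _ >>); apply: smooth_map_eq => x.
by rewrite /= /cone_fun hgt_cofS hgt0 (contr_ge1 cH) //; lra.
Qed.

Lemma bd_coneS p (c : mchain D X p.+1) : supp A c ->
  mbd _ _ _ (cone_op p.+1 c) = c - cone_op p (mbd _ _ _ c).
Proof.
pose P c := mbd D X p.+1 (cone_op p.+1 c) = c - cone_op p (mbd _ _ _ c).
apply: (@supp_additive _ _ _ _ A _ P idfun c).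
- by rewrite /P !raddf0 ?addr0 ?subr0.
- by move=> a b; rewrite /P !raddfD /= => -> ->; rewrite ?opprD addrACA.
- move=> a z; rewrite /P (raddfMz (cone_op p.+1)) (raddfMz (mbd D X p.+1)).
  by rewrite (raddfMz (mbd D X p)) (raddfMz (cone_op p)) => ->; rewrite mulrzBl.
move=> s As; rewrite /P /= (cone_opU As) !mbdU big_ord_recl expr0 scale1r face_cone0.
congr (_ + _); rewrite raddf_sum -sumrN; apply: eq_bigr => i _.
have Ai x : A (mface i s x) by exact: As.
rewrite raddfZsign (cone_opU Ai).
have -> : ((-1) ^+ (lift ord0 i) = - (-1) ^+ i :> int) by rewrite exprS mulN1r.
rewrite scaleNr; congr (- (_ *: << _ >>)); apply: smooth_map_eq => x.
rewrite /= /cone_fun hgt_cofS.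
have [h1|h1] := eqVneq (hgt cD x) 1; last by rewrite rad_cofS.
by rewrite h1 !(contr_ge1 cH) //; [exact: As|lra|lra].
Qed.

Lemma supp_cone p (c : mchain D X p) : supp A c -> supp B (cone_op p c).
Proof.
apply: supp_additive; [exact: supp0|exact: suppD| |].
  by move=> a z; exact: suppMz.
move=> s As; rewrite (cone_opU As); apply: suppU => x; exact: (contr_in cH).
Qed.
End Cone.

(** A, w and H may depend on the chain, and H may leave A inside B: the rays that contract a finite
    stage of EG leave that stage. *)
Lemma contraction_acyclic (D : model R) (cD : conical D) (X : dspace R) (B : set X) :
  (exists x, B x) ->
  (forall p (c : mchain D X p), supp B c -> exists A w H,
     [/\ B w, supp A c & contraction A B w H]) ->
  acyclic D B.
Proof.
move=> B0 hB; split => // [c Bc c0|p c Bc c0].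
  have [A [w [H [Bw Ac cH]]]] := hB _ c Bc; exists (cone_op cD cH 0 c).
  by split; [exact: supp_cone|rewrite bd_cone0 // c0 mulr0z subr0].
have [A [w [H [Bw Ac cH]]]] := hB _ c Bc; exists (cone_op cD cH p.+1 c).
by split; [exact: supp_cone|rewrite bd_coneS // c0 raddf0 subr0].
Qed.
End Models.

(** * Finite stages of EG *)

Section Compactness.
Context {R : realType}.
Notation simplex := (@simplex R).
Notation dsimplex := (@dsimplex R).

Lemma step_continuous : continuous (@step R).
Proof.
move=> x; have h : Cn_on 0 [set: R] (@step R).
  by apply: (@Cn_step R R 0 setT openT idfun); exact: Cn_id.
exact: h.
Qed.

Lemma step_onto (y : R) : 0 <= y <= 1 -> exists2 s, 0 <= s <= 1 & step s = y.
Proof.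
move=> y01; have := @IVT R (@step R) 0 1 y ler01 (continuous_subspaceT step_continuous).
rewrite step_le0 // step_ge1 // minEle maxEle ler01 => /(_ y01)[s].
by rewrite in_itv /= => s01 sy; exists s.
Qed.

(** Iterated polar coordinates. In dimension q + 1 every point has a coordinate i of at least 1/(q +
    2), so [phi i] is needed only for t <= c = 1 - 1/(q + 2), and compact cubes suffice although [0,
    1) is not compact. [step] keeps t in [0, c] for all real arguments, so that the charts are plots
    on the whole of R^(q+1). *)
Lemma cube_cover q : exists (I : finType) (E : I -> 'rV[R]_q -> simplex q),
  (forall i, @is_plot R (dsimplex q) q setT (E i)) /\
  forall x, exists i (s : 'rV[R]_q), (forall k, 0 <= s 0 k <= 1) /\ E i s = x.
Proof.
elim: q => [|q [I [E [EP EX]]]].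
  exists unit, (fun _ _ => exist _ _ (vertex_std ord0)); split => [_|x].
    by apply: simplex0_plot; exact: openT.
  exists tt, 0; split; last exact: simplex0_eq.
  by case.
pose c : R := 1 - q.+2%:R^-1.
have q0 : 0 < (q.+2%:R : R)^-1 by rewrite invr_gt0 ltr0n.
have q1 : (q.+2%:R : R)^-1 < 1 by rewrite invf_lt1 ?ltr0n // ltr1n.
have c0 : 0 < c by rewrite subr_gt0.
have c1 : c < 1 by rewrite /c ltrBlDr ltrDl.
pose tl (s : 'rV[R]_q.+1) : 'rV[R]_q := \row_k s 0 (lift ord0 k).
have cs01 s : 0 <= c * step s < 1.
  rewrite mulr_ge0 ?step_ge0 ?(ltW c0) //=.
  by apply: le_lt_trans c1; rewrite ler_piMr ?step_le1 // ltW.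
exists ('I_q.+2 * I)%type, (fun ij s => phi ij.1 (E ij.2 (tl s), to_half (c * step (s 0 0)))).
split=> [[i j]|x] /=.
  have cf k (l : 'I_q.+1) : @Cn_on R k 'rV[R]_q.+1 R setT (fun s => s 0 l).
    by apply: (@Cn_coord R _ k setT openT _ idfun); exact: Cn_id.
  apply: (@phi_dsmooth R q i q.+1 setT (fun s => (E j (tl s), to_half (c * step (s 0 0))))).
  split => /=.
    apply: (@plot_comp _ _ (dstruct (dsimplex q)) _ _ setT setT (E j) tl (EP j) openT) => //.
    move=> k; apply: Cn_row; first exact: openT.
    by move=> l; apply: Cn_eq (cf k (lift ord0 l)); [exact: openT|move=> s _; rewrite mxE].
  apply: to_half_plot => //; apply: splotM; first exact/splot_cst/openT.
  by apply: splot_step; apply: splotP => [|k]; [exact: openT|exact: cf].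
have [i xi] : exists i, q.+2%:R^-1 <= sval x 0 i.
  apply: contrapT => /forallNP h.
  have : \sum_i sval x 0 i < \sum_(i < q.+2) q.+2%:R^-1.
    apply: ltr_sum; first by apply/hasP; exists ord0; rewrite ?mem_index_enum.
    by move=> i _; rewrite ltNge; apply/negP/h.
  have [-> _] := svalP x.
  by rewrite sumr_const card_ord -[X in _ < X]mulr_natr mulVf ?ltxx // pnatr_eq0.
have [j [s [s01 sx]]] := EX (radial i x).
have [s0 s001 s0x] : exists2 s0, 0 <= s0 <= 1 & step s0 = (1 - sval x 0 i) / c.
  apply: step_onto; apply/andP; split.
    by apply: divr_ge0; [rewrite subr_ge0; exact: std_le1|exact: ltW].
  by rewrite ler_pdivrMr // mul1r /c lerD2l lerN2.
exists (i, j), (\row_k (if unlift ord0 k is Some k' then s 0 k' else s0)); split.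
  by move=> k; rewrite mxE; case: unliftP.
have -> : tl (\row_k (if unlift ord0 k is Some k' then s 0 k' else s0)) = s.
  by apply/rowP => k; rewrite !mxE liftK.
have e : c * step s0 = 1 - sval x 0 i by rewrite s0x mulrC divfK // gt_eqF.
have /andP[? ?] := cs01 s0.
rewrite mxE unlift_none /= sx; apply: esym; apply: phi_eqP => [|k] /=; rewrite to_halfE // e.
  by rewrite subKr.
exact: radialK.
Qed.

(** Compactness enters through the cubes of [cube_cover], where the condition on plots gives an open
    cover on each member of which one m suffices. *)
Lemma simplex_locally_bounded q (N : nat -> simplex q -> Prop) :
  (forall m n x, (m <= n)%N -> N m x -> N n x) ->
  (forall n (U : set 'rV[R]_n) (x : 'rV[R]_n -> simplex q), @is_plot R (dsimplex q) n U x ->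
     forall u, U u -> exists V m, [/\ open V, V u & forall v, V v -> N m (x v)]) ->
  exists m, forall x, N m x.
Proof.
move=> Nmono Nloc; have [I [E [EP EX]]] := cube_cover q.
have /choice[M hM] i : exists m, forall s : 'rV[R]_q,
    (forall k, 0 <= s 0 k <= 1) -> N m (E i s).
  have cK : compact [set s : 'rV[R]_q | forall k, `[0, 1]%classic (s ord0 k)].
    by apply: (@rV_compact R q (fun=> `[0, 1]%classic)) => k; exact: segment_compact.
  move/compact_near_coveringP : cK => /(_ nat \oo (fun m s => N m (E i s)) _) h.
  have [s _|m _ hm] := h.
    have [V [m [oV Vs VN]]] := Nloc _ _ _ (EP i) s Logic.I.
    exists (V, [set n | (m <= n)%N]) => /=.
      by split; [apply: open_nbhs_nbhs; split|exists m].
    by move=> [v n] [/= /VN Vv mn]; exact: Nmono Vv.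
  by exists m => s s01; apply: (hm m) => //=.
exists (\max_i M i) => x; have [i [s [s01 <-]]] := EX x.
by apply: Nmono (hM i s s01); exact: leq_bigmax.
Qed.
End Compactness.

Section UniversalTotalSpace.
Context {R : realType} (G : dgroup R).
Notation EG := (EG G).
Notation EG_rel := (EG_rel G).

Definition wt (y : EG) (i : nat) : R := weight (Defs.repr_of y) i.

Lemma wtE (x : EG_pre G) i : wt (class_of EG_rel x) i = weight x i.
Proof. by have [h _] := repr_ofP EG_rel x; exact: h. Qed.

Lemma direct_sum_lift n (U : set 'rV[R]_n) (t : 'rV[R]_n -> direct_sum) u :
  @is_plot R direct_sum n U t -> U u ->
  exists V m (r : 'rV[R]_n -> 'rV[R]_m), [/\ V u, V `<=` U, @is_plot R (euclid m) n V r &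
    forall v, V v -> t v = finseq_incl (r v)].
Proof.
move=> tP Uu; have [_ /(_ u Uu)[V [Vu VU oV c]]] := final_lift tP.
case: c => [[x tx]|[m [r [rP tr]]]]; last by exists V, m, r.
have [m xm] := svalP x.
exists V, m, (fun=> \row_i sval x i); split => //; first exact: plot_cst.
move=> v Vv; rewrite tx //; apply: sval_inj; apply/funext => i /=.
rewrite /finseq_incl_fun; case: insubP => [j _ <-|]; first by rewrite /= mxE.
by rewrite -leqNgt => /xm.
Qed.

Lemma incl_ge m (r : 'rV[R]_m) i : (m <= i)%N -> sval (finseq_incl r) i = 0.
Proof. by move=> mi; rewrite /= /finseq_incl_fun insubF // ltnNge mi. Qed.

Lemma EG_plot_lift n (U : set 'rV[R]_n) (y : 'rV[R]_n -> EG) u :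
  is_plot U y -> U u -> exists V m (r : 'rV[R]_n -> 'rV[R]_m) (q : 'rV[R]_n -> EG_pre G),
  [/\ V u, V `<=` U, @is_plot R (euclid m) n V r, is_plot V q &
    forall v, V v -> y v = class_of EG_rel (q v) /\ sval (q v).1 = finseq_incl (r v)].
Proof.
move=> yP Uu; have [_ /(_ u Uu)[V [q [Vu VU qP yq]]]] := quot_plotP yP.
have [q1 q2] := qP.
have [W [m [r [Wu WV rP qr]]]] := direct_sum_lift (t := fun v => sval (q v).1) q1 Vu.
exists W, m, r, q; split => //; first exact: subset_trans VU.
  exact: plot_sub qP (plot_open rP) WV.
by move=> v Wv; split; [apply/yq/WV|exact: qr].
Qed.

Definition stage (n : nat) : set EG := [set y | forall i, (n <= i)%N -> wt y i = 0].

Lemma simplex_stage q (f : smooth_map (@dsimplex R q) EG) : exists n, forall x, stage n (f x).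
Proof.
apply: (simplex_locally_bounded (N := fun n x => stage n (f x))).
  by move=> m n x mn h i ni; apply/h/(leq_trans mn).
move=> n U x xP u Uu.
have [V [m [r [p [Vu VU rP pP fp]]]]] := EG_plot_lift (sm_smooth f xP) Uu.
exists V, m; split => //; first exact: plot_open rP.
move=> v Vv i mi; have [/= -> pr] := fp v Vv.
by rewrite wtE /weight pr incl_ge.
Qed.

Lemma fsum_ord (f : nat -> R) m : (forall i, (m <= i)%N -> f i = 0) ->
  \sum_(i \in [set: nat]) f i = \sum_(i < m) f i.
Proof.
move=> fm; rewrite fsbig_ord; apply: esym; apply: fsbig_widen => // i [_ /= /negP].
by rewrite -leqNgt => /fm.
Qed.

Section Contraction.
Variable n : nat.

Definition ray_wt (t : @inf_simplex R) (s : R) (i : nat) : R :=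
  (1 - step s) * sval (sval t) i + step s * (i == n)%:R.

Lemma ray_fin (t : @inf_simplex R) s : exists m, forall i, (m <= i)%N -> ray_wt t s i = 0.
Proof.
have [m tm] := svalP (sval t); exists (maxn m n.+1) => i; rewrite geq_max => /andP[mi ni].
by rewrite /ray_wt tm // gtn_eqF // !mulr0 addr0.
Qed.

Definition ray_seq t s : finseq := exist _ _ (ray_fin t s).

Lemma ray_simplex (t : @inf_simplex R) s : (forall i, 0 <= sval (ray_seq t s) i) /\
  \sum_(i \in [set: nat]) sval (ray_seq t s) i = 1.
Proof.
have [t0 t1] := svalP t; split => [i|].
  by rewrite /= /ray_wt addr_ge0 // mulr_ge0 ?step_ge0 // subr_ge0 step_le1.
have [m tm] := svalP (sval t).
have tm' i : (maxn m n.+1 <= i)%N -> sval (sval t) i = 0.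
  by rewrite geq_max => /andP[mi _]; exact: tm.
rewrite (@fsum_ord _ (maxn m n.+1)) /=; last first.
  move=> i mi; rewrite /ray_wt tm' //; move: mi; rewrite geq_max => /andP[_ ni].
  by rewrite gtn_eqF // !mulr0 addr0.
rewrite /ray_wt big_split /= -!mulr_sumr -(fsum_ord tm') t1.
have nm : (n < maxn m n.+1)%N by rewrite leq_max ltnSn orbT.
rewrite (bigD1 (Ordinal nm)) //= eqxx big1 ?addr0 ?mulr1 ?subrK // => i.
by rewrite -val_eqE /= => /negPf ->.
Qed.

Definition ray (t : @inf_simplex R) (s : R) : @inf_simplex R := exist _ _ (ray_simplex t s).

Definition ray_pre (x : EG_pre G) (s : R) : EG_pre G :=
  (ray x.1 s, fun i => if i == n then 1%g else x.2 i).

(* On stage n this is a contraction: the n-th weights vanish there, so that the n-th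
   components in G may be overwritten. *)
Definition EG_ray (y : EG) (s : R) : EG := class_of EG_rel (ray_pre (Defs.repr_of y) s).

Lemma EG_rayE (x : EG_pre G) s :
  EG_ray (class_of EG_rel x) s = class_of EG_rel (ray_pre x s).
Proof.
apply/class_ofP; have [h1 h2] := repr_ofP EG_rel x; rewrite /ray_pre; split => i.
  by rewrite /weight /= /ray_wt; congr (_ * _ + _); exact: h1.
rewrite /weight /= /ray_wt; case: eqP => // /eqP /negPf ni; rewrite mulr0 addr0 => hi.
apply: h2; move: hi; rewrite /weight; apply: contra_not => ->; exact: mulr0.
Qed.

Lemma direct_sum_plot k (U : set 'rV[R]_k) (t : 'rV[R]_k -> direct_sum) m
    (r : 'rV[R]_k -> 'rV[R]_m) : @is_plot R (euclid m) k U r ->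
  (forall u, U u -> t u = finseq_incl (r u)) -> @is_plot R direct_sum k U t.
Proof.
move=> rP tr; apply: (@plot_ext _ _ (dstruct direct_sum) k U (fun u => finseq_incl (r u))).
  by move=> u /tr.
exact: (@final_smooth R nat (fun n => euclid n) finseq (@finseq_incl R) m k U r rP).
Qed.

Lemma EG_ray_plot k (U : set 'rV[R]_k) (y : 'rV[R]_k -> EG) (s : 'rV[R]_k -> R) :
  is_plot U y -> @is_plot R dline k U s -> is_plot U (fun u => EG_ray (y u) (s u)).
Proof.
move=> yP sP; apply: plot_glue => u Uu.
have [V [m [r [q [Vu VU rP qP yq]]]]] := EG_plot_lift yP Uu.
have oV := plot_open rP; have sV := plot_sub sP oV VU.
exists V, (fun v => class_of EG_rel (ray_pre (q v) (s v))); split => //; last first.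
  by move=> v Vv; have [-> _] := yq v Vv; rewrite EG_rayE.
apply: (@class_of_smooth R (EG_pre G) EG_rel k V (fun v => ray_pre (q v) (s v))).
have [_ [_ q2]] := qP; split; last first.
  split => // i; case: (eqVneq i n) => [->|/negPf ni].
    apply: (@plot_ext _ _ (dstruct (G : dspace R)) k V (fun=> 1%g)); last exact: plot_cst.
    by move=> v _ /=; rewrite eqxx.
  by apply: plot_ext (q2 i) => v _ /=; rewrite ni.
(* Room for the m coordinates of r and for the vertex n. *)
pose M := maxn m n.+1.
pose r' v : 'rV[R]_M := \row_i ((1 - step (s v)) * sval (finseq_incl (r v)) i +
  step (s v) * (i == n :> nat)%:R).
apply: (@direct_sum_plot k V _ M r').
  split => // l; apply: Cn_row => // i.
  suff [_ h] : @is_plot R dline k V (fun v => r' v 0 i) by exact: h.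
  apply: (@plot_ext _ _ (dstruct dline) k V (fun v =>
    (1 - step (s v)) * sval (finseq_incl (r v)) i + step (s v) * (i == n :> nat)%:R)).
    by move=> v _; rewrite mxE.
  have stP : @is_plot R dline k V (fun v => step (s v)) by exact: splot_step.
  apply: splotD; last by apply: splotM => //; exact: splot_cst.
  apply: splotM; first by apply: splotB => //; exact: splot_cst.
  have [im|mi] := ltnP i m; last first.
    apply: (@plot_ext _ _ (dstruct dline) k V (fun=> 0)); last exact: plot_cst.
    by move=> v _; rewrite incl_ge.
  have [_ sr] := rP; split => // l'.
  apply: Cn_eq (Cn_coord oV (Ordinal im) (sr l')) => // v _.
  by rewrite /= /finseq_incl_fun (insubT (fun i => i < m)%N im).
move=> v Vv; apply: sval_inj; apply/funext => i /=.
have [_ qr] := yq v Vv.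
have [iM|Mi] := ltnP i M.
  by rewrite /finseq_incl_fun (insubT (fun i => i < M)%N iM) /= mxE /ray_wt qr.
rewrite [RHS](incl_ge (r' v) Mi) /ray_wt qr.
move: Mi; rewrite geq_max => /andP[mi ni].
by rewrite incl_ge // gtn_eqF // !mulr0 addr0.
Qed.

Lemma EG_ray_le0 y s : stage n y -> s <= 0 -> EG_ray y s = y.
Proof.
move=> yn s0; rewrite -[RHS](@Defs.repr_ofK _ EG_rel); apply/class_ofP.
have e i : weight (ray_pre (Defs.repr_of y) s) i = weight (Defs.repr_of y) i.
  by rewrite /weight /= /ray_wt step_le0 // subr0 mul1r mul0r addr0.
split=> // i; rewrite e /=; case: eqP => // -> h; case: h; exact: yn.
Qed.

Lemma EG_ray_ge1 y z s : 1 <= s -> EG_ray y s = EG_ray z 1.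
Proof.
move=> s1; apply/class_ofP; split => i.
  by rewrite /weight /= /ray_wt !step_ge1 // subrr !mul0r.
rewrite /weight /= /ray_wt step_ge1 // subrr mul0r add0r mul1r.
by case: eqP => // _ [].
Qed.
End Contraction.
End UniversalTotalSpace.

(** * Diffeological principal bundles *)

Section PrincipalBundles.
Context {R : realType} (G : dgroup R).

Lemma mul_plot n (U : set 'rV[R]_n) (g h : 'rV[R]_n -> G) :
  is_plot U g -> is_plot U h -> @is_plot R G n U (fun u => (g u * h u)%g).
Proof. by move=> gP hP; apply: (@mul_smooth R G n U (fun u => (g u, h u))); split. Qed.

Lemma inv_plot n (U : set 'rV[R]_n) (g : 'rV[R]_n -> G) :
  is_plot U g -> @is_plot R G n U (fun u => (g u)^-1%g).
Proof. exact: inv_smooth. Qed.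

Lemma act_plot (X : dspace R) (P : gspace G X) n (U : set 'rV[R]_n)
    (x : 'rV[R]_n -> P) (g : 'rV[R]_n -> G) :
  is_plot U x -> is_plot U g -> is_plot U (fun u => act (x u) (g u)).
Proof. by move=> xP gP; apply: (@act_smooth R G X P n U (fun u => (x u, g u))); split. Qed.

Lemma proj_plot (X : dspace R) (P : gspace G X) n (U : set 'rV[R]_n) (x : 'rV[R]_n -> P) :
  is_plot U x -> is_plot U (fun u => proj (x u)).
Proof. exact: proj_smooth. Qed.

(* gam v x is the coordinate in G of the point x of the fibre over p v. *)
Definition local_triv (X : dspace R) (P : gspace G X) n (p : 'rV[R]_n -> X)
    (V : set 'rV[R]_n) (sec : 'rV[R]_n -> P) (gam : 'rV[R]_n -> P -> G) : Prop :=
  [/\ is_plot V sec /\ forall v, V v -> proj (sec v) = p v,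
      forall v x, V v -> proj x = p v -> x = act (sec v) (gam v x),
      forall v g, V v -> gam v (act (sec v) g) = g &
      forall m (U : set 'rV[R]_m) (a : 'rV[R]_m -> 'rV[R]_n) (x : 'rV[R]_m -> P),
        @is_plot R (euclid n) m U a -> is_plot U x ->
        (forall w, U w -> V (a w) /\ proj (x w) = p (a w)) ->
        is_plot U (fun w => gam (a w) (x w))].

Section LocalTriv.
Variables (X : dspace R) (P : gspace G X) (n : nat) (U : set 'rV[R]_n) (p : 'rV[R]_n -> X).
Hypothesis pP : is_plot U p.
Let E := pullback (plot_map pP) P.
Variable W : set (dsub (U : set (euclid n))).
Variables (f : smooth_map (restr E W) (triv_gspace G (dsub W)))
  (f' : smooth_map (triv_gspace G (dsub W)) (restr E W)).
Hypotheses (fK : cancel f f') (f'K : cancel f' f)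
  (f_act : forall e g, f (act e g) = act (f e) g)
  (f_proj : forall e, proj (f e) = proj e).
Variables (u : 'rV[R]_n) (Uu : U u).
Let uu : dsub (U : set (euclid n)) := exist _ u Uu.
Hypothesis Wu : W uu.
Hypothesis oW : dopen W.

(** [mkT], [mkW] and [mkE] make partial maps total, as the encoding of plots demands; their values
    matter only over V. *)
Let mkT (v : 'rV[R]_n) : dsub (U : set (euclid n)) :=
  match pselect (U v) with left h => exist _ v h | right _ => uu end.

Let mkTE v : U v -> sval (mkT v) = v.
Proof. by rewrite /mkT; case: pselect. Qed.

Let V : set 'rV[R]_n := U `&` mkT @^-1` W.

Let mkT_plot m (A : set 'rV[R]_m) (a : 'rV[R]_m -> 'rV[R]_n) :
  @is_plot R (euclid n) m A a -> (forall w, A w -> U (a w)) -> is_plot A (fun w => mkT (a w)).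
Proof. by move=> aP aU; apply: plot_ext aP => w /aU /mkTE /= ->. Qed.

Let oV : open V.
Proof.
have oU := plot_open pP; apply: oW; apply: (@mkT_plot n U id) => //.
by split => // k; exact: Cn_id.
Qed.

Let mkW (v : 'rV[R]_n) : dsub W :=
  match pselect (W (mkT v)) with left h => exist _ (mkT v) h | right _ => exist _ uu Wu end.

Let mkWE v : V v -> sval (mkW v) = mkT v.
Proof. by move=> [_ Wv]; rewrite /mkW; case: pselect. Qed.

Let e_ v : restr E W := f' (mkW v, 1%g).

Let e_fst v : V v -> (sval (sval (e_ v))).1 = mkT v.
Proof.
move=> Vv; have := f_proj (e_ v); rewrite /e_ f'K /=.
by move=> /(congr1 sval); rewrite mkWE.
Qed.

Let sec v : P := (sval (sval (e_ v))).2.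

Let sec_proj v : V v -> proj (sec v) = p v.
Proof.
move=> Vv; have := svalP (sval (e_ v)) => /= <-.
by rewrite e_fst // mkTE //; case: Vv.
Qed.

Let mkE (v : 'rV[R]_n) (x : P) : restr E W :=
  match pselect (plot_map pP (mkT v) = proj x) with
  | left h =>
    match pselect (W (mkT v)) with
    | left h' => exist (fun e : E => W (proj e)) (exist _ (mkT v, x) h) h'
    | right _ => e_ u
    end
  | right _ => e_ u
  end.

Let mkEE v x : V v -> proj x = p v -> sval (sval (mkE v x)) = (mkT v, x).
Proof.
move=> [Uv Wv] xv; rewrite /mkE; case: pselect => [h|[]]; last by rewrite /= mkTE.
by case: pselect.
Qed.

Let E_eq (e e' : restr E W) : sval (sval e) = sval (sval e') -> e = e'.
Proof. by move=> h; apply: sval_inj; apply: sval_inj. Qed.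

Let mkE_act v g : V v -> mkE v (act (sec v) g) = act (e_ v) g.
Proof.
move=> Vv; apply: E_eq; rewrite mkEE ?proj_act ?sec_proj //=.
by rewrite e_fst.
Qed.

Lemma local_triv_iso : V u /\ local_triv p V sec (fun v x => (f (mkE v x)).2).
Proof.
have Vu : V u.
  split => //; rewrite /preimage /=; suff -> : mkT u = uu by [].
  by apply: sval_inj; rewrite mkTE.
split => //; split.
- split => [|v]; last exact: sec_proj.
  have mkW_plot : is_plot V mkW.
    apply: (@plot_ext _ _ (dstruct (dsub (U : set (euclid n)))) n V mkT).
      by move=> v /mkWE.
    apply: (@mkT_plot n V id); first by split => // k; exact: Cn_id.
    by move=> v [].
  have := @sm_smooth _ _ _ f' n V (fun v => (mkW v, 1%g)).
  case; first by split => //; exact: plot_cst.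
  by [].
- move=> v x Vv xv; set g := (f (mkE v x)).2.
  have h : f (mkE v x) = f (act (e_ v) g).
    rewrite f_act /e_ f'K [LHS]surjective_pairing /= mul1g; congr (_, _).
    have /= -> := f_proj (mkE v x); apply: sval_inj => /=.
    by rewrite mkEE // mkWE.
  have {}h : mkE v x = act (e_ v) g by rewrite -(fK (mkE v x)) h fK.
  by have := congr1 (fun e => (sval (sval e)).2) h; rewrite /= mkEE.
- by move=> v g Vv; rewrite mkE_act // f_act /e_ f'K /= mul1g.
- move=> m A a x aP xP ax.
  have AV w : A w -> V (a w) by move=> /ax[].
  have AU w : A w -> U (a w) by move=> /AV[].
  have eP : is_plot A (fun w => mkE (a w) (x w)).
    split.
      apply: plot_ext (mkT_plot aP AU) => w Aw /=.
      by rewrite mkEE //; [exact: AV|case: (ax _ Aw)].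
    apply: plot_ext xP => w Aw /=.
    by rewrite mkEE //; [exact: AV|case: (ax _ Aw)].
  by have [] := sm_smooth f eP.
Qed.
End LocalTriv.

Section DiffeologicalPrincipal.
Variables (X : dspace R) (P : gspace G X).
Hypothesis dP : diffeological_principal P.

Lemma principal_local_triv n (U : set 'rV[R]_n) (p : 'rV[R]_n -> X) u :
  is_plot U p -> U u -> exists V (sec : 'rV[R]_n -> P) gam, [/\ V u, V `<=` U & local_triv p V sec gam].
Proof.
move=> pP Uu; have [I [W [oW cW tW]]] := dP pP.
have [i _ Wi] : (\bigcup_i W i) (exist _ u Uu) by rewrite cW.
have [f [f' [fK f'K fa fp]]] := tW i.
have [Vu lt] := local_triv_iso fK f'K fa fp Wi (oW i).
by do 3 eexists; split; [exact: Vu| |exact: lt] => v [].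
Qed.

Lemma principal_section n (U : set 'rV[R]_n) (p : 'rV[R]_n -> X) u :
  is_plot U p -> U u -> exists V (sec : 'rV[R]_n -> P), [/\ V u, V `<=` U, is_plot V sec &
    forall v, V v -> proj (sec v) = p v].
Proof.
move=> pP Uu; have [V [sec [gam [Vu VU [[sP sp] _ _ _]]]]] := principal_local_triv pP Uu.
by exists V, sec.
Qed.

(** A constant plot on R^0 trivializes a single fibre; hence fibres are nonempty, and likewise the
    action on them is transitive and free. *)
Lemma principal_fibre (x : X) : exists e : P, proj e = x.
Proof.
have [V [sec [V0 _ _ h]]] := @principal_section 0 setT (fun=> x) 0 (plot_cst _ _ openT) Logic.I.
by exists (sec 0); exact: h.
Qed.

Lemma principal_point (x y : P) : proj x = proj y -> exists g, y = act x g.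
Proof.
move=> xy; have [V [sec [gam [V0 _ [_ h1 _ _]]]]] :=
  @principal_local_triv 0 setT (fun=> proj x) 0 (plot_cst _ _ openT) Logic.I.
exists ((gam 0 x)^-1 * gam 0 y)%g.
transitivity (act (act (sec 0) (gam 0 x)) ((gam 0 x)^-1 * gam 0 y)%g); last by rewrite -h1.
by rewrite -actM mulVKg -h1.
Qed.

Lemma principal_free (x : P) g h : act x g = act x h -> g = h.
Proof.
have [V [sec [gam [V0 _ [_ h1 h2 _]]]]] :=
  @principal_local_triv 0 setT (fun=> proj x) 0 (plot_cst _ _ openT) Logic.I.
have -> : x = act (sec 0) (gam 0 x) by exact: h1.
rewrite -!actM => e.
have := congr1 (gam 0) e; rewrite !h2 //.
exact: mulgI.
Qed.

(** The action is free, so g is determined over U, and its smoothness can be checked in local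
    trivializations, where it is the quotient of the two coordinates in G. *)
Lemma principal_division n (U : set 'rV[R]_n) (x y : 'rV[R]_n -> P) :
  is_plot U x -> is_plot U y -> (forall u, U u -> proj (x u) = proj (y u)) ->
  exists g, is_plot U g /\ forall u, U u -> y u = act (x u) (g u).
Proof.
move=> xP yP xy.
have gE u : exists g, proj (x u) = proj (y u) -> y u = act (x u) g.
  have [h|h] := pselect (proj (x u) = proj (y u)); last by exists 1%g.
  by have [g ->] := principal_point h; exists g.
have [g hg] := choice gE; exists g; split; last by move=> u /xy /hg.
apply: plot_glue => u Uu.
have [V [sec [gam [Vu VU [[sP _] h1 h2 h3]]]]] := principal_local_triv (proj_plot xP) Uu.
have oV := plot_open sP.
have idP : @is_plot R (euclid n) n V id by split => // k; exact: Cn_id.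
exists V, (fun v => (gam v (x v))^-1 * gam v (y v))%g; split => //.
  apply: mul_plot; [apply: inv_plot|]; apply: (h3 n V id) => //.
  - exact: plot_sub xP oV VU.
  - exact: plot_sub yP oV VU.
  - by move=> v Vv; split => //; rewrite -xy //; exact: VU.
move=> v Vv; have e := xy v (VU v Vv); apply: (@principal_free (x v)).
rewrite -hg //.
transitivity (act (act (sec v) (gam v (x v))) ((gam v (x v))^-1 * gam v (y v))%g).
  by rewrite -actM mulVKg -h1.
by rewrite -h1.
Qed.
End DiffeologicalPrincipal.
End PrincipalBundles.

(** * Sections of diffeological principal bundles over boxes *)

Section BoxSection.
Context {R : realType}.

(** Compactness of [a, b] as a supremum argument. [Q a b] is meant for the open interval from a to
    b, which is why two pieces must overlap in order to merge. *)
Lemma interval_cover_ind (Q : R -> R -> Prop) :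
  (forall a a' b b', a <= a' -> b' <= b -> Q a b -> Q a' b') ->
  (forall t, exists2 d, 0 < d & Q (t - d) (t + d)) ->
  (forall a b c c', a <= c -> c < c' -> c' <= b -> Q a c' -> Q c b -> Q a b) ->
  forall a b, Q a b.
Proof.
move=> mono loc merge a b.
have [ba|ab] := ltP b a.
  have [d d0 hd] := loc a; apply: (mono _ _ _ _ _ _ hd); lra.
pose T := [set t | t <= b /\ Q a t].
have Ta : T a by split => //; have [d d0 hd] := loc a; apply: (mono _ _ _ _ _ _ hd); lra.
have Tb : has_sup T by split; [exists a|exists b => t []].
set s := sup T.
have [d d0 hd] := loc s.
have Tub t : T t -> t <= s by move=> Tt; exact: sup_upper_bound.
have [t [tb Qt] st] := sup_adherent d0 Tb.
have ts : t <= s by apply: Tub.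
have Qs : Q a (s + d).
  have [at_|ta] := ltP (Num.max a (s - d)) t.
    apply: (merge a (s + d) (Num.max a (s - d)) t) => //.
    - by rewrite le_max lexx.
    - lra.
    - by apply: (mono _ _ _ _ _ _ hd); rewrite // le_max lexx orbT.
  apply: (mono _ _ _ _ _ _ hd) => //; move: ta; rewrite le_max => /orP[|]; last by rewrite /s; lra.
  by move: st; rewrite -/s; lra.
have [bs|sb] := leP b (s + d); first exact: (mono _ _ _ _ _ _ Qs).
have := Tub (s + d) (conj (ltW sb) Qs); lra.
Qed.

Lemma open_box n (A : 'I_n -> set R) : (forall i, open (A i)) ->
  open [set v : 'rV[R]_n | forall i, A i (v 0 i)].
Proof.
move=> oA; rewrite openE => v Av.
apply: (@filter_forall _ _ (fun i (v : 'rV[R]_n) => A i (v 0 i)) (nbhs v)) => i.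
have c : continuous (@coordf R n i : 'rV[R]_n -> R) by exact: coord_continuous.
by apply: (c v (A i)); apply: open_nbhs_nbhs; split => //; exact: Av.
Qed.

Definition itv (a b : R) : set R := [set t | a < t < b].

Lemma open_itv a b : open (itv a b).
Proof.
have -> : itv a b = [set t | a < t] `&` [set t | t < b].
  by apply/seteqP; split => [t /andP[]|t [h1 h2]]; [split|apply/andP].
by apply: openI; [exact: open_gt|exact: open_lt].
Qed.

Context (G : dgroup R) (X : dspace R) (P : gspace G X).
Hypothesis dP : diffeological_principal P.
Variables (n : nat) (p : 'rV[R]_n -> X).
Hypothesis pP : is_plot setT p.

Definition box (A : 'I_n -> set R) : set 'rV[R]_n := [set v | forall i, A i (v 0 i)].

Definition has_section (V : set 'rV[R]_n) : Prop :=
  exists sec : 'rV[R]_n -> P, is_plot V sec /\ forall v, V v -> proj (sec v) = p v.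

Lemma has_section_sub (V V' : set 'rV[R]_n) :
  open V' -> V' `<=` V -> has_section V -> has_section V'.
Proof.
move=> oV VV [sec [sP sp]]; exists sec; split; first exact: plot_sub sP oV VV.
by move=> v /VV /sp.
Qed.

Definition upd (A : 'I_n -> set R) k B i : set R := if i == k then B else A i.

Lemma open_upd A k B : (forall i, open (A i)) -> open B -> forall i, open (upd A k B i).
Proof. by move=> oA oB i; rewrite /upd; case: ifP. Qed.

Lemma box_updP A k B (v : 'rV[R]_n) :
  box (upd A k B) v <-> (forall i, i != k -> A i (v 0 i)) /\ B (v 0 k).
Proof.
split=> [h|[h1 h2] i]; last by rewrite /upd; case: eqP => [->|/eqP /h1].
split=> [i /negPf ik|]; first by have := h i; rewrite /upd ik.
by have := h k; rewrite /upd eqxx.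
Qed.

(* The difference of the two sections lives on the overlap c < v k < c'; it is
   extended to m <= v k by composing with a retraction th into the overlap. *)
Lemma merge_sections A k a b c c' : (forall i, open (A i)) -> a <= c -> c < c' -> c' <= b ->
  has_section (box (upd A k (itv a c'))) -> has_section (box (upd A k (itv c b))) ->
  has_section (box (upd A k (itv a b))).
Proof.
move=> oA ac cc' cb [s [sP sp]] [s' [s'P s'p]].
have oB x y : open (box (upd A k (itv x y))).
  by apply: open_box; apply: open_upd => //; exact: open_itv.
have sub x y x' y' : x' <= x -> y <= y' ->
    box (upd A k (itv x y)) `<=` box (upd A k (itv x' y')).
  move=> xx yy v /box_updP[h /andP[h1 h2]]; apply/box_updP; split => //.
  by apply/andP; split; [exact: le_lt_trans h1|exact: lt_le_trans yy].
have [g [gP gE]] : exists g, is_plot (box (upd A k (itv c c'))) g /\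
    forall v, box (upd A k (itv c c')) v -> s v = act (s' v) (g v).
  apply: (principal_division dP).
  - exact: plot_sub s'P (oB _ _) (sub _ _ _ _ (lexx _) cb).
  - exact: plot_sub sP (oB _ _) (sub _ _ _ _ ac (lexx _)).
  - move=> v Vv; rewrite s'p ?sp //; first exact: sub Vv.
    exact: sub Vv.
(* [th] is the identity up to m + e and constantly m from m + 2 e < c' on; so both formulas of the
   glued section agree for v k between m and m + e. *)
pose m := (c + c') / 2; pose e := (c' - m) / 3.
pose th t := t + (m - t) * step ((t - m - e) / e).
have e0 : 0 < e by rewrite /e /m; lra.
have th_id t : t <= m + e -> th t = t.
  move=> tm; rewrite /th step_le0 ?mulr0 ?addr0 //.
  by rewrite pmulr_lle0 ?invr_gt0 //; lra.
have cm : c < m by rewrite /m; lra.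
have mc' : m + 2 * e < c' by rewrite /e /m; lra.
have th_in t : c < t -> itv c c' (th t).
  move=> ct; have [tm|mt] := leP (m + 2 * e) t.
    rewrite /th step_ge1 ?mulr1; last by rewrite ler_pdivlMr //; lra.
    by apply/andP; split; lra.
  have := @step_ge0 R ((t - m - e) / e); have := @step_le1 R ((t - m - e) / e).
  rewrite /th; move: (step _) => l l1 l0.
  have [tm|mt'] := leP t m.
    have h1 : 0 <= (m - t) * l by rewrite mulr_ge0 // subr_ge0.
    have h2 : (m - t) * l <= m - t by rewrite ler_piMr // subr_ge0.
    apply/andP; split; lra.
  have h1 : 0 <= (t - m) * l by rewrite mulr_ge0 // subr_ge0 ltW.
  have h2 : (t - m) * l <= t - m by rewrite ler_piMr // subr_ge0 ltW.
  apply/andP; split; lra.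
pose clamp (v : 'rV[R]_n) : 'rV[R]_n := \row_i (if i == k then th (v 0 k) else v 0 i).
have clampP v : box (upd A k (itv c b)) v -> box (upd A k (itv c c')) (clamp v).
  move=> /box_updP[h /andP[h1 h2]]; apply/box_updP; split=> [i ik|].
    by rewrite mxE (negPf ik); exact: h.
  by rewrite mxE eqxx; exact: th_in.
have cf K V i : open V -> @Cn_on R K 'rV[R]_n R V (fun v => v 0 i).
  by move=> oV; apply: (@Cn_coord R _ K V oV _ idfun); exact: Cn_id.
have thP V : open V -> @is_plot R dline n V (fun v => th (v 0 k)).
  move=> oV; have vP : @is_plot R dline n V (fun v => v 0 k) by split => // K; exact: cf.
  have cP x : @is_plot R dline n V (fun=> x) by exact: splot_cst.
  apply: splotD => //; apply: splotM; first exact: splotB.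
  by apply: splot_step; apply: splotM => //; apply: splotB => //; exact: splotB.
have gclamp : is_plot (box (upd A k (itv c b))) (fun v => g (clamp v)).
  apply: (@plot_comp _ _ (dstruct (G : dspace R)) _ _ _ _ g clamp gP (oB _ _)) => //.
  move=> K; apply: Cn_row => // i; have [->|/negPf ik] := eqVneq i k.
    have [_ h] := thP _ (oB c b); apply: Cn_eq (h K) => // v _.
    by rewrite mxE eqxx.
  by apply: Cn_eq (cf K _ i (oB c b)) => // v _; rewrite mxE ik.
exists (fun v : 'rV[R]_n => if v 0 k < m then s v else act (s' v) (g (clamp v))); split; last first.
  move=> v /box_updP[h /andP[h1 h2]]; case: ltP => vm.
    by apply: sp; apply/box_updP; split => //; apply/andP; split; lra.
  rewrite proj_act; apply: s'p; apply/box_updP; split => //.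
  by apply/andP; split; lra.
apply: plot_glue => v /box_updP[h /andP[h1 h2]].
have [vm|mv] := ltP (v 0 k) (m + e).
  exists (box (upd A k (itv a (m + e)))), s; split.
  - by apply/box_updP; split => //; apply/andP.
  - by apply: sub; lra.
  - by apply: plot_sub sP (oB _ _) (sub _ _ _ _ _ _); lra.
  - move=> w /box_updP[hw /andP[w1 w2]]; case: ltP => // mw.
    have -> : clamp w = w.
      apply/rowP => i; rewrite mxE; case: eqP => // ->; apply: th_id; exact: ltW.
    rewrite gE //; apply/box_updP; split => //; apply/andP; split; lra.
exists (box (upd A k (itv m b))), (fun v => act (s' v) (g (clamp v))); split.
- by apply/box_updP; split => //; apply/andP; split => //; lra.
- by apply: sub => //; lra.
- have S : box (upd A k (itv m b)) `<=` box (upd A k (itv c b)) by apply: sub => //; exact: ltW.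
  by apply: act_plot; [exact: plot_sub s'P (oB _ _) S|exact: plot_sub gclamp (oB _ _) S].
- by move=> w /box_updP[hw /andP[w1 w2]]; rewrite ltNge ltW.
Qed.

Definition slab (j : nat) (x : 'rV[R]_n) (e : R) (i : 'I_n) : set R :=
  if (i < j)%N then itv (- 2) 2 else itv (x 0 i - e) (x 0 i + e).

Lemma open_slab j x e i : open (slab j x e i).
Proof. by rewrite /slab; case: ifP => _; exact: open_itv. Qed.

(** Induction on the number j of coordinates already stretched to (-2, 2), for all centres x at
    once; [interval_cover_ind] stretches the next one. Merging two pieces costs the larger of their
    widths e in the remaining directions. *)
Lemma slab_section j : (j <= n)%N -> forall x, exists2 e, 0 < e & has_section (box (slab j x e)).
Proof.
elim: j => [_ x|j IH jn x].
  have [V [sec [Vx _ sP sp]]] := principal_section dP pP (u := x) Logic.I.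
  have /nbhs_ballP[e /= e0 eV] : nbhs x V.
    by apply: open_nbhs_nbhs; split => //; exact: plot_open sP.
  exists e => //; apply: (@has_section_sub V); last by exists sec.
    by apply: open_box => i; exact: open_slab.
  move=> v hv; apply: eV; split=> // i' i; rewrite (ord1 i').
  have /andP[] := hv i; rewrite /ball /= ltr_norml; lra.
pose k := Ordinal jn.
pose Q a b := exists2 e, 0 < e & has_section (box (upd (slab j x e) k (itv a b))).
have oB e a b : open (box (upd (slab j x e) k (itv a b))).
  apply: open_box; apply: open_upd; [exact: open_slab|exact: open_itv].
have slab_mono e e' i : e <= e' -> slab j x e i `<=` slab j x e' i.
  move=> ee t; rewrite /slab; case: ifP => // _ /andP[h1 h2]; apply/andP; split; lra.
have Qmono a a' b b' : a <= a' -> b' <= b -> Q a b -> Q a' b'.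
  move=> aa bb [e e0 he]; exists e => //; apply: has_section_sub he => // v.
  move=> /box_updP[h /andP[h1 h2]]; apply/box_updP; split => //; apply/andP; split; lra.
suff [e e0 he] : Q (- 2) 2.
  exists e => //; apply: has_section_sub he.
    by apply: open_box => i; exact: open_slab.
  move=> v hv; apply/box_updP; split=> [i ik|].
    have := hv i; rewrite /slab ltnS leq_eqVlt.
    by have -> : (i == j :> nat) = false by apply/negbTE.
  by have := hv k; rewrite /slab ltnS leqnn.
apply: interval_cover_ind => //.
- move=> t; have [e e0 he] := IH (ltnW jn) (\row_i (if i == k then t else x 0 i)).
  exists e => //; exists e => //; apply: has_section_sub he => // v.
  move=> /box_updP[h hk] i; have [->|ik] := eqVneq i k.
    by rewrite /slab /= ltnn mxE eqxx.
  by have := h i ik; rewrite /slab mxE (negPf ik).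
- move=> a b c c' ac cc' cb [e1 e10 h1] [e2 e20 h2].
  exists (Num.min e1 e2); first by rewrite lt_min e10.
  apply: (merge_sections (c := c) (c' := c')) => //; first exact: open_slab.
    apply: has_section_sub h1 => // v /box_updP[h hk]; apply/box_updP; split => // i ik.
    by apply: slab_mono (h i ik); rewrite ge_min lexx.
  apply: has_section_sub h2 => // v /box_updP[h hk]; apply/box_updP; split => // i ik.
  by apply: slab_mono (h i ik); rewrite ge_min lexx orbT.
Qed.

(** The bound 2 leaves room around the standard simplex, whose coordinates lie in [0, 1]. *)
Lemma box_section : has_section [set v | forall i, - 2 < v 0 i < 2].
Proof.
have [e _ he] := slab_section (leqnn n) 0; apply: has_section_sub he.
  by apply: (@open_box n (fun=> itv (- 2) 2)) => i; exact: open_itv.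
by move=> v hv i; rewrite /slab ltn_ord; exact: hv.
Qed.
End BoxSection.

(** * The associated space *)

Section AssociatedSpace.
Context {R : realType} (G : dgroup R).
Variables (X : dspace R) (P : gspace G X).
Notation EG := (EG G).

Program Definition assoc_rel : Defs.eqrel (dprod P EG) :=
  @Defs.EqRel _ (fun a b => exists g, b.1 = act a.1 g /\ b.2 = EG_act a.2 g) _ _ _.
Next Obligation. by exists 1%g; rewrite act1 EG_act1. Qed.
Next Obligation.
move=> a b [g [-> ->]]; exists (g^-1)%g.
by rewrite -actM -EG_actM mulgV act1 EG_act1.
Qed.
Next Obligation.
move=> b a c [g [e1 e2]] [h [-> ->]]; exists (g * h)%g.
by rewrite e1 e2 actM EG_actM.
Qed.

(* P x_G EG; its points over x are the equivariant maps from the fibre of P to EG. *)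
Definition assoc : dspace R := dquot assoc_rel.

Definition assoc_class (x : P) (y : EG) : assoc := class_of assoc_rel (x, y).

Lemma assoc_classE x y g : assoc_class (act x g) (EG_act y g) = assoc_class x y.
Proof. by apply/class_ofP/eqr_sym; exists g. Qed.

Lemma assoc_class_plot n (U : set 'rV[R]_n) (x : 'rV[R]_n -> P) (y : 'rV[R]_n -> EG) :
  is_plot U x -> is_plot U y -> is_plot U (fun u => assoc_class (x u) (y u)).
Proof.
move=> xP yP.
by apply: (@class_of_smooth R (dprod P EG) assoc_rel n U (fun u => (x u, y u))); split.
Qed.

Section Elim.
Variables (Z : dspace R) (f : P -> EG -> Z).
Hypothesis f_act : forall x y g, f (act x g) (EG_act y g) = f x y.
Hypothesis f_plot : forall n (U : set 'rV[R]_n) (x : 'rV[R]_n -> P) (y : 'rV[R]_n -> EG),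
  is_plot U x -> is_plot U y -> is_plot U (fun u => f (x u) (y u)).

Definition assoc_fun (z : assoc) : Z := f (Defs.repr_of z).1 (Defs.repr_of z).2.

Lemma assoc_funE x y : assoc_fun (assoc_class x y) = f x y.
Proof.
rewrite /assoc_fun; have [g [e1 e2]] := repr_ofP assoc_rel (x, y).
by rewrite -(f_act _ _ g) -e1 -e2.
Qed.

Lemma assoc_fun_smooth : dsmooth assoc_fun.
Proof.
apply: final_universal => -[] n U a [a1 a2].
apply: plot_ext (f_plot a1 a2) => u _ /=.
by case: (a u) => x y /=; rewrite -assoc_funE.
Qed.

Definition assoc_elim : smooth_map assoc Z := SmoothMap assoc_fun_smooth.
End Elim.

Lemma assoc_plot_lift n (U : set 'rV[R]_n) (z : 'rV[R]_n -> assoc) u :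
  is_plot U z -> U u -> exists V x y, [/\ V u, V `<=` U, is_plot V x, is_plot V y &
    forall v, V v -> z v = assoc_class (x v) (y v)].
Proof.
move=> zP Uu; have [_ /(_ u Uu)[V [q [Vu VU [q1 q2] zq]]]] := quot_plotP zP.
exists V, (fun v => (q v).1), (fun v => (q v).2); split => // v /zq ->.
by rewrite /assoc_class -surjective_pairing.
Qed.

Lemma assoc_classP (z : assoc) : exists x y, z = assoc_class x y.
Proof.
exists (Defs.repr_of z).1, (Defs.repr_of z).2.
by rewrite /assoc_class -surjective_pairing (Defs.repr_ofK (r := assoc_rel)).
Qed.

Definition assoc_proj : smooth_map assoc X :=
  @assoc_elim X (fun x _ => proj x) (fun x _ g => proj_act x g)
    (fun n U x y xP _ => proj_plot xP).

Lemma assoc_projE x y : assoc_proj (assoc_class x y) = proj x.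
Proof. exact: (@assoc_funE X (fun x _ => proj x) (fun x _ g => proj_act x g)). Qed.

Lemma BG_class_act (x : P) (y : EG) g :
  class_of (BG_rel G) (EG_act y g) = class_of (BG_rel G) y.
Proof. by apply/class_ofP/eqr_sym; exists g. Qed.

Definition assoc_BG : smooth_map assoc (BG G) :=
  @assoc_elim (BG G) (fun _ y => class_of (BG_rel G) y) BG_class_act
    (fun n U x y _ yP => @class_of_smooth R EG (BG_rel G) n U y yP).

Lemma assoc_BGE x y : assoc_BG (assoc_class x y) = class_of (BG_rel G) y.
Proof. exact: (@assoc_funE (BG G) (fun _ y => class_of (BG_rel G) y) BG_class_act). Qed.

Section Fibres.
Hypothesis dP : diffeological_principal P.

Lemma assoc_class_inj x y y' : assoc_class x y = assoc_class x y' -> y = y'.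
Proof.
move=> /class_ofP[g /= [e1 ->]].
have -> : g = 1%g by apply: (principal_free dP (x := x)); rewrite -e1 act1.
by rewrite EG_act1.
Qed.

Lemma assoc_at x z : assoc_proj z = proj x -> exists y, z = assoc_class x y.
Proof.
have [x' [y' ->]] := assoc_classP z; rewrite assoc_projE => e.
have [g ->] := principal_point dP e; exists (EG_act y' g).
by rewrite assoc_classE.
Qed.

Lemma EG_act_plot n (U : set 'rV[R]_n) (y : 'rV[R]_n -> EG) (g : 'rV[R]_n -> G) :
  is_plot U y -> is_plot U g -> is_plot U (fun u => EG_act (y u) (g u)).
Proof. by move=> yP gP; apply: (@EG_act_smooth R G n U (fun u => (y u, g u))); split. Qed.

(** The identification of fibres of the associated space with EG by means of x is smooth: locally z
    = [x', y'] and x = x' g with g smooth by [principal_division], so that y = y' g. *)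
Lemma assoc_coord_plot n (U : set 'rV[R]_n) (x : 'rV[R]_n -> P) (z : 'rV[R]_n -> assoc)
    (y : 'rV[R]_n -> EG) :
  is_plot U x -> is_plot U z -> (forall u, U u -> z u = assoc_class (x u) (y u)) ->
  is_plot U y.
Proof.
move=> xP zP zE; apply: plot_glue => u Uu.
have [V [x' [y' [Vu VU x'P y'P zxy]]]] := assoc_plot_lift zP Uu.
have oV := plot_open x'P.
have [g [gP xg]] : exists g, is_plot V g /\ forall v, V v -> x v = act (x' v) (g v).
  apply: (principal_division dP x'P (plot_sub xP oV VU)) => v Vv.
  by rewrite -(assoc_projE (x' v) (y' v)) -zxy // zE ?assoc_projE //; exact: VU.
exists V, (fun v => EG_act (y' v) (g v)); split => //; first exact: EG_act_plot.
move=> v Vv; apply: (@assoc_class_inj (x v)).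
rewrite [in RHS]xg // assoc_classE -zxy // -zE //; exact: VU.
Qed.
End Fibres.
End AssociatedSpace.

(** * The two carriers: graphs of simplices, and associated spaces over boxes *)

Section SimplexCarrier.
Context {R : realType}.
Variable X : dspace R.

Definition graph_carrier p (e : msing (@kihara_model R) X p) :
    set (dprod (@kihara_model R p) X) := [set bx | e bx.1 = bx.2].

(** The graph of e is contracted along with its simplex. D' is affine for the refinement of chains,
    and Kihara's for comparing the restriction of a refinement with the identity. *)
Lemma graph_carrier_acyclic (D' : model R) (cD : conical D') p
  (e : msing (@kihara_model R) X p) : acyclic D' (graph_carrier e).
Proof.
have [H [sH H0 H1 _]] := @simplex_contraction R p.
apply: (contraction_acyclic cD).
  by exists (exist _ _ (vertex_std ord0), e (exist _ _ (vertex_std ord0))).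
move=> m c hc; exists (graph_carrier e), (exist _ _ (vertex_std ord0), e (exist _ _ (vertex_std ord0))).
exists (fun bx s => (H bx.1 s, e (H bx.1 s))); split => //; split => //=.
- move=> n U bx s [b1 _] _ sP; have HP := sH n U _ s b1 sP.
  by split => //; exact: (sm_smooth e HP).
- by move=> [b x] s; rewrite /graph_carrier /= => <- s0; rewrite H0.
- by move=> [b x] s _ s1; rewrite /= H1.
Qed.
End SimplexCarrier.

Section EGPoint.
Context {R : realType} (G : dgroup R).

Lemma inf_vertexP : (forall i, 0 <= sval (finseq_incl (const_mx 1 : 'rV[R]_1)) i) /\
  \sum_(i \in [set: nat]) sval (finseq_incl (const_mx 1 : 'rV[R]_1)) i = 1.
Proof.
split=> [i|]; first by rewrite /= /finseq_incl_fun; case: insubP => //= j _ _; rewrite mxE.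
rewrite (@fsum_ord _ _ 1) => [|i]; last exact: incl_ge.
by rewrite big_ord1 /= /finseq_incl_fun insubT /= mxE.
Qed.

Definition EG_point : EG G :=
  class_of (EG_rel G) (exist _ _ inf_vertexP : @inf_simplex R, fun=> 1%g).
End EGPoint.

Section BundleCarrier.
Context {R : realType} (G : dgroup R).
Variables (X : dspace R) (P : gspace G X).
Hypothesis dP : diffeological_principal P.
Notation affm := (@affine_model R).

Definition in_box p (b : @aff R p) : Prop := forall i, - 2 < sval b 0 i < 2.

(* Restricted to a box, since this is where sections of e^*P are constructed. *)
Definition assoc_carrier p (e : msing affm X p) : set (dprod (affm p) (assoc P)) :=
  [set bz | @in_box p bz.1 /\ e bz.1 = assoc_proj P bz.2].

Lemma assoc_carrier_face p (e : msing affm X p.+1) i b z :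
  assoc_carrier (mface i e) (b, z) -> assoc_carrier e (mcof affm i b, z).
Proof.
move=> [/= h1 h2]; split => //= j; case: (unliftP i j) => [k ->|->].
  by rewrite coface_fun_lift.
by rewrite coface_fun_diag ltr0n andbT oppr_lt0.
Qed.

Lemma aff_retractP p (w : 'rV[R]_p.+1) :
  \sum_i (w + (1 - \sum_j w 0 j) *: vertex ord0) 0 i = 1.
Proof.
rewrite (eq_bigr (fun i => w 0 i + (1 - \sum_j w 0 j) * vertex ord0 0 i)).
  by rewrite big_split /= -mulr_sumr aff_vertexP mulr1 addrC subrK.
by move=> i _; rewrite !mxE.
Qed.

(** [box_section] works over plots on Euclidean spaces, so e is extended to R^(p+1) along this
    retraction; it adds the defect of the coordinate sum to the coordinate 0. *)
Definition aff_retract p (w : 'rV[R]_p.+1) : aff p := exist _ _ (aff_retractP w).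

Lemma aff_retract_plot p : @is_plot R (aff p) p.+1 setT (@aff_retract p).
Proof.
have cf i : @is_plot R dline p.+1 setT (fun w => w 0 i).
  split => [|k]; first exact: openT.
  by apply: (@Cn_coord R _ k setT openT _ idfun); exact: Cn_id.
apply: aff_plotP => [|i]; first exact: openT.
apply: (@plot_ext _ _ (dstruct dline) _ setT (fun w : 'rV[R]_p.+1 =>
    w 0 i + (1 - \sum_j w 0 j) * (vertex ord0 : 'rV[R]_p.+1) 0 i)).
  by move=> w _; rewrite !mxE.
apply: splotD => //; apply: splotM; last exact/splot_cst/openT.
apply: splotB; first exact/splot_cst/openT.
split => [|k]; first exact: openT.
by apply: Cn_sumf => [|j]; [exact: openT|case: (cf j)].
Qed.

Lemma aff_retractK p (b : @aff R p) : aff_retract (sval b) = b.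
Proof.
apply: sval_inj => /=; have hb : \sum_j sval b 0 j = 1 by exact: (svalP b).
by rewrite hb subrr scale0r addr0.
Qed.

Lemma aff_mixP p (b : @aff R p) (s : R) :
  \sum_i ((1 - step s) *: sval b + step s *: vertex ord0) 0 i = 1.
Proof.
rewrite (eq_bigr (fun i => (1 - step s) * sval b 0 i + step s * vertex ord0 0 i)).
  rewrite big_split /= -!mulr_sumr aff_vertexP.
  have hb : \sum_j sval b 0 j = 1 by exact: (svalP b).
  by rewrite hb !mulr1 subrK.
by move=> i _; rewrite !mxE.
Qed.

Definition aff_mix p (b : @aff R p) (s : R) : aff p := exist _ _ (aff_mixP b s).

Lemma aff_mix_plot p n (U : set 'rV[R]_n) (b : 'rV[R]_n -> aff p) s :
  is_plot U b -> @is_plot R dline n U s -> is_plot U (fun u => aff_mix (b u) (s u)).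
Proof.
move=> bP sP; have oU := plot_open bP; apply: aff_plotP => // i.
apply: (@plot_ext _ _ (dstruct dline) n U (fun u => (1 - step (s u)) * sval (b u) 0 i +
    step (s u) * (vertex ord0 : 'rV[R]_p.+1) 0 i)).
  by move=> u _; rewrite !mxE.
have stP := splot_step sP.
apply: splotD; last by apply: splotM => //; exact: splot_cst.
apply: splotM; last exact: aff_coord_plot.
by apply: splotB => //; exact: splot_cst.
Qed.

Lemma aff_mix_box p (b : @aff R p) s : in_box b -> in_box (aff_mix b s).
Proof.
move=> hb i; have /andP[b1 b2] := hb i; have h0 := @step_ge0 R s; have h1 := @step_le1 R s.
have v0 := std_ge0 (exist _ _ (@vertex_std R p ord0)) i.
have v1 := std_le1 (exist _ _ (@vertex_std R p ord0)) i.
have -> : sval (aff_mix b s) 0 i = (1 - step s) * sval b 0 i + step s * vertex ord0 0 i.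
  by rewrite /= !mxE.
move: v0 v1 h0 h1 => /=; move: (step s) (vertex _ _ _) => l v *.
have e1 : 0 <= (1 - l) * (sval b 0 i + 2) by rewrite mulr_ge0; lra.
have e2 : 0 <= (1 - l) * (2 - sval b 0 i) by rewrite mulr_ge0; lra.
have e3 : 0 <= l * v by rewrite mulr_ge0.
have e4 : l * v <= l by rewrite ler_piMr.
have [l1|l1] := eqVneq l 1; first by rewrite l1 subrr mul0r mul1r; apply/andP; split; lra.
have l1' : 0 < 1 - l by rewrite subr_gt0 lt_neqAle l1.
have e5 : 0 < (1 - l) * (sval b 0 i + 2) by rewrite mulr_gt0; lra.
have e6 : 0 < (1 - l) * (2 - sval b 0 i) by rewrite mulr_gt0; lra.
by apply/andP; split; lra.
Qed.

Lemma aff_vertex_box p : in_box (@aff_vertex R p ord0).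
Proof.
move=> i; have v0 := std_ge0 (exist _ _ (@vertex_std R p ord0)) i.
have v1 := std_le1 (exist _ _ (@vertex_std R p ord0)) i.
by move: v0 v1 => /= v0 v1; apply/andP; split; lra.
Qed.

(** A section over the box identifies the carrier with the product of the box and EG, by (b, z) |->
    (b, [Y (b, z)]). Both factors are contracted at the same time, the box to its vertex 0 and EG
    along rays. *)
Lemma assoc_carrier_acyclic p (e : msing affm X p) :
  acyclic (@kihara_model R) (assoc_carrier e).
Proof.
have eP : @is_plot R X p.+1 setT (fun w => e (aff_retract w)).
  exact: (sm_smooth e (@aff_retract_plot p)).
have [sec [secP sec_proj]] := box_section dP eP.
pose sg (b : @aff R p) := sec (sval b).
have sgE b : in_box b -> proj (sg b) = e b.
  by move=> hb; rewrite /sg sec_proj // aff_retractK.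
have sgP n (U : set 'rV[R]_n) (b : 'rV[R]_n -> aff p) :
    is_plot U b -> (forall u, U u -> in_box (b u)) -> is_plot U (fun u => sg (b u)).
  by move=> [oU sb] bb; exact: (plot_comp secP oU sb bb).
have YP bz : exists y, assoc_carrier e bz -> bz.2 = assoc_class (sg bz.1) y.
  have [[h1 h2]|h] := pselect (assoc_carrier e bz); last by exists (EG_point G).
  have [y ->] := assoc_at dP (z := bz.2) (x := sg bz.1) (esym (etrans (sgE _ h1) h2)).
  by exists y.
have [Y hY] := choice YP.
have Y_plot n (U : set 'rV[R]_n) (bz : 'rV[R]_n -> dprod (affm p) (assoc P)) :
    is_plot U bz -> (forall u, U u -> assoc_carrier e (bz u)) -> is_plot U (fun u => Y (bz u)).
  move=> [b1 b2] hbz.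
  apply: (assoc_coord_plot dP (x := fun u => sg (bz u).1) (z := fun u => (bz u).2)) => //.
    by apply: sgP => // u /hbz[].
  by move=> u /hbz /hY.
apply: (contraction_acyclic (@kihara_conical R)).
  exists (aff_vertex ord0, assoc_class (sg (aff_vertex ord0)) (EG_point G)).
  split; first exact: aff_vertex_box.
  exact: esym (etrans (assoc_projE _ _) (sgE _ (@aff_vertex_box p))).
move=> m c hc.
have NP (s : msing (@kihara_model R) (dprod (affm p) (assoc P)) m) :
    exists N, (forall x, assoc_carrier e (s x)) -> forall x, stage N (Y (s x)).
  have [hs|hs] := pselect (forall x, assoc_carrier e (s x)); last by exists 0%N.
  have sm : @dsmooth R (dsimplex m) (EG G) (fun x => Y (s x)).
    by move=> n U x xP; apply: (Y_plot n U (fun u => s (x u))); [exact: (sm_smooth s)|].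
  by have [N hN] := simplex_stage (SmoothMap sm); exists N.
have [N hN] := choice NP.
pose n := (\max_(s <- dom c) N s)%N.
exists [set bz | assoc_carrier e bz /\ stage n (Y bz)].
exists (aff_vertex ord0, assoc_class (sg (aff_vertex ord0)) (EG_ray n (EG_point G) 1)).
exists (fun bz s => (aff_mix bz.1 s, assoc_class (sg (aff_mix bz.1 s)) (EG_ray n (Y bz) s))).
split.
- split; first exact: aff_vertex_box.
  exact: esym (etrans (assoc_projE _ _) (sgE _ (@aff_vertex_box p))).
- move=> s cs x; split; first exact: hc.
  move=> i ni; apply: (hN s); first exact: hc.
  by apply: leq_trans ni; apply: leq_bigmax_seq => //; rewrite mem_dom.
split.
- move=> k U bz s bzP hbz sP; have [bP zP] := bzP.
  have mP := aff_mix_plot bP sP; split => //.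
  apply: assoc_class_plot.
    by apply: sgP => // u /hbz[[h _] _]; exact: aff_mix_box.
  by apply: EG_ray_plot => //; apply: Y_plot => // u /hbz[].
- move=> [b z] s [h hn] s0.
  have mb : aff_mix b s = b by apply: sval_inj; rewrite /= step_le0 // subr0 scale1r scale0r addr0.
  by rewrite /= mb EG_ray_le0 // -(hY (b, z)).
- move=> [b z] s _ s1.
  have mb : aff_mix b s = aff_vertex ord0.
    by apply: sval_inj; rewrite /= step_ge1 // subrr scale0r scale1r add0r.
  by rewrite /= mb (EG_ray_ge1 _ _ (EG_point G)).
- move=> [b z] s [[h1 h2] _]; have hb : in_box (aff_mix b s) by exact: aff_mix_box.
  by split => //; exact: esym (etrans (assoc_projE _ _) (sgE _ hb)).
Qed.
End BundleCarrier.

(** * Refinement of chains *)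

Section ChainHomotopies.
Context {R : realType}.
Implicit Types (D : model R) (X Y Z : dspace R).

Lemma chomo_ext D X D' Z (f f' g g' : forall p, mchain D X p -> mchain D' Z p) :
  (forall p, f p =1 f' p) -> (forall p, g p =1 g' p) -> chomo f g -> chomo f' g'.
Proof.
move=> ff gg [h [h0 hS]]; exists h; split => [c|p c]; first by rewrite -ff -gg h0.
by rewrite -ff -gg hS.
Qed.

Lemma chomo_trans D X D' Z (f g k : forall p, mchain D X p -> mchain D' Z p) :
  chomo f g -> chomo g k -> chomo f k.
Proof.
move=> [h [h0 hS]] [h' [h'0 h'S]]; exists (fun p => h p \+ h' p); split => [c|p c] /=.
  by rewrite -(subrKA (g 0%N c)) h0 h'0 raddfD.
by rewrite -(subrKA (g p.+1 c)) hS h'S raddfD addrACA.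
Qed.

Lemma chomo_precomp D X D' Z D1 Y (f g : forall p, mchain D X p -> mchain D' Z p)
    (k : forall p, {additive mchain D1 Y p -> mchain D X p}) :
  (forall p c, mbd _ _ _ (k p.+1 c) = k p (mbd _ _ _ c)) ->
  chomo f g -> chomo (fun p c => f p (k p c)) (fun p c => g p (k p c)).
Proof.
move=> kbd [h [h0 hS]]; exists (fun p => h p \o k p); split => [c|p c] /=; first exact: h0.
by rewrite hS kbd.
Qed.

Lemma chomo_postcomp D X D' Z D1 Y (f g : forall p, mchain D X p -> mchain D' Z p)
    (k : forall p, {additive mchain D' Z p -> mchain D1 Y p}) :
  (forall p c, mbd _ _ _ (k p.+1 c) = k p (mbd _ _ _ c)) ->
  chomo f g -> chomo (fun p c => k p (f p c)) (fun p c => k p (g p c)).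
Proof.
move=> kbd [h [h0 hS]]; exists (fun p => k p.+1 \o h p); split => [c|p c] /=.
  by rewrite -raddfB h0 kbd.
by rewrite -raddfB hS raddfD /= kbd.
Qed.

Section Systems.
Variables (D D' : model R).

Lemma carried_precomp X X' Z (B : forall p, msing D X p -> set (dprod (D p) Z))
    (f : smooth_map X' X) (L : system D D' X Z) :
  carried B L ->
  carried (fun p (e : msing D X' p) => B p (smooth_comp f e))
    ((fun p (e : msing D X' p) => L p (smooth_comp f e)) : system D D' X' Z).
Proof.
move=> [h1 h2 h3]; split => // p s; rewrite h3; apply: eq_bigr => i _.
by congr (_ *: mmap _ _ (L p _)); exact: smooth_map_eq.
Qed.

Lemma induced_precomp X X' Z (f : smooth_map X' X) (L : system D D' X Z) p c :
  induced ((fun p (e : msing D X' p) => L p (smooth_comp f e)) : system D D' X' Z) p c =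
  induced L p (mmap f p c).
Proof.
apply: (@freeg_ext _ _ (induced _ p) (induced L p \o mmap f p)) => s.
by rewrite [LHS]inducedU -[RHS]/(induced L p (mmap f p << s >>)) mmapU inducedU.
Qed.

Lemma prod_map_smooth X Z Z' (F : smooth_map Z Z') :
  @dsmooth R (dprod X Z) (dprod X Z') (fun xz => (xz.1, F xz.2)).
Proof. by move=> n U x [x1 x2]; split => //; exact: (sm_smooth F). Qed.
Definition prod_map X Z Z' (F : smooth_map Z Z') := SmoothMap (@prod_map_smooth X Z Z' F).

Lemma carried_postcomp X Z Z' (B : forall p, msing D X p -> set (dprod (D p) Z))
    (B' : forall p, msing D X p -> set (dprod (D p) Z')) (F : smooth_map Z Z')
    (L : system D D' X Z) :
  (forall p (e : msing D X p) b z, B p e (b, z) -> B' p e (b, F z)) ->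
  carried B L ->
  carried B' ((fun p e => mmap (prod_map (D p) F) p (L p e)) : system D D' X Z').
Proof.
move=> BB' [h1 h2 h3]; split.
- by move=> p s; apply: supp_mmap (h1 p s) => -[b z]; exact: BB'.
- by move=> s; rewrite mmap_deg.
- move=> p s; rewrite -mmap_bd h3 raddf_sum; apply: eq_bigr => i _.
  by rewrite raddfZsign !mmap_comp; congr (_ *: mmap _ _ _); exact: smooth_map_eq.
Qed.

Lemma induced_postcomp X Z Z' (F : smooth_map Z Z') (L : system D D' X Z) p c :
  induced ((fun p e => mmap (prod_map (D p) F) p (L p e)) : system D D' X Z') p c =
  mmap F p (induced L p c).
Proof.
apply: (@freeg_ext _ _ (induced _ p) (mmap F p \o induced L p)) => s.
rewrite [LHS]inducedU -[RHS]/(mmap F p (induced L p << s >>)) inducedU !mmap_comp.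
by congr (mmap _ _ _); exact: smooth_map_eq.
Qed.
End Systems.

Lemma simplex_aff_smooth p :
  @dsmooth R (dsimplex p) (aff p) (fun x => exist _ (sval x) (svalP x).1).
Proof.
move=> n U x xP; apply: aff_plotP => [|i]; first exact: plot_open xP.
exact: simplex_coord_plot.
Qed.
Definition simplex_aff p : smooth_map (@kihara_model R p) (@affine_model R p) :=
  SmoothMap (@simplex_aff_smooth p).

Definition restrict X p : {additive mchain (@affine_model R) X p -> mchain (@kihara_model R) X p} :=
  fglift (fun e : msing (@affine_model R) X p =>
    << (smooth_comp e (simplex_aff p) : msing (@kihara_model R) X p) >>).

Lemma restrictU X p (e : msing (@affine_model R) X p) :
  restrict X p << e >> = << (smooth_comp e (simplex_aff p) : msing (@kihara_model R) X p) >>.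
Proof. exact: fgliftU. Qed.

Lemma simplex_aff_cof p (i : 'I_p.+2) x :
  simplex_aff p.+1 (mcof (@kihara_model R) i x) = mcof (@affine_model R) i (simplex_aff p x).
Proof. exact: sval_inj. Qed.

Lemma restrict_bd X p c : mbd _ _ _ (restrict X p.+1 c) = restrict X p (mbd _ _ _ c).
Proof.
apply: (@freeg_ext _ _ (mbd _ _ _ \o restrict X p.+1) (restrict X p \o mbd _ _ _)) => e /=.
rewrite restrictU !mbdU raddf_sum; apply: eq_bigr => i _.
rewrite raddfZsign restrictU; congr (_ *: << _ >>).
by apply: smooth_map_eq => x /=; rewrite -[LHS]/(e (simplex_aff p.+1 (mcof (@kihara_model R) i x)))
  simplex_aff_cof.
Qed.

Lemma restrict_mmap X Y (f : smooth_map X Y) p c :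
  restrict Y p (mmap f p c) = mmap f p (restrict X p c).
Proof.
apply: (@freeg_ext _ _ (restrict Y p \o mmap f p) (mmap f p \o restrict X p)) => e /=.
by rewrite restrictU !mmapU restrictU; congr (<< _ >>); exact: smooth_map_eq.
Qed.

Lemma restrict_deg X p c : deg (restrict X p c) = deg c.
Proof.
apply: (@freeg_ext (msing (@affine_model R) X p) int (@deg _ \o restrict X p) (@deg _)) => e.
by rewrite /= restrictU !degU.
Qed.

Lemma supp_restrict X p (B : set X) c : supp B c -> supp B (restrict X p c).
Proof.
apply: supp_additive; [exact: supp0|exact: suppD| |].
  by move=> a z; exact: suppMz.
by move=> e Be; rewrite restrictU; apply: suppU => x /=; exact: Be.
Qed.

Section Refinement.
Variable X : dspace R.

Lemma refine_ex : exists k : system (@kihara_model R) (@affine_model R) X X,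
  carried (fun p e => graph_carrier e) k.
Proof.
apply: carried_ex => [p e i b z|p e]; first by [].
exact: graph_carrier_acyclic affine_conical _ _.
Qed.

(** The restriction of k and the identity, in the form b |-> (b, e b), are carried by the same
    graphs. *)
Lemma restrict_refine (k : system (@kihara_model R) (@affine_model R) X X) :
  carried (fun p e => graph_carrier e) k ->
  chomo (fun p c => restrict X p (induced k p c)) (fun p c => c).
Proof.
move=> [h1 h2 h3].
have pair_smooth p (e : msing (@kihara_model R) X p) :
    @dsmooth R _ (dprod (@kihara_model R p) X) (fun b => (b, e b)).
  by move=> n U b bP; split => //; exact: (sm_smooth e).
pose L2 : system (@kihara_model R) (@kihara_model R) X X := fun p e =>
  << (SmoothMap (pair_smooth p e) : msing (@kihara_model R) (dprod (@kihara_model R p) X) p) >>.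
pose L1 : system (@kihara_model R) (@kihara_model R) X X := fun p e => restrict _ p (k p e).
have c1 : carried (fun p e => graph_carrier e) L1.
  split.
  - by move=> p e; exact: supp_restrict.
  - by move=> e; rewrite /L1 restrict_deg.
  - move=> p e; rewrite /L1 restrict_bd h3 raddf_sum; apply: eq_bigr => i _.
    by rewrite raddfZsign restrict_mmap.
have c2 : carried (fun p e => graph_carrier e) L2.
  split.
  - by move=> p e; exact: suppU.
  - by move=> e; rewrite /L2 degU.
  - move=> p e; rewrite /L2 mbdU; apply: eq_bigr => i _.
    by rewrite mmapU; congr (_ *: << _ >>); exact: smooth_map_eq.
have := carried_unique _ _ c1 c2; move=> /(_ (fun p e i b z h => h)
  (fun p e => graph_carrier_acyclic (@kihara_conical R) e)).
apply: chomo_ext => p c.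
  apply: (@freeg_ext _ _ (induced L1 p) (restrict X p \o induced k p)) => e /=.
  by rewrite !inducedU restrict_mmap.
apply: (@freeg_ext _ _ (induced L2 p) idfun) => e /=.
by rewrite inducedU mmapU; congr (<< _ >>); exact: smooth_map_eq.
Qed.
End Refinement.

(** Over e, both chain maps are carried by the graph of f o e. *)
Lemma refine_natural X Y (f : smooth_map X Y)
    (k : system (@kihara_model R) (@affine_model R) X X)
    (k' : system (@kihara_model R) (@affine_model R) Y Y) :
  carried (fun p e => graph_carrier e) k -> carried (fun p e => graph_carrier e) k' ->
  chomo (fun p c => mmap f p (induced k p c)) (fun p c => induced k' p (mmap f p c)).
Proof.
move=> ck ck'.
have c1 := @carried_postcomp _ _ _ _ _ _
  (fun p (e : msing (@kihara_model R) X p) => graph_carrier (smooth_comp f e : msing _ Y p)) f k _ ck.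
have {}c1 := c1 (fun p e b z h => congr1 f h).
have c2 := carried_precomp f ck'.
have := carried_unique _ _ c1 c2; move=> /(_ (fun p e i b z h => h)
  (fun p e => graph_carrier_acyclic affine_conical (smooth_comp f e))).
by apply: chomo_ext => p c; [exact: induced_postcomp|exact: induced_precomp].
Qed.
End ChainHomotopies.

(** * The characteristic class *)

Section CharacteristicClass.
Context {R : realType} (G : dgroup R).
Notation K := (@kihara_model R).
Notation aff := (@affine_model R).

Section Bundle.
Variables (X : dspace R) (P : gspace G X).
Hypothesis dP : diffeological_principal P.

Lemma assoc_lift_ex : exists L : system aff K X (assoc P),
  carried (fun p e => assoc_carrier e) L.
Proof.
apply: carried_ex => [p e i b z|p e]; first exact: assoc_carrier_face.
exact: assoc_carrier_acyclic.
Qed.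

(** Composition with s is carried too: b |-> (b, s (e b)) lies over e, and the points b of the
    simplex lie in the box. *)
Lemma assoc_lift_section (s : smooth_map X (assoc P)) (L : system aff K X (assoc P)) :
  (forall x, assoc_proj P (s x) = x) ->
  carried (fun p e => assoc_carrier e) L ->
  chomo (fun p c => induced L p c) (fun p c => mmap s p (restrict X p c)).
Proof.
move=> sK cL.
have pair_smooth p (e : msing aff X p) :
    @dsmooth R (K p) (dprod (aff p) (assoc P)) (fun b => (simplex_aff p b, s (e (simplex_aff p b)))).
  move=> n U b bP; have h := sm_smooth (simplex_aff p) bP.
  by split => //; exact: (sm_smooth s (sm_smooth e h)).
pose L' : system aff K X (assoc P) := fun p e =>
  << (SmoothMap (pair_smooth p e) : msing K (dprod (aff p) (assoc P)) p) >>.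
have cL' : carried (fun p e => assoc_carrier e) L'.
  split.
  - move=> p e; apply: suppU => b; split; last exact: esym (sK _).
    move=> i; have := std_ge0 b i; have := std_le1 b i; rewrite /= => h1 h2.
    by apply/andP; split; lra.
  - by move=> e; rewrite /L' degU.
  - move=> p e; rewrite /L' mbdU; apply: eq_bigr => i _.
    rewrite mmapU; congr (_ *: << _ >>); apply: smooth_map_eq => b /=.
    have -> : (exist _ _ (svalP (coface i b)).1 : aff p.+1) =
        aff_coface i (exist _ (sval b) (svalP b).1) by exact: sval_inj.
    by [].
have := carried_unique (fun p e i b z => @assoc_carrier_face R G X P p e i b z)
  (fun p e => assoc_carrier_acyclic dP e) cL cL'.
apply: chomo_ext => p c //.
apply: (@freeg_ext _ _ (induced L' p) (mmap s p \o restrict X p)) => e.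
rewrite [LHS]inducedU -[RHS]/(mmap s p (restrict X p << e >>)) restrictU !mmapU.
by congr (<< _ >>); exact: smooth_map_eq.
Qed.
(** The isomorphism yields an equivariant map y from P to EG over f, and the class [x, y x] depends
    only on the fibre of x. Local sections of P along plots show that it is smooth in the base
    point. *)
Lemma classifying_section (f : smooth_map X (BG G)) : classifying P f ->
  exists s : smooth_map X (assoc P),
    (forall x, assoc_proj P (s x) = x) /\ (forall x, assoc_BG P (s x) = f x).
Proof.
move=> [h [h' [hK h'K h_act h_proj]]].
pose y x := (sval (h' x)).2.
have h'_act x g : h' (act x g) = act (h' x) g by rewrite -[RHS]hK h_act h'K.
have y_act x g : y (act x g) = EG_act (y x) g by rewrite /y h'_act.
have yP x : class_of (BG_rel G) (y x) = f (proj x).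
  by have /= <- := svalP (h' x); have /= <- := h_proj (h' x); rewrite h'K.
have y_plot n (U : set 'rV[R]_n) (x : 'rV[R]_n -> P) : is_plot U x -> is_plot U (fun u => y (x u)).
  by move=> xP; have [] := sm_smooth h' xP.
have [e he] := choice (principal_fibre dP).
have sE x z : proj z = x -> assoc_class (e x) (y (e x)) = assoc_class z (y z).
  move=> zx; have [g ->] := principal_point dP (etrans zx (esym (he x))).
  by rewrite y_act assoc_classE.
have sm : @dsmooth R X (assoc P) (fun x => assoc_class (e x) (y (e x))).
  move=> n U x xP; apply: plot_glue => u Uu.
  have [V [sec [Vu VU sP sp]]] := principal_section dP xP Uu.
  exists V, (fun v => assoc_class (sec v) (y (sec v))); split => //.
    by apply: assoc_class_plot => //; exact: y_plot.
  by move=> v Vv; apply: sE; exact: sp.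
exists (SmoothMap sm); split => x.
  by rewrite [LHS]assoc_projE he.
by rewrite [LHS]assoc_BGE yP he.
Qed.
End Bundle.

(** The isomorphism yields an equivariant map from Q to P over f; its product with the identity of
    EG descends to the associated spaces. *)
Lemma pullback_assoc_map (X Y : dspace R) (f : smooth_map Y X) (P : gspace G X)
    (Q : gspace G Y) : giso Q (pullback f P) ->
  exists F : smooth_map (assoc Q) (assoc P),
    (forall z, assoc_proj P (F z) = f (assoc_proj Q z)) /\
    (forall z, assoc_BG P (F z) = assoc_BG Q z).
Proof.
move=> [h [h' [_ _ h_act h_proj]]].
pose F x := (sval (h x)).2.
have F_act x g : F (act x g) = act (F x) g by rewrite /F h_act.
have F_proj x : proj (F x) = f (proj x).
  by have /= <- := svalP (h x); have /= <- := h_proj x.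
have F_plot n (U : set 'rV[R]_n) (x : 'rV[R]_n -> Q) : is_plot U x -> is_plot U (fun u => F (x u)).
  by move=> xP; have [] := sm_smooth h xP.
have A x y g : assoc_class (F (act x g)) (EG_act y g) = assoc_class (F x) y.
  by rewrite F_act assoc_classE.
have B n (U : set 'rV[R]_n) (x : 'rV[R]_n -> Q) (y : 'rV[R]_n -> EG G) :
    is_plot U x -> is_plot U y -> is_plot U (fun u => assoc_class (F (x u)) (y u)).
  by move=> xP yP; apply: assoc_class_plot => //; exact: F_plot.
have FE x y : assoc_elim A B (assoc_class x y) = assoc_class (F x) y by exact: (assoc_funE A).
exists (assoc_elim A B); split => z; have [x [y ->]] := assoc_classP z; rewrite FE.
  by rewrite !assoc_projE F_proj.
by rewrite !assoc_BGE.
Qed.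

Section ClassOfChainMap.
Variables (A : zmodType) (k : nat).

Section Along.
Variables (X Z : dspace R) (phi : forall p, {additive chain X p -> chain Z p}).
Hypothesis phi_bd : forall p c, boundary Z p (phi p.+1 c) = phi p (boundary X p c).
Variable z : cocycle Z A k.

Lemma cocycle_along_proof (c : chain X k.+1) : (z \o phi k) (boundary X k c) = 0.
Proof. by rewrite /= -phi_bd cocycleP. Qed.

Definition cocycle_along : cocycle X A k := @Cocycle R X A k (z \o phi k) cocycle_along_proof.
End Along.

(** As z vanishes on boundaries, z o h is a primitive of the difference; in degree 0 the difference
    itself vanishes. *)
Lemma chomo_cohomologous (X Z : dspace R)
    (phi psi : forall p, mchain K X p -> mchain K Z p) (z : cocycle Z A k) (a b : cocycle X A k) :
  chomo phi psi -> (forall c, a c = z (phi k c)) -> (forall c, b c = z (psi k c)) ->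
  class_of (cohomologous_eqrel X A k) a = class_of (cohomologous_eqrel X A k) b.
Proof.
move=> [h [h0 hS]] ha hb; apply/class_ofP; rewrite /= /cohomologous.
move: z a b ha hb; case: k => [|q] z a b ha hb /=.
  by move=> c; rewrite ha hb -raddfB h0; exact: cocycleP.
exists (z \o h q) => c; rewrite ha hb -raddfB hS raddfD /=.
by rewrite [X in X + _](cocycleP z) add0r.
Qed.
End ClassOfChainMap.

Section Construction.
Variables (A : zmodType) (k : nat) (alpha : cohomology (BG G) A k).
Variables (X : dspace R) (P : gspace G X) (dP : diffeological_principal P).

Definition refine : system K aff X X := sval (cid (refine_ex X)).
Lemma refineP : carried (fun p e => graph_carrier e) refine.
Proof. exact: (svalP (cid (refine_ex X))). Qed.

Definition assoc_lift : system aff K X (assoc P) := sval (cid (assoc_lift_ex dP)).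
Lemma assoc_liftP : carried (fun p e => assoc_carrier e) assoc_lift.
Proof. exact: (svalP (cid (assoc_lift_ex dP))). Qed.

Definition class_chain_map p : {additive chain X p -> chain (BG G) p} :=
  mmap (assoc_BG P) p \o (induced assoc_lift p \o induced refine p).

Lemma class_chain_map_bd p c :
  boundary (BG G) p (class_chain_map p.+1 c) = class_chain_map p (boundary X p c).
Proof.
rewrite -[LHS]/(mbd K _ _ (mmap (assoc_BG P) p.+1 (induced assoc_lift p.+1 (induced refine p.+1 c)))).
by rewrite -mmap_bd (induced_bd _ assoc_liftP) (induced_bd _ refineP).
Qed.

Definition bundle_class : cohomology X A k :=
  class_of (cohomologous_eqrel X A k)
    (cocycle_along class_chain_map_bd (Defs.repr_of alpha)).
End Construction.
End CharacteristicClass.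

Theorem proposition1p4 (R : realType) (G : dgroup R) (A : zmodType) (k : nat)
    (alpha : cohomology (BG G) A k) :
  exists a : class_rule (@diffeological_principal R G) A k,
    characteristic_class a /\
    (forall (X : dspace R) (P : gspace G X) (dP : diffeological_principal P)
        (f_P : smooth_map X (BG G)),
      D_numerable P -> classifying P f_P ->
      a X P dP = cohomology_pull f_P alpha).
Proof.
exists (fun X P dP => bundle_class alpha dP); split.
  move=> X Y f P Q dP dQ PQ.
  have [F [F_proj F_BG]] := pullback_assoc_map PQ.
  have cX := refineP X; have cY := refineP Y.
  have lP := assoc_liftP dP; have lQ := assoc_liftP dQ.
  rewrite /bundle_class cohomology_pullE.
  (* Over a simplex e of Y both sides are carried by the associated space of P over f o e. *)
  have hL : chomo (fun p c => mmap F p (induced (assoc_lift dQ) p c))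
      (fun p c => induced (assoc_lift dP) p (mmap f p c)).
    have c1 := @carried_postcomp _ _ _ _ _ _ _
      (fun p (e : msing (@affine_model R) Y p) => assoc_carrier (smooth_comp f e) : set (dprod _ (assoc P)))
      F (assoc_lift dQ) _ lQ.
    have {}c1 := c1 (fun p e b z h => conj h.1 (etrans (congr1 f h.2) (esym (F_proj z)))).
    have c2 := carried_precomp f lP.
    have := carried_unique _ _ c1 c2.
    move=> /(_ (fun p e i b z => @assoc_carrier_face R G X P p (smooth_comp f e) i b z)
      (fun p e => assoc_carrier_acyclic dP (smooth_comp f e))).
    by apply: chomo_ext => p c; [exact: induced_postcomp|exact: induced_precomp].
  have h1 := chomo_precomp (fun p c => induced_bd c cY) hL.
  have h2 := chomo_postcomp (fun p c => induced_bd c lP) (refine_natural f cY cX).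
  (* With lifts L and refinements k: F L_Q k_Y is homotopic to L_P f k_Y by [hL], and then to L_P
     k_X f by naturality of refinement. *)
  have h3 := chomo_postcomp (fun p c => esym (mmap_bd (assoc_BG P) c)) (chomo_trans h1 h2).
  have e : smooth_comp (assoc_BG P) F = assoc_BG Q.
    by apply: smooth_map_eq => z; exact: F_BG.
  by apply: (chomo_cohomologous (z := Defs.repr_of alpha) h3) => // c; rewrite mmap_comp e.
move=> X P dP f _ /(classifying_section dP)[s [sK sf]].
rewrite -[in RHS](Defs.repr_ofK alpha) cohomology_pullE.
have cX := refineP X; have lP := assoc_liftP dP.
(* The lift is homotopic to restriction followed by s, and restriction after refinement to the
   identity; what remains is composition with s and then with [assoc_BG P], that is, with f. *)
have h1 := chomo_precomp (fun p c => induced_bd c cX) (assoc_lift_section dP sK lP).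
have h2 := chomo_postcomp (fun p c => esym (mmap_bd s c)) (restrict_refine cX).
have h3 := chomo_postcomp (fun p c => esym (mmap_bd (assoc_BG P) c)) (chomo_trans h1 h2).
have e : smooth_comp (assoc_BG P) s = f by apply: smooth_map_eq => x; exact: sf.
by apply: (chomo_cohomologous (z := Defs.repr_of alpha) h3) => // c; rewrite mmap_comp e.
Qed.
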